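(* Let $X$ be a nonempty open subset of $\mathbb R^\omega$. Then the hyperspace $\mathrm{mpcc}(X)$ of all nonempty compact max-plus convex subsets of $\mathbb R^\omega$ contained in $X$ is homeomorphic to $X$.
   Context: For $x,y\in\mathbb R^\omega$ and $\lambda\in\mathbb R_{\max}=\mathbb R\cup\{-\infty\}$, $x\oplus y$ denotes the coordinatewise maximum and $\lambda\odot x$ the vector obtained by adding $\lambda$ to every coordinate. A subset $A\subset\mathbb R^\omega$ is max-plus convex if $\alpha\odot a\oplus\beta\odot b\in A$ for all $a,b\in A$ and $\alpha,\beta\in\mathbb R_{\max}$ with $\max(\alpha,\beta)=0$. $\mathrm{mpcc}(\mathbb R^\omega)$ is the set of nonempty compact max-plus convex subsets of $\mathbb R^\omega$ (product topology) with the Vietoris (equivalently Hausdorff metric) topology, and $\mathrm{mpcc}(X)=\{A\in\mathrm{mpcc}(\mathbb R^\omega): A\subset X\}$ with the subspace topology. *)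

(* Defs.v *)
From Stdlib Require Import Reals List.
Open Scope R_scope.

Definition Rw : Type := nat -> R.

Definition topology (T : Type) : Type := (T -> Prop) -> Prop.

Definition prod_open : topology Rw :=
  fun U => forall x, U x -> exists (N : nat) (eps : R), 0 < eps /\
    forall y, (forall n, (n < N)%nat -> Rabs (y n - x n) < eps) -> U y.

Definition subspace_top {T : Type} (tau : topology T) (P : T -> Prop)
  : topology {x : T | P x} :=
  fun W => exists V, tau V /\ forall z : {x : T | P x}, W z <-> V (proj1_sig z).

Definition compact {T : Type} (tau : topology T) (K : T -> Prop) : Prop :=
  forall (I : Type) (U : I -> T -> Prop),
    (forall i, tau (U i)) ->
    (forall x, K x -> exists i, U i x) ->
    exists l : list I, forall x, K x -> exists i, In i l /\ U i x.

Definition mp_comb (alpha beta : R) (a b : Rw) : Rw :=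
  fun n => Rmax (alpha + a n) (beta + b n).

(* max-plus convexity.  Only finite alpha, beta are quantified: when one of
   them is -infinity the other is 0 and the combination is a or b itself,
   which lies in A trivially. *)
Definition mp_convex (A : Rw -> Prop) : Prop :=
  forall (a b : Rw) (alpha beta : R),
    A a -> A b -> Rmax alpha beta = 0 -> A (mp_comb alpha beta a b).

Definition upper_set (U : Rw -> Prop) : (Rw -> Prop) -> Prop :=
  fun A => forall x, A x -> U x.
Definition lower_set (U : Rw -> Prop) : (Rw -> Prop) -> Prop :=
  fun A => exists x, A x /\ U x.

Definition vietoris_subbasic (S : (Rw -> Prop) -> Prop) : Prop :=
  exists U, prod_open U /\
    ((forall A, S A <-> upper_set U A) \/ (forall A, S A <-> lower_set U A)).

Definition vietoris_open : topology (Rw -> Prop) :=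
  fun W => forall A, W A ->
    exists l : list ((Rw -> Prop) -> Prop),
      (forall S, In S l -> vietoris_subbasic S) /\
      (forall S, In S l -> S A) /\
      (forall B, (forall S, In S l -> S B) -> W B).

Definition mpcc (X : Rw -> Prop) (A : Rw -> Prop) : Prop :=
  (exists x, A x) /\ compact prod_open A /\ mp_convex A /\
  (forall x, A x -> X x).

Definition continuous {T1 T2 : Type} (tau1 : topology T1) (tau2 : topology T2)
  (f : T1 -> T2) : Prop :=
  forall V, tau2 V -> tau1 (fun x => V (f x)).

Definition homeomorphic {T1 T2 : Type} (tau1 : topology T1) (tau2 : topology T2)
  : Prop :=
  exists (f : T1 -> T2) (g : T2 -> T1),
    (forall x, g (f x) = x) /\ (forall y, f (g y) = y) /\
    continuous tau1 tau2 f /\ continuous tau2 tau1 g.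

(* Main.v *)
Require Import Defs.
From Stdlib Require Import Reals List.
From Stdlib Require Import Lra Lia Classical ClassicalEpsilon.
From Stdlib Require Import FunctionalExtensionality PropExtensionality Cantor.
Local Open Scope R_scope.

(** A set [A] in mpcc(X) has a greatest element [x], and [A |-> (x, U)] with
    [U = {exp (a - x) : a in A}] identifies mpcc(X) with a space of pairs, where [U] is a
    closed max-times convex subset of the cube containing the constant [1], with every
    coordinate bounded away from [0] and a positive margin [mu x U] separating
    [x + ln U] from the complement of [X].  The pairs with [U = {1}] form a copy of [X].

    Spaces of pairs with a positive margin absorb a factor [R^w]: the margin, seen
    through finitely many coordinates, tells from which coordinate on [x] may be mixed
    with an additional sequence.  Half-lines are absorbed by [R^w], so one may adjoin
    parameters [p >= 0], [v > 0] and replace the two openness conditions on [U] by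
    [U_i >= 1 / (1 + p_i)] and [v * mu x U > 1].

    Over each base point [(x, p, v)] the sets [U] form a complete space which is the limit
    of finite-dimensional approximations: [U] is approximately recovered, by a
    convex mixture followed by a truncation, from its distances to a finite net.
    A sequence [(x_n)] of perturbed distance vectors of [U], with summable errors, is
    then the same as a sequence in which [x_(n+1)] is a perturbation of the distance
    vector of the set recovered from [x_n]: [U] is the limit of the recovered sets.
    In the first reading the sequence carries the factor [U] and errors in boxes, in the
    second one only errors in boxes.  Hence the pairs (base point, [U]) and the base points
    become homeomorphic after multiplication by [R^w], whatever the fibres; the fibres
    [{{1}}] give the same conclusion, and comparing the two cases finishes the proof. *)

(** * Sequential spaces *)

(** The obstacle is that the two readings cut out different sets: small errors in one need not meet
    the bounds of the other. So errors are bounded by [tol eta n] with [eta] a free positive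
    sequence. The errors of a point in the other reading form a null sequence varying continuously
    with the point, and the parameters dominating a null sequence [t] form a product of half-lines
    [eta k > Lam t k]. A second parameter can thus be adjoined with the other bounds imposed, at no
    cost; from either side this produces the same points with two parameters.

    Scales: nets have mesh [/ 8 ^ n], box radii are [tol eta n / 4 ^ n], and
    [tol eta n >= (/ 2) ^ n] lets the radius absorb the mesh. A mixture recovered from distances may
    leave [X]; truncation at level [k] moves it towards [{1}], which lies inside by the condition on
    the base point. What is required of [v] times the margin is [1 + (/ 3) ^ n * (1 - k)]. Since
    [(/ 3) ^ n] decays more slowly than [/ 4 ^ n], the drop of this threshold between late stages
    pays for the new error: levels no longer rise, the recovered sets are Cauchy, and the limit
    keeps a positive reserve. *)

Record space := Space { pt :> Type; lim : (nat -> pt) -> pt -> Prop }.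

Definition Rsp : space := Space R Un_cv.
Definition prodS (S1 S2 : space) : space :=
  Space (S1 * S2) (fun u x => lim S1 (fun j => fst (u j)) (fst x) /\
                              lim S2 (fun j => snd (u j)) (snd x)).
Definition powS (I : Type) (S : space) : space :=
  Space (I -> S) (fun u x => forall i, lim S (fun j => u j i) (x i)).
Definition Rws : space := powS nat Rsp.
Definition metS (M : Type) (d : M -> M -> R) : space :=
  Space M (fun u x => Un_cv (fun j => d (u j) x) 0).

(** Convergent sequences are the only structure kept: the subspaces that matter are metrizable, and
    open sets return only in [heq_homeomorphic]. Subsets are predicates and maps are total, with
    irrelevant values outside, which avoids dependent pairs. *)
Definition cont {S S' : space} (P : S -> Prop) (f : S -> S') : Prop :=
  forall u x, (forall j, P (u j)) -> P x -> lim S u x ->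
    lim S' (fun j => f (u j)) (f x).

Definition heq (S S' : space) (P : S -> Prop) (P' : S' -> Prop) : Prop :=
  exists (f : S -> S') (g : S' -> S),
    (forall x, P x -> P' (f x) /\ g (f x) = x) /\
    (forall y, P' y -> P (g y) /\ f (g y) = y) /\
    cont P f /\ cont P' g.
Arguments heq {S S'} P P'.

Definition full {S : Type} : S -> Prop := fun _ => True.
Definition prodP {A B : Type} (P : A -> Prop) (Q : B -> Prop) : A * B -> Prop :=
  fun z => P (fst z) /\ Q (snd z).

Lemma heq_refl (S : space) (P : S -> Prop) : heq P P.
Proof.
  exists (fun x => x), (fun x => x). repeat split; auto; intros u x _ _ H; exact H.
Qed.

Lemma heq_sym (S S' : space) (P : S -> Prop) (P' : S' -> Prop) :
  heq P P' -> heq P' P.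
Proof. intros (f & g & H1 & H2 & H3 & H4). exists g, f. auto. Qed.

Lemma heq_trans (S1 S2 S3 : space) (P1 : S1 -> Prop) (P2 : S2 -> Prop)
  (P3 : S3 -> Prop) : heq P1 P2 -> heq P2 P3 -> heq P1 P3.
Proof.
  intros (f & g & H1 & H2 & H3 & H4) (f' & g' & K1 & K2 & K3 & K4).
  exists (fun x => f' (f x)), (fun x => g (g' x)). repeat split.
  - apply K1, H1, H.
  - destruct (H1 x H) as [Hx E]. destruct (K1 _ Hx) as [_ E']. rewrite E'. exact E.
  - apply H2, K2, H.
  - destruct (K2 y H) as [Hx E]. destruct (H2 _ Hx) as [_ E']. rewrite E'. exact E.
  - intros u x Hu Hx L. apply K3. intro j; apply H1, Hu. apply H1, Hx. apply H3; auto.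
  - intros u x Hu Hx L. apply H4. intro j; apply K2, Hu. apply K2, Hx. apply K4; auto.
Qed.

Lemma heq_prod (S1 S2 T1 T2 : space) (P1 : S1 -> Prop) (P2 : S2 -> Prop)
  (Q1 : T1 -> Prop) (Q2 : T2 -> Prop) :
  heq P1 P2 -> heq Q1 Q2 ->
  heq (S := prodS S1 T1) (S' := prodS S2 T2) (prodP P1 Q1) (prodP P2 Q2).
Proof.
  intros (f & g & H1 & H2 & H3 & H4) (f' & g' & K1 & K2 & K3 & K4).
  exists (fun z => (f (fst z), f' (snd z))), (fun z => (g (fst z), g' (snd z))).
  split; [|split; [|split]].
  - intros [a b] [Ha Hb]; cbn in *. destruct (H1 a Ha), (K1 b Hb).
    split; [split; auto|]; cbn; try congruence.
  - intros [a b] [Ha Hb]; cbn in *. destruct (H2 a Ha), (K2 b Hb).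
    split; [split; auto|]; cbn; try congruence.
  - intros u x Hu Hx [L1 L2]. split; cbn.
    apply (H3 (fun j => fst (u j))); auto. intro j; apply Hu. apply Hx.
    apply (K3 (fun j => snd (u j))); auto. intro j; apply Hu. apply Hx.
  - intros u x Hu Hx [L1 L2]. split; cbn.
    apply (H4 (fun j => fst (u j))); auto. intro j; apply Hu. apply Hx.
    apply (K4 (fun j => snd (u j))); auto. intro j; apply Hu. apply Hx.
Qed.

Lemma heq_assoc (S1 S2 S3 : space) (P1 : S1 -> Prop) (P2 : S2 -> Prop)
  (P3 : S3 -> Prop) :
  heq (S := prodS (prodS S1 S2) S3) (S' := prodS S1 (prodS S2 S3))
    (prodP (prodP P1 P2) P3) (prodP P1 (prodP P2 P3)).
Proof.
  exists (fun z => (fst (fst z), (snd (fst z), snd z))),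
    (fun z => ((fst z, fst (snd z)), snd (snd z))).
  split; [|split; [|split]].
  - intros [[a b] c] [[Ha Hb] Hc]; cbn in *; repeat split; auto.
  - intros [a [b c]] [Ha [Hb Hc]]; cbn in *; repeat split; auto.
  - intros u x _ _ [[L1 L2] L3]. repeat split; auto.
  - intros u x _ _ [L1 [L2 L3]]. repeat split; auto.
Qed.

Lemma heq_comm (S1 S2 : space) (P1 : S1 -> Prop) (P2 : S2 -> Prop) :
  heq (S := prodS S1 S2) (S' := prodS S2 S1) (prodP P1 P2) (prodP P2 P1).
Proof.
  exists (fun z => (snd z, fst z)), (fun z => (snd z, fst z)).
  split; [|split; [|split]].
  - intros [a b] [Ha Hb]; cbn in *; repeat split; auto.
  - intros [a b] [Ha Hb]; cbn in *; repeat split; auto.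
  - intros u x _ _ [L1 L2]. repeat split; auto.
  - intros u x _ _ [L1 L2]. repeat split; auto.
Qed.

Lemma heq_pow (I : Type) (S S' : space) (P : S -> Prop) (P' : S' -> Prop) :
  heq P P' ->
  heq (S := powS I S) (S' := powS I S') (fun x => forall i, P (x i))
    (fun x => forall i, P' (x i)).
Proof.
  intros (f & g & H1 & H2 & H3 & H4).
  exists (fun x i => f (x i)), (fun x i => g (x i)). split; [|split; [|split]].
  - intros x Hx. split. intro i; apply H1, Hx.
    apply functional_extensionality; intro i; apply H1, Hx.
  - intros x Hx. split. intro i; apply H2, Hx.
    apply functional_extensionality; intro i; apply H2, Hx.
  - intros u x Hu Hx L i. apply (H3 (fun j => u j i)); auto.
  - intros u x Hu Hx L i. apply (H4 (fun j => u j i)); auto.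
Qed.

Lemma heq_reindex (I J : Type) (S : space) (a : I -> J) (b : J -> I) :
  (forall i, b (a i) = i) -> (forall j, a (b j) = j) ->
  heq (S := powS J S) (S' := powS I S) full full.
Proof.
  intros E1 E2. exists (fun x i => x (a i)), (fun y j => y (b j)).
  split; [|split; [|split]].
  - intros x _. split. exact Logic.I.
    apply functional_extensionality; intro j. now rewrite E2.
  - intros y _. split. exact Logic.I.
    apply functional_extensionality; intro j. now rewrite E1.
  - intros u x _ _ L i. apply L.
  - intros u x _ _ L i. apply L.
Qed.

Lemma heq_pow_prod (I : Type) (S1 S2 : space) (P1 : S1 -> Prop) (P2 : S2 -> Prop) :
  heq (S := powS I (prodS S1 S2)) (S' := prodS (powS I S1) (powS I S2))
    (fun x => forall i, prodP P1 P2 (x i))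
    (prodP (fun x => forall i, P1 (x i)) (fun x => forall i, P2 (x i))).
Proof.
  exists (fun x => ((fun i => fst (x i)), (fun i => snd (x i)))),
    (fun z i => (fst z i, snd z i)).
  split; [|split; [|split]].
  - intros x Hx. split. split; intro i; apply Hx.
    apply functional_extensionality; intro i. cbn. now destruct (x i).
  - intros [x y] [Hx Hy]; cbn in *. split. intro i; split; cbn; auto. reflexivity.
  - intros u x _ _ L. split; intro i; apply L.
  - intros u x _ _ [L1 L2] i. split; cbn. apply (L1 i). apply (L2 i).
Qed.

Lemma heq_pow_pow (I J : Type) (S : space) :
  heq (S := powS I (powS J S)) (S' := powS (I * J) S) full full.
Proof.
  exists (fun x ij => x (fst ij) (snd ij)), (fun y i j => y (i, j)).
  split; [|split; [|split]].
  - intros x _. split. exact Logic.I. reflexivity.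
  - intros y _. split. exact Logic.I. apply functional_extensionality. now intros [i j].
  - intros u x _ _ L i. apply L.
  - intros u x _ _ L i j. apply (L (i, j)).
Qed.

Lemma heq_Rw_pow : heq (S := powS nat Rws) (S' := Rws) full full.
Proof.
  eapply heq_trans. apply heq_pow_pow.
  apply (heq_reindex _ _ Rsp Cantor.of_nat Cantor.to_nat).
  apply Cantor.cancel_to_of. apply Cantor.cancel_of_to.
Qed.

Lemma heq_pow_sum (I J : Type) (S : space) :
  heq (S := prodS (powS I S) (powS J S)) (S' := powS (I + J) S) full full.
Proof.
  exists (fun z k => match k with inl i => fst z i | inr j => snd z j end),
    (fun y => ((fun i => y (inl i)), (fun j => y (inr j)))).
  split; [|split; [|split]].
  - intros [x y] _. split. exact Logic.I. reflexivity.
  - intros y _. split. exact Logic.I. apply functional_extensionality. now intros [i|j].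
  - intros u x _ _ [L1 L2] [i|j]. apply (L1 i). apply (L2 j).
  - intros u x _ _ L. split; intro i; cbn. apply (L (inl i)). apply (L (inr i)).
Qed.

Lemma full_prod (A B : Type) : @full (A * B) = prodP full full.
Proof.
  apply functional_extensionality; intro z. apply propositional_extensionality.
  split; intros _; repeat split.
Qed.

Lemma heq_Rw2 : heq (S := prodS Rws Rws) (S' := Rws) (prodP full full) full.
Proof.
  rewrite <- full_prod.
  eapply heq_trans. apply heq_pow_sum.
  apply (heq_reindex nat (nat + nat) Rsp
    (fun n => if Nat.even n then inl (Nat.div2 n) else inr (Nat.div2 n))
    (fun s => match s with inl k => 2 * k | inr k => 2 * k + 1 end)%nat).
  - intro n. destruct (Nat.even n) eqn:E.
    + apply Nat.even_spec in E. destruct E as [m ->]. now rewrite Nat.div2_double.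
    + assert (O : Nat.odd n = true) by (unfold Nat.odd; now rewrite E).
      apply Nat.odd_spec in O. destruct O as [m ->].
      now replace (Nat.div2 (2 * m + 1)) with m
        by (rewrite Nat.add_1_r; symmetry; apply Nat.div2_succ_double).
  - intros [k|k].
    + rewrite Nat.even_mul; cbn [Nat.even orb]. now rewrite Nat.div2_double.
    + rewrite Nat.add_1_r, Nat.even_succ, Nat.odd_mul; cbn [Nat.odd Nat.even andb negb].
      now rewrite <- Nat.add_1_r, Nat.add_1_r, Nat.div2_succ_double.
Qed.

Lemma heq_Rw_R : heq (S := prodS Rws Rsp) (S' := Rws) (prodP full full) full.
Proof.
  rewrite <- full_prod.
  exists (fun z k => match k with O => snd z | S k => fst z k end),
    (fun y => ((fun k => y (S k)), y O)).
  split; [|split; [|split]].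
  - intros [x t] _. split. exact Logic.I. reflexivity.
  - intros y _. split. exact Logic.I. apply functional_extensionality. now intros [|k].
  - intros u x _ _ [L1 L2] [|k]. apply L2. apply (L1 k).
  - intros u x _ _ L. split. intro i. apply (L (S i)). apply (L O).
Qed.

(** * Convergence of real sequences *)

Lemma cv_const (c : R) : Un_cv (fun _ => c) c.
Proof. intros e He. exists O. intros. unfold Rdist. rewrite Rminus_diag, Rabs_R0. lra. Qed.

Lemma cv_ext_eventually (u v : nat -> R) (l : R) (N : nat) :
  (forall j, (N <= j)%nat -> u j = v j) -> Un_cv u l -> Un_cv v l.
Proof.
  intros E H e He. destruct (H e He) as [N' HN]. exists (max N N'). intros n Hn.
  rewrite <- E by lia. apply HN. lia.
Qed.

Lemma cv_cont (h : R -> R) (u : nat -> R) (l : R) :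
  continuity_pt h l -> Un_cv u l -> Un_cv (fun j => h (u j)) (h l).
Proof. intros. now apply continuity_seq. Qed.

Lemma cv_inv (u : nat -> R) (l : R) : l <> 0 -> Un_cv u l -> Un_cv (fun j => / u j) (/ l).
Proof.
  intros Hl H. apply (cv_cont Rinv); auto.
  apply (continuity_pt_inv (fun x => x)); auto. apply derivable_continuous_pt, derivable_pt_id.
Qed.

Lemma cv_abs (u : nat -> R) (l : R) : Un_cv u l -> Un_cv (fun j => Rabs (u j)) (Rabs l).
Proof. intro H. apply (cv_cont Rabs); auto. apply Rcontinuity_abs. Qed.

Lemma cv_exp (u : nat -> R) (l : R) : Un_cv u l -> Un_cv (fun j => exp (u j)) (exp l).
Proof. intro H. apply (cv_cont exp); auto. apply derivable_continuous_pt, derivable_pt_exp. Qed.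

Lemma cv_ln (u : nat -> R) (l : R) : 0 < l -> Un_cv u l -> Un_cv (fun j => ln (u j)) (ln l).
Proof.
  intros Hl H. apply (cv_cont ln); auto.
  apply derivable_continuous_pt. exists (/ l). now apply derivable_pt_lim_ln.
Qed.

Lemma cv_max (u v : nat -> R) (l m : R) :
  Un_cv u l -> Un_cv v m -> Un_cv (fun j => Rmax (u j) (v j)) (Rmax l m).
Proof.
  intros H K e He. destruct (H e He) as [N HN], (K e He) as [N' HN'].
  exists (max N N'). intros n Hn. specialize (HN n ltac:(lia)). specialize (HN' n ltac:(lia)).
  unfold Rdist in *. apply Rabs_def2 in HN, HN'. apply Rabs_def1; unfold Rmax;
    repeat destruct Rle_dec; lra.
Qed.

Lemma cv_min (u v : nat -> R) (l m : R) :
  Un_cv u l -> Un_cv v m -> Un_cv (fun j => Rmin (u j) (v j)) (Rmin l m).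
Proof.
  intros H K e He. destruct (H e He) as [N HN], (K e He) as [N' HN'].
  exists (max N N'). intros n Hn. specialize (HN n ltac:(lia)). specialize (HN' n ltac:(lia)).
  unfold Rdist in *. apply Rabs_def2 in HN, HN'. apply Rabs_def1; unfold Rmin;
    repeat destruct Rle_dec; lra.
Qed.

Lemma cv0_iff (u : nat -> R) : (forall j, 0 <= u j) ->
  Un_cv u 0 <-> (forall e, 0 < e -> exists N, forall j, (N <= j)%nat -> u j < e).
Proof.
  intro P. split; intros H e He; destruct (H e He) as [N HN]; exists N; intros j Hj;
    specialize (HN j Hj); specialize (P j); unfold Rdist in *;
    rewrite Rminus_0_r, Rabs_pos_eq in *; auto.
Qed.

Lemma cv_near (u : nat -> R) (l e : R) : 0 < e -> Un_cv u l ->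
  exists N, forall j, (N <= j)%nat -> Rabs (u j - l) < e.
Proof. intros He H. destruct (H e He) as [N HN]. exists N. intros. now apply HN. Qed.

Lemma cv_squeeze (u : nat -> R) (l : R) (v : nat -> R) :
  (forall j, Rabs (u j - l) <= v j) -> Un_cv v 0 -> Un_cv u l.
Proof.
  intros H K e He. destruct (K e He) as [N HN]. exists N. intros n Hn.
  specialize (HN n Hn). unfold Rdist in *. rewrite Rminus_0_r in HN.
  specialize (H n). pose proof (Rle_abs (v n)). lra.
Qed.

Lemma cv_le (u : nat -> R) (l c : R) : Un_cv u l -> (forall j, u j <= c) -> l <= c.
Proof.
  intros H K. destruct (Rle_lt_dec l c); auto. destruct (H (l - c)) as [N HN]; [lra|].
  specialize (HN N ltac:(lia)). specialize (K N). unfold Rdist in HN.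
  apply Rabs_def2 in HN. lra.
Qed.

Lemma cv_bounded (u : nat -> R) (l : R) : Un_cv u l -> exists B, 0 < B /\ forall j, Rabs (u j) <= B.
Proof.
  intro H. destruct (H 1 Rlt_0_1) as [N HN].
  assert (K : forall n, exists B, 0 < B /\ forall j, (j < n)%nat -> Rabs (u j) <= B).
  { induction n as [|n (B & HB & IH)].
    - exists 1. split. lra. intros; lia.
    - exists (B + Rabs (u n)). pose proof (Rabs_pos (u n)). split. lra.
      intros j Hj. destruct (Nat.eq_dec j n). subst; lra. specialize (IH j ltac:(lia)). lra. }
  destruct (K N) as (B & HB & HK). exists (B + Rabs l + 1). pose proof (Rabs_pos l).
  split. lra. intro j. destruct (Nat.lt_ge_cases j N).
  - specialize (HK j H1). lra.
  - specialize (HN j H1). unfold Rdist in HN. pose proof (Rabs_triang (u j - l) l).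
    replace (u j - l + l) with (u j) in * by ring. lra.
Qed.

Lemma eventually_and (P Q : nat -> Prop) :
  (exists N, forall j, (N <= j)%nat -> P j) -> (exists N, forall j, (N <= j)%nat -> Q j) ->
  exists N, forall j, (N <= j)%nat -> P j /\ Q j.
Proof.
  intros [N H] [N' H']. exists (max N N'). intros j Hj. split. apply H; lia. apply H'; lia.
Qed.

Lemma eventually_all (P : nat -> nat -> Prop) (n : nat) :
  (forall i, (i < n)%nat -> exists N, forall j, (N <= j)%nat -> P i j) ->
  exists N, forall j, (N <= j)%nat -> forall i, (i < n)%nat -> P i j.
Proof.
  induction n; intro H.
  - exists O. intros; lia.
  - destruct IHn as [N HN]. { intros; apply H; lia. }
    destruct (H n ltac:(lia)) as [N' HN']. exists (max N N'). intros j Hj i Hi.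
    destruct (Nat.eq_dec i n). subst. apply HN'; lia. apply HN; lia.
Qed.

Lemma pow2_pos (n : nat) : 0 < 2 ^ n.
Proof. apply pow_lt. lra. Qed.
Lemma pow2_ge1 (n : nat) : 1 <= 2 ^ n.
Proof. apply pow_R1_Rle. lra. Qed.
Lemma pow2_unbounded (r : R) : exists n, r < 2 ^ n.
Proof.
  destruct (Pow_x_infinity 2 ltac:(rewrite Rabs_pos_eq; lra) (r + 1)) as [N HN]. exists N.
  specialize (HN N ltac:(lia)). rewrite Rabs_pos_eq in HN. lra. left; apply pow2_pos.
Qed.

Lemma div_le_iff (a b c : R) : 0 < c -> (a / c <= b <-> a <= b * c).
Proof.
  intro Hc. assert (E : a = a / c * c) by (field; lra). split; intro H.
  - rewrite E. apply Rmult_le_compat_r; lra.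
  - rewrite E in H. now apply Rmult_le_reg_r in H.
Qed.

Lemma div_lt_iff (a b c : R) : 0 < c -> (a / c < b <-> a < b * c).
Proof.
  intro Hc. assert (E : a = a / c * c) by (field; lra). split; intro H.
  - rewrite E. apply Rmult_lt_compat_r; lra.
  - rewrite E in H. now apply Rmult_lt_reg_r in H.
Qed.

Lemma heq_iff (S : space) (P P' : S -> Prop) : (forall x, P x <-> P' x) -> heq P P'.
Proof.
  intro H. assert (E : P = P').
  { apply functional_extensionality; intro x. now apply propositional_extensionality. }
  rewrite E. apply heq_refl.
Qed.

Lemma Rabs_le_iff (a b : R) : Rabs a <= b <-> - b <= a <= b.
Proof.
  split; intro H. 2: now apply Rabs_le.
  pose proof (Rle_abs a). pose proof (Rle_abs (- a)). rewrite Rabs_Ropp in H1. lra.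
Qed.

(** * Finite maxima *)

(** The maximum starts at [0]: it is used for nonnegative families only. *)
Fixpoint fmax (h : nat -> R) (N : nat) : R :=
  match N with O => 0 | S n => Rmax (fmax h n) (h n) end.

Lemma fmax_ge0 h N : 0 <= fmax h N.
Proof. induction N; cbn. lra. eapply Rle_trans; [exact IHN | apply Rmax_l]. Qed.

Lemma fmax_ge h N k : (k < N)%nat -> h k <= fmax h N.
Proof.
  induction N; intro H. lia. cbn. destruct (Nat.eq_dec k N).
  - subst. apply Rmax_r.
  - eapply Rle_trans; [apply IHN; lia | apply Rmax_l].
Qed.

Lemma fmax_le h N c : 0 <= c -> (forall k, (k < N)%nat -> h k <= c) -> fmax h N <= c.
Proof.
  intros Hc H. induction N; cbn. lra. apply Rmax_lub. apply IHN; intros; apply H; lia.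
  apply H; lia.
Qed.

Lemma fmax_lt h N c : 0 < c -> (forall k, (k < N)%nat -> h k < c) -> fmax h N < c.
Proof.
  intros Hc H. induction N; cbn. lra. apply Rmax_lub_lt. apply IHN; intros; apply H; lia.
  apply H; lia.
Qed.

Lemma fmax_ext h h' N : (forall k, (k < N)%nat -> h k = h' k) -> fmax h N = fmax h' N.
Proof.
  intro H. induction N; cbn. reflexivity. rewrite IHN, H by (try lia; intros; apply H; lia).
  reflexivity.
Qed.

Lemma fmax_cv (h : nat -> nat -> R) (l : nat -> R) N :
  (forall k, (k < N)%nat -> Un_cv (fun j => h j k) (l k)) ->
  Un_cv (fun j => fmax (h j) N) (fmax l N).
Proof.
  intro H. induction N; cbn. apply cv_const. apply cv_max. apply IHN; intros; apply H; lia.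
  apply H; lia.
Qed.

(** * Null sequences parametrized by positive sequences *)

Definition Pos (eta : nat -> R) : Prop := forall k, 0 < eta k.

(** For fixed [k], asking [t n < tterm eta n k] for all [n >= k] bounds only [eta k] from below. For
    fixed [eta] the terms tend to [(/ 2) ^ k] as [n] grows, so their minimum over [k <= n] is a null
    sequence, yet at least [(/ 2) ^ n]. *)
Definition tterm (eta : nat -> R) (n k : nat) : R := (/ 2) ^ k * (1 + eta k / (INR n + 1)).
Fixpoint tmin (eta : nat -> R) (n k : nat) : R :=
  match k with
  | O => tterm eta n O
  | S k' => Rmin (tmin eta n k') (tterm eta n (S k'))
  end.
Definition tol (eta : nat -> R) (n : nat) : R := tmin eta n n.

Lemma INR1_pos n : 0 < INR n + 1.
Proof. pose proof (pos_INR n). lra. Qed.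
Lemma half_pos k : 0 < (/ 2) ^ k.
Proof. apply pow_lt. lra. Qed.
Lemma pow2_half k : 2 ^ k * (/ 2) ^ k = 1.
Proof. rewrite <- Rpow_mult_distr. replace (2 * / 2) with 1 by field. apply pow1. Qed.

Lemma tmin_le eta n K k : (k <= K)%nat -> tmin eta n K <= tterm eta n k.
Proof.
  induction K; intro H; cbn [tmin].
  - replace k with O by lia. lra.
  - destruct (Nat.eq_dec k (S K)). subst. apply Rmin_r.
    eapply Rle_trans. apply Rmin_l. apply IHK. lia.
Qed.

Lemma tmin_gt eta n K c : (forall k, (k <= K)%nat -> c < tterm eta n k) -> c < tmin eta n K.
Proof.
  induction K; intro H; cbn [tmin]. apply H; lia. apply Rmin_glb_lt. apply IHK.
  intros; apply H; lia. apply H; lia.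
Qed.

Lemma tmin_ge eta n K c : (forall k, (k <= K)%nat -> c <= tterm eta n k) -> c <= tmin eta n K.
Proof.
  induction K; intro H; cbn [tmin]. apply H; lia. apply Rmin_glb. apply IHK.
  intros; apply H; lia. apply H; lia.
Qed.

Lemma tol_le eta n k : (k <= n)%nat -> tol eta n <= tterm eta n k.
Proof. apply tmin_le. Qed.

Lemma tterm_ge eta n k : Pos eta -> (/ 2) ^ k <= tterm eta n k.
Proof.
  intro P. unfold tterm. pose proof (half_pos k).
  assert (0 < eta k / (INR n + 1)) by (apply Rdiv_lt_0_compat; [apply P | apply INR1_pos]).
  nra.
Qed.

Lemma tol_ge eta n : Pos eta -> (/ 2) ^ n <= tol eta n.
Proof.
  intro P. apply tmin_ge. intros k Hk. eapply Rle_trans; [|now apply tterm_ge].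
  replace n with (k + (n - k))%nat by lia. rewrite pow_add.
  pose proof (half_pos k). assert ((/ 2) ^ (n - k) <= 1).
  { rewrite <- (pow1 (n - k)). apply pow_incr. lra. }
  nra.
Qed.

Lemma tol_pos eta n : Pos eta -> 0 < tol eta n.
Proof. intro P. pose proof (tol_ge eta n P). pose proof (half_pos n). lra. Qed.

Lemma tol_decr eta n : Pos eta -> tol eta (S n) <= tol eta n.
Proof.
  intro P. apply tmin_ge. intros k Hk. eapply Rle_trans. apply (tol_le eta (S n) k); lia.
  unfold tterm. apply Rmult_le_compat_l. left; apply half_pos. apply Rplus_le_compat_l.
  apply Rmult_le_compat_l. left; apply P. apply Rinv_le_contravar. apply INR1_pos.
  rewrite S_INR. lra.
Qed.

Lemma tol_decr_add eta n q : Pos eta -> tol eta (n + q) <= tol eta n.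
Proof.
  intro P. induction q. rewrite Nat.add_0_r; lra. rewrite Nat.add_succ_r.
  pose proof (tol_decr eta (n + q) P). lra.
Qed.

Lemma tterm_cv (eta : nat -> nat -> R) (eta0 : nat -> R) n k :
  Un_cv (fun j => eta j k) (eta0 k) -> Un_cv (fun j => tterm (eta j) n k) (tterm eta0 n k).
Proof.
  intro H. unfold tterm. apply (CV_mult (fun _ => _)). apply cv_const.
  apply (CV_plus (fun _ => _)). apply cv_const.
  apply (CV_mult (fun j => eta j k) (fun _ => / (INR n + 1))). exact H. apply cv_const.
Qed.

Lemma tol_cv (eta : nat -> nat -> R) (eta0 : nat -> R) n :
  (forall k, Un_cv (fun j => eta j k) (eta0 k)) ->
  Un_cv (fun j => tol (eta j) n) (tol eta0 n).
Proof.
  intro H. unfold tol. generalize n at 2 4. intro K. induction K; cbn [tmin].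
  now apply tterm_cv. apply cv_min. exact IHK. now apply tterm_cv.
Qed.

Definition null (t : nat -> R) : Prop :=
  forall e, 0 < e -> exists N, forall n, (N <= n)%nat -> t n < e.
Definition unull (t : nat -> nat -> R) : Prop :=
  forall e, 0 < e -> exists N, forall j n, (N <= j)%nat -> (N <= n)%nat -> t j n < e.

Lemma unull_const t : unull (fun _ => t) -> null t.
Proof. intros H e He. destruct (H e He) as [N HN]. exists N. intros n Hn. now apply (HN N). Qed.

(** One index [k] with [(/ 2) ^ k < e / 2] suffices: [tterm eta n k] is at most [2 * (/ 2) ^ k] once
    [n + 1 >= eta k], and convergence of the single coordinate [eta k] makes this uniform in [j]. *)
Lemma tol_unull (eta : nat -> nat -> R) (eta0 : nat -> R) :
  (forall k, Un_cv (fun j => eta j k) (eta0 k)) -> unull (fun j => tol (eta j)).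
Proof.
  intros H e He. destruct (pow2_unbounded (2 / e)) as [k Hk].
  assert (Hk' : (/ 2) ^ k < e / 2).
  { pose proof (pow2_half k). pose proof (half_pos k). pose proof (pow2_pos k).
    assert (2 / e * (/ 2) ^ k < 1) by nra.
    apply (Rmult_lt_reg_l (2 / e)). apply Rdiv_lt_0_compat; lra.
    replace (2 / e * (e / 2)) with 1 by (field; lra). lra. }
  destruct (cv_near _ _ 1 Rlt_0_1 (H k)) as [J HJ].
  destruct (INR_unbounded (Rabs (eta0 k) + 1)) as [N HN].
  exists (max (max J N) k). intros j n Hj Hn. specialize (HJ j ltac:(lia)).
  eapply Rle_lt_trans. apply (tol_le _ n k); lia. unfold tterm.
  assert (eta j k / (INR n + 1) <= 1).
  { apply div_le_iff. apply INR1_pos. apply Rabs_def2 in HJ. pose proof (Rle_abs (eta0 k)).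
    assert (INR N <= INR n) by (apply le_INR; lia). lra. }
  pose proof (half_pos k). nra.
Qed.

(** The bound on [eta k] obtained by solving [t n < tterm eta n k]. Indices [n < k] do not enter
    [tol], hence the value [0] there. *)
Definition lamterm (t : nat -> R) (k n : nat) : R :=
  if Nat.leb k n then (INR n + 1) * (2 ^ k * t n - 1) else 0.
(** For null [t] the terms with large [n] are at most [0], so the maxima stabilize; [epsilon]
    returns the stable value without a threshold entering the definition. *)
Definition Lam (t : nat -> R) (k : nat) : R :=
  epsilon (inhabits 0) (fun l => exists N0, forall N, (N0 <= N)%nat -> fmax (lamterm t k) N = l).

Lemma Lam_eq t k N0 : (forall n, (N0 <= n)%nat -> 2 ^ k * t n <= 1) ->
  Lam t k = fmax (lamterm t k) N0.
Proof.
  intro H.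
  assert (K : forall q, fmax (lamterm t k) (N0 + q) = fmax (lamterm t k) N0).
  { induction q. now rewrite Nat.add_0_r. rewrite Nat.add_succ_r. cbn [fmax]. rewrite IHq.
    apply Rmax_left. eapply Rle_trans; [|apply fmax_ge0]. unfold lamterm.
    destruct Nat.leb. 2: lra. specialize (H (N0 + q)%nat ltac:(lia)).
    pose proof (INR1_pos (N0 + q)). nra. }
  assert (X : exists l N0, forall N, (N0 <= N)%nat -> fmax (lamterm t k) N = l).
  { exists (fmax (lamterm t k) N0), N0. intros N HN.
    replace N with (N0 + (N - N0))%nat by lia. apply K. }
  destruct (epsilon_spec (inhabits 0) _ X) as [N1 H1]. fold (Lam t k) in H1.
  rewrite <- (H1 (N0 + N1)%nat) by lia. apply K.
Qed.

Lemma null_threshold t k : null t -> exists N0, forall n, (N0 <= n)%nat -> 2 ^ k * t n <= 1.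
Proof.
  intro H. destruct (H ((/ 2) ^ k) (half_pos k)) as [N HN]. exists N. intros n Hn.
  specialize (HN n Hn). pose proof (pow2_half k). pose proof (pow2_pos k). nra.
Qed.

Lemma Lam_ge0 t k : null t -> 0 <= Lam t k.
Proof.
  intro H. destruct (null_threshold t k H) as [N HN]. rewrite (Lam_eq t k N HN). apply fmax_ge0.
Qed.

Lemma lamterm_lt t eta k n : (k <= n)%nat ->
  (t n < tterm eta n k <-> lamterm t k n < eta k).
Proof.
  intro H. unfold lamterm. apply Nat.leb_le in H. rewrite H. unfold tterm.
  pose proof (INR1_pos n). pose proof (pow2_half k). pose proof (pow2_pos k).
  pose proof (half_pos k).
  assert (E : eta k = (INR n + 1) * (eta k / (INR n + 1))) by (field; lra).
  rewrite E at 2. generalize (eta k / (INR n + 1)). intro z. split; intro L.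
  - apply Rmult_lt_compat_l. lra. apply (Rmult_lt_compat_l (2 ^ k)) in L; auto.
    rewrite <- Rmult_assoc, H1, Rmult_1_l in L. lra.
  - apply Rmult_lt_reg_l in L; auto. apply (Rmult_lt_reg_l (2 ^ k)); auto.
    rewrite <- Rmult_assoc, H1, Rmult_1_l. lra.
Qed.

Lemma Lam_dom t eta : null t ->
  (Pos eta /\ forall n, t n < tol eta n) <-> (forall k, Lam t k < eta k).
Proof.
  intro Ht. split.
  - intros [P H] k. destruct (null_threshold t k Ht) as [N HN]. rewrite (Lam_eq t k N HN).
    apply fmax_lt. apply P. intros n _. destruct (Nat.le_gt_cases k n).
    + apply lamterm_lt; auto. eapply Rlt_le_trans. apply H. now apply tol_le.
    + unfold lamterm. apply Nat.leb_gt in H0. rewrite H0. apply P.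
  - intro H. split. intro k. eapply Rle_lt_trans; [now apply (Lam_ge0 t) | apply H].
    intro n. apply tmin_gt. intros k Hk. apply lamterm_lt; auto.
    eapply Rle_lt_trans; [|apply H]. destruct (null_threshold t k Ht) as [N HN].
    rewrite (Lam_eq t k (max N (S n))). apply fmax_ge; lia. intros; apply HN; lia.
Qed.

(** Uniform nullness gives one cutoff [N] for all late [j]; up to [N] only a finite maximum of
    continuous expressions remains. *)
Lemma Lam_cv (t : nat -> nat -> R) (t0 : nat -> R) k :
  unull t -> null t0 -> (forall n, Un_cv (fun j => t j n) (t0 n)) ->
  Un_cv (fun j => Lam (t j) k) (Lam t0 k).
Proof.
  intros U N0 H. destruct (null_threshold t0 k N0) as [N1 HN1].
  destruct (U ((/ 2) ^ k) (half_pos k)) as [N2 HN2].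
  set (N := max N1 N2).
  apply (cv_ext_eventually (fun j => fmax (lamterm (t j) k) N) _ _ N).
  - intros j Hj. symmetry. apply Lam_eq. intros n Hn. specialize (HN2 j n ltac:(lia) ltac:(lia)).
    pose proof (pow2_half k). pose proof (pow2_pos k). nra.
  - rewrite (Lam_eq t0 k N) by (intros; apply HN1; lia). apply fmax_cv. intros n _.
    unfold lamterm. destruct Nat.leb. 2: apply cv_const.
    apply (CV_mult (fun _ => _)). apply cv_const. apply (CV_minus _ (fun _ => _)).
    apply (CV_mult (fun _ => _)). apply cv_const. apply H. apply cv_const.
Qed.

(* The parameters whose tolerance dominates a given null sequence form a product
   of half-lines, which is translated onto the space of all parameters. *)
Lemma heq_dominate (S : space) (P : S -> Prop) (t : S -> nat -> R) :
  (forall p, P p -> null (t p)) ->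
  (forall u x, (forall j, P (u j)) -> P x -> lim S u x ->
     unull (fun j => t (u j)) /\ forall n, Un_cv (fun j => t (u j) n) (t x n)) ->
  heq (S := prodS S Rws) (S' := prodS S Rws) (prodP P Pos)
    (fun z => P (fst z) /\ Pos (snd z) /\ forall n, t (fst z) n < tol (snd z) n).
Proof.
  intros Hn Hc.
  exists (fun z => (fst z, fun k => snd z k + Lam (t (fst z)) k)),
    (fun z => (fst z, fun k => snd z k - Lam (t (fst z)) k)).
  split; [|split; [|split]].
  - intros [p th] [Hp Hth]; cbn in *. split.
    + split; auto. apply Lam_dom. now apply Hn. intro k. specialize (Hth k). lra.
    + f_equal. apply functional_extensionality. intro. ring.
  - intros [p th] (Hp & Hth); cbn in *. split.
    + split; auto. cbn. intro k. apply Lam_dom with (k := k) in Hth. lra. now apply Hn.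
    + f_equal. apply functional_extensionality. intro. ring.
  - intros u x Hu Hx [L1 L2]. split; cbn. exact L1. intro k.
    destruct (Hc (fun j => fst (u j)) (fst x)) as [U C]; auto. intro j; apply Hu. apply Hx.
    apply (CV_plus (fun j => snd (u j) k)). apply (L2 k). apply Lam_cv; auto. apply Hn, Hx.
  - intros u x Hu Hx [L1 L2]. split; cbn. exact L1. intro k.
    destruct (Hc (fun j => fst (u j)) (fst x)) as [U C]; auto. intro j; apply Hu. apply Hx.
    apply (CV_minus (fun j => snd (u j) k)). apply (L2 k). apply Lam_cv; auto. apply Hn, Hx.
Qed.

(** * Sequences of boxes *)

Definition RRs : space := powS nat Rws.

Definition squash (a z : R) : R := a * (z / (1 + Rabs z)).
Definition unsquash (a w : R) : R := w / (a - Rabs w).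

Lemma squash_lt a z : 0 < a -> Rabs (squash a z) < a.
Proof.
  intro Ha. unfold squash. pose proof (Rabs_pos z).
  rewrite Rabs_mult, (Rabs_pos_eq a) by lra. unfold Rdiv. rewrite Rabs_mult, Rabs_inv.
  rewrite (Rabs_pos_eq (1 + Rabs z)) by lra. rewrite <- (Rmult_1_r a) at 2.
  apply Rmult_lt_compat_l; auto. apply div_lt_iff; lra.
Qed.

Lemma unsquash_squash a z : 0 < a -> unsquash a (squash a z) = z.
Proof.
  intro Ha. unfold unsquash, squash. pose proof (Rabs_pos z).
  rewrite Rabs_mult, (Rabs_pos_eq a) by lra. unfold Rdiv. rewrite Rabs_mult, Rabs_inv.
  rewrite (Rabs_pos_eq (1 + Rabs z)) by lra. field. split. lra.
  replace (a * (1 + Rabs z) - a * Rabs z) with a by ring. lra.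
Qed.

Lemma squash_unsquash a w : Rabs w < a -> squash a (unsquash a w) = w.
Proof.
  intro H. unfold unsquash, squash. pose proof (Rabs_pos w).
  unfold Rdiv. rewrite Rabs_mult, Rabs_inv. rewrite (Rabs_pos_eq (a - Rabs w)) by lra.
  field. split. lra. replace (a - Rabs w + Rabs w) with a by ring. lra.
Qed.

Lemma squash_cv a a0 z z0 : Un_cv a a0 -> Un_cv z z0 ->
  Un_cv (fun j => squash (a j) (z j)) (squash a0 z0).
Proof.
  intros H K. unfold squash. apply CV_mult; auto. apply (CV_mult z); auto.
  apply cv_inv. pose proof (Rabs_pos z0); lra. apply (CV_plus (fun _ => _)). apply cv_const.
  now apply cv_abs.
Qed.

Lemma unsquash_cv a a0 w w0 : Rabs w0 < a0 -> Un_cv a a0 -> Un_cv w w0 ->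
  Un_cv (fun j => unsquash (a j) (w j)) (unsquash a0 w0).
Proof.
  intros L H K. unfold unsquash. apply (CV_mult w); auto.
  apply cv_inv. lra. apply CV_minus. auto. now apply cv_abs.
Qed.

Definition prev (x : nat -> nat -> R) (n : nat) : nat -> R :=
  match n with O => fun _ => 0 | S n' => x n' end.

Section Boxes.
Variables (S : space) (P : S -> Prop) (N : nat -> nat)
  (cen : S -> nat -> (nat -> R) -> nat -> R) (rad : S -> nat -> R).
Hypothesis rad_pos : forall p n, P p -> 0 < rad p n.
Hypothesis rad_cv : forall u p n, (forall j, P (u j)) -> P p -> lim S u p ->
  Un_cv (fun j => rad (u j) n) (rad p n).
Hypothesis cen_cv : forall u p v v0 n k, (forall j, P (u j)) -> P p -> lim S u p ->
  (forall i, Un_cv (fun j => v j i) (v0 i)) -> (k < N n)%nat ->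
  Un_cv (fun j => cen (u j) n (v j) k) (cen p n v0 k).

Let out (p : S) (z : nat -> nat -> R) (n : nat) (pr : nat -> R) (k : nat) : R :=
  if Nat.ltb k (N n) then cen p n pr k + squash (rad p n) (z n k) else z n k.
Fixpoint box_out (p : S) (z : nat -> nat -> R) (n : nat) : nat -> R :=
  match n with
  | O => out p z O (fun _ => 0)
  | Datatypes.S n' => out p z (Datatypes.S n') (box_out p z n')
  end.
Let back (p : S) (x : nat -> nat -> R) (n k : nat) : R :=
  if Nat.ltb k (N n) then unsquash (rad p n) (x n k - cen p n (prev x n) k) else x n k.

Lemma box_out_eq p z n : box_out p z n = out p z n (prev (box_out p z) n).
Proof. destruct n; reflexivity. Qed.

(** A triangular change of variables: the box at stage [n] is centred at a function of the base
    point and of stage [n - 1], so the boxes are filled recursively through [squash]. The inverse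
    [back] needs no recursion, the centres being read off the given sequence. Coordinates from [N n]
    on are unconstrained and stay untouched. *)
Lemma heq_boxes :
  heq (S := prodS S RRs) (S' := prodS S RRs) (prodP P full)
    (fun z => P (fst z) /\ forall n k, (k < N n)%nat ->
       Rabs (snd z n k - cen (fst z) n (prev (snd z) n) k) < rad (fst z) n).
Proof.
  exists (fun z => (fst z, box_out (fst z) (snd z))), (fun z => (fst z, back (fst z) (snd z))).
  split; [|split; [|split]].
  - intros [p z] [Hp _]; cbn [fst snd]. split.
    + split; auto. intros n k Hk. cbn [fst snd]. rewrite (box_out_eq p z n). unfold out.
      apply Nat.ltb_lt in Hk. rewrite Hk.
      replace (_ + _ - _) with (squash (rad p n) (z n k)) by ring.
      apply squash_lt. now apply rad_pos.
    + apply (f_equal (pair p)). apply functional_extensionality; intro n. apply functional_extensionality; intro k.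
      unfold back. rewrite (box_out_eq p z n). unfold out.
      destruct (Nat.ltb k (N n)) eqn:E; auto.
      replace (_ + _ - _) with (squash (rad p n) (z n k)) by ring.
      apply unsquash_squash. now apply rad_pos.
  - intros [p x] [Hp Hx]; cbn [fst snd] in *. split.
    + split; auto. exact Logic.I.
    + apply (f_equal (pair p)). apply functional_extensionality.
      assert (K : forall n pr, pr = prev x n -> out p (back p x) n pr = x n).
      { intros n pr ->. apply functional_extensionality; intro k. unfold out, back.
        destruct (Nat.ltb k (N n)) eqn:E; auto. rewrite squash_unsquash. ring.
        apply Nat.ltb_lt in E. now apply Hx. }
      induction x0; cbn [box_out]; apply K; auto.
  - intros u p Hu Hp [L1 L2]. split; cbn [fst snd]. exact L1.
    assert (Hu' : forall j, P (fst (u j))) by (intro; apply Hu).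
    assert (Hp' : P (fst p)) by apply Hp.
    assert (K : forall n (v : nat -> nat -> R) v0, (forall i, Un_cv (fun j => v j i) (v0 i)) ->
      forall k, Un_cv (fun j => out (fst (u j)) (snd (u j)) n (v j) k)
                  (out (fst p) (snd p) n v0 k)).
    { intros n v v0 Hv k. unfold out. destruct (Nat.ltb k (N n)) eqn:E. 2: apply L2.
      apply Nat.ltb_lt in E.
      apply CV_plus. now apply (cen_cv (fun j => fst (u j))). apply squash_cv.
      now apply (rad_cv (fun j => fst (u j))). apply L2. }
    intro n. induction n; cbn [box_out].
    + intro k. apply (K O (fun _ _ => 0) (fun _ => 0)). intro; apply cv_const.
    + intro k. apply (K (Datatypes.S n) (fun j => box_out (fst (u j)) (snd (u j)) n)). exact IHn.
  - intros u p Hu Hp [L1 L2]. split; cbn [fst snd]. exact L1. intros n k. cbn. unfold back.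
    assert (Hu' : forall j, P (fst (u j))) by (intro; apply Hu).
    assert (Hp' : P (fst p)) by apply Hp.
    destruct (Nat.ltb k (N n)) eqn:E. 2: apply L2. apply Nat.ltb_lt in E.
    apply unsquash_cv. now apply Hp. now apply (rad_cv (fun j => fst (u j))).
    apply CV_minus. apply L2.
    apply (cen_cv (fun j => fst (u j)) _ (fun j => prev (snd (u j)) n)); auto.
    intro i. destruct n; cbn. apply cv_const. apply L2.
Qed.
End Boxes.

Lemma heq_Rpos : heq (S := Rsp) (S' := Rsp) (fun t => 0 < t) full.
Proof.
  exists ln, exp. split; [|split; [|split]].
  - intros x Hx. split. exact Logic.I. now apply exp_ln.
  - intros y _. split. apply exp_pos. apply ln_exp.
  - intros u x _ Hx L. now apply cv_ln.
  - intros u x _ _ L. now apply cv_exp.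
Qed.

Lemma heq_Pos : heq (S := Rws) (S' := Rws) Pos full.
Proof.
  eapply heq_trans. apply (heq_pow nat _ _ _ _ heq_Rpos). apply heq_iff. intro x.
  split; repeat intro; exact Logic.I.
Qed.

Lemma heq_absorb (S : space) (P : S -> Prop) (Q : Rws -> Prop) : heq Q (@full Rws) ->
  heq (S := prodS (prodS S Rws) Rws) (S' := prodS S Rws) (prodP (prodP P full) Q) (prodP P full).
Proof.
  intro H. eapply heq_trans. apply heq_assoc. apply heq_prod. apply heq_refl.
  eapply heq_trans. apply heq_prod. apply heq_refl. exact H. apply heq_Rw2.
Qed.

Lemma heq_absorb_all (S : space) (P : S -> Prop) :
  heq (S := prodS (prodS (prodS S Rws) RRs) Rws) (S' := prodS S Rws)
    (prodP (prodP (prodP P Pos) full) Pos) (prodP P full).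
Proof.
  eapply heq_trans.
  { apply heq_prod. 2: apply heq_Pos. apply heq_prod. 2: apply heq_Rw_pow.
    apply heq_prod. apply heq_refl. apply heq_Pos. }
  eapply heq_trans. apply heq_absorb, heq_refl. apply heq_absorb, heq_refl.
Qed.

(** * The telescope theorem *)

Section Telescope.
Variables (SB : space) (PB : SB -> Prop) (M : Type) (d : M -> M -> R)
  (W : SB -> M -> Prop) (N : nat -> nat) (f : nat -> nat -> M -> R)
  (g : nat -> SB -> (nat -> R) -> M) (C : R).
Hypothesis SB_const : forall b : SB, lim SB (fun _ => b) b.
Hypothesis d_ge0 : forall m m', 0 <= d m m'.
Hypothesis d_sym : forall m m', d m m' = d m' m.
Hypothesis d_tri : forall m m' m'', d m m'' <= d m m' + d m' m''.
Hypothesis d_refl : forall m, d m m = 0.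
Hypothesis d_eq : forall b m m', W b m -> W b m' -> d m m' = 0 -> m = m'.
Hypothesis W_base : forall b m, W b m -> PB b.
Hypothesis f_lip : forall n k m m', Rabs (f n k m - f n k m') <= d m m'.
Hypothesis g_cont : forall n u b (x : nat -> nat -> R) x0,
  (forall j, PB (u j)) -> PB b -> lim SB u b ->
  (forall k, (k < N n)%nat -> Un_cv (fun j => x j k) (x0 k)) ->
  Un_cv (fun j => d (g n (u j) (x j)) (g n b x0)) 0.
Hypothesis C_pos : 0 < C.
(** One [n0] serving all late members of a convergent sequence is local uniformity in sequential
    form; it yields the uniform nullness that [heq_dominate] asks for. [R0] will be a bound for the
    tolerances along the sequence, and [/ 8 ^ n] is the discretization error of stage [n]. *)
Hypothesis H_p : forall (u : nat -> SB * M) p R0,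
  (forall j, W (fst (u j)) (snd (u j))) -> W (fst p) (snd p) ->
  lim (prodS SB (metS M d)) u p ->
  exists n0, forall n j x r, (n0 <= n)%nat -> (n0 <= j)%nat -> r <= R0 / 4 ^ n ->
    (forall k, (k < N n)%nat -> Rabs (x k - f n k (snd (u j))) <= r) ->
    d (g n (fst (u j)) x) (snd (u j)) <= C * (r + / 8 ^ n).
(** Here [x] is arbitrary: even a point recovered from meaningless data must be reproduced
    accurately by the next stage. *)
Hypothesis H_E : forall (u : nat -> SB) b R0,
  (forall j, PB (u j)) -> PB b -> lim SB u b ->
  exists n0, forall n j x x' r, (n0 <= n)%nat -> (n0 <= j)%nat -> r <= R0 / 4 ^ n ->
    (forall k, (k < N (S n))%nat -> Rabs (x' k - f (S n) k (g n (u j) x)) <= r) ->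
    d (g (S n) (u j) x') (g n (u j) x) <= C * (r + / 8 ^ S n).
Hypothesis H_lim : forall b x R0 n0, PB b ->
  (forall n, (n0 <= n)%nat -> d (g (S n) b (x (S n))) (g n b (x n)) <= R0 / 4 ^ n) ->
  exists m, W b m /\ Un_cv (fun n => d (g n b (x n)) m) 0.

Lemma pow4_pos n : 0 < 4 ^ n.
Proof. apply pow_lt. lra. Qed.
Lemma pow8_pos n : 0 < 8 ^ n.
Proof. apply pow_lt. lra. Qed.

Lemma pow8_split n : / 8 ^ n = (/ 2) ^ n / 4 ^ n.
Proof.
  unfold Rdiv. rewrite <- !pow_inv, <- Rpow_mult_distr. f_equal. field.
Qed.

Lemma tail8 eta n : Pos eta -> / 8 ^ n <= tol eta n / 4 ^ n.
Proof.
  intro P. rewrite pow8_split. apply Rmult_le_compat_r.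
  left; apply Rinv_0_lt_compat, pow4_pos. now apply tol_ge.
Qed.

Lemma geom_tail (m : nat -> M) A n :
  (forall q, d (m (n + S q)%nat) (m (n + q)%nat) <= A * (/ 4) ^ q) ->
  forall q, d (m (n + q)%nat) (m n) <= 4 / 3 * A.
Proof.
  intro H. assert (HA : 0 <= A).
  { specialize (H O). cbn [pow] in H. pose proof (d_ge0 (m (n + 1)%nat) (m (n + 0)%nat)). lra. }
  assert (K : forall q, d (m (n + q)%nat) (m n) <= 4 / 3 * A * (1 - (/ 4) ^ q)).
  { induction q. rewrite Nat.add_0_r, d_refl. cbn. lra.
    pose proof (d_tri (m (n + S q)%nat) (m (n + q)%nat) (m n)). specialize (H q).
    cbn [pow]. nra. }
  intro q. specialize (K q). assert (0 < (/ 4) ^ q) by (apply pow_lt; lra).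
  pose proof (Rmult_le_pos _ _ HA (Rlt_le _ _ H0)). nra.
Qed.

Lemma d_lim_le (m : nat -> M) m0 m1 A n :
  Un_cv (fun n => d (m n) m0) 0 -> (forall q, d (m (n + q)%nat) m1 <= A) -> d m0 m1 <= A.
Proof.
  intros H K. destruct (Rle_lt_dec (d m0 m1) A); auto.
  destruct (proj1 (cv0_iff _ (fun n => d_ge0 (m n) m0)) H (d m0 m1 - A)) as [q Hq]. lra.
  specialize (Hq (n + q)%nat ltac:(lia)). specialize (K q).
  pose proof (d_tri m0 (m (n + q)%nat) m1). rewrite (d_sym m0 (m (n + q)%nat)) in H0. lra.
Qed.

Definition gap (x : nat -> nat -> R) (n : nat) (m : M) : R :=
  fmax (fun k => Rabs (x n k - f n k m)) (N n).

Lemma gap_le x n m k : (k < N n)%nat -> Rabs (x n k - f n k m) <= gap x n m.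
Proof. intro H. apply (fmax_ge (fun k => Rabs (x n k - f n k m))). exact H. Qed.

Lemma gap_lip x n m m' : gap x n m <= gap x n m' + d m m'.
Proof.
  apply fmax_le. unfold gap.
  pose proof (fmax_ge0 (fun k => Rabs (x n k - f n k m')) (N n)). pose proof (d_ge0 m m'). lra.
  intros k Hk. pose proof (gap_le x n m' k Hk). pose proof (f_lip n k m' m).
  rewrite d_sym in H0.
  pose proof (Rabs_triang (x n k - f n k m') (f n k m' - f n k m)).
  replace (x n k - f n k m' + (f n k m' - f n k m)) with (x n k - f n k m) in H1 by ring. lra.
Qed.

Lemma gap_cv (x : nat -> nat -> nat -> R) x0 n m m0 :
  (forall k, Un_cv (fun j => x j n k) (x0 n k)) -> Un_cv (fun j => d (m j) m0) 0 ->
  Un_cv (fun j => gap (x j) n (m j)) (gap x0 n m0).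
Proof.
  intros Hx Hm. apply fmax_cv. intros k _. apply cv_abs. apply CV_minus. apply Hx.
  apply (cv_squeeze _ _ (fun j => d (m j) m0)); auto.
Qed.

Lemma gap_lt x n m a : 0 < a ->
  ((forall k, (k < N n)%nat -> Rabs (x n k - f n k m) < a / 4 ^ n) <-> 4 ^ n * gap x n m < a).
Proof.
  intro Ha. pose proof (pow4_pos n). split; intro H0.
  - apply (Rmult_lt_reg_l (/ 4 ^ n)). now apply Rinv_0_lt_compat.
    rewrite <- Rmult_assoc, Rinv_l, Rmult_1_l by lra. rewrite Rmult_comm. apply fmax_lt; auto.
    now apply Rdiv_lt_0_compat.
  - intros k Hk. eapply Rle_lt_trans. apply (gap_le x n m k Hk).
    apply (Rmult_lt_reg_r (4 ^ n)); auto. unfold Rdiv. rewrite Rmult_assoc, Rinv_l by lra. lra.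
Qed.

(* The two readings of a sequence [x] of finite tuples: as perturbations of the
   coordinates of a point [m], and as perturbations of the coordinates of the
   point reconstructed from the preceding tuple. *)
Definition near_p (z : prodS (prodS (prodS SB (metS M d)) Rws) RRs) : Prop :=
  (W (fst (fst (fst z))) (snd (fst (fst z))) /\ Pos (snd (fst z))) /\
  forall n, 4 ^ n * gap (snd z) n (snd (fst (fst z))) < tol (snd (fst z)) n.

(** Stage [0] has no predecessor and carries no condition. The factor [4 ^ n] makes the errors
    comparable with [tol]. *)
Definition err_E (b : SB) (x : nat -> nat -> R) (n : nat) : R :=
  match n with O => 0 | S n' => 4 ^ n * gap x n (g n' b (x n')) end.

Definition near_E (z : prodS (prodS SB Rws) RRs) : Prop :=
  (PB (fst (fst z)) /\ Pos (snd (fst z))) /\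
  forall n, err_E (fst (fst z)) (snd z) n < tol (snd (fst z)) n.

Definition mlim (b : SB) (x : nat -> nat -> R) : M :=
  epsilon (inhabits (g O b (x O))) (fun m => W b m /\ Un_cv (fun n => d (g n b (x n)) m) 0).

Lemma mlim_unique b x m : W b m -> Un_cv (fun n => d (g n b (x n)) m) 0 -> mlim b x = m.
Proof.
  intros Hm Hc.
  assert (X : exists m, W b m /\ Un_cv (fun n => d (g n b (x n)) m) 0) by (now exists m).
  destruct (epsilon_spec (inhabits (g O b (x O))) _ X) as [H1 H2].
  fold (mlim b x) in H1, H2. apply (d_eq b); auto.
  apply Rle_antisym; [|apply d_ge0]. apply le_epsilon. intros e He. rewrite Rplus_0_l.
  destruct (proj1 (cv0_iff _ (fun n => d_ge0 (g n b (x n)) m)) Hc e He) as [n Hn].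
  apply (d_lim_le (fun n => g n b (x n)) _ _ _ n H2). intro q. left. apply Hn. lia.
Qed.

(** Tolerances decrease in [n] and [tol eta 0] is bounded along the sequence, which supplies [R0];
    [tail8] absorbs the term [/ 8 ^ n], whence the factor [2]. *)
Lemma p_rate (u : nat -> prodS (prodS (prodS SB (metS M d)) Rws) RRs) p :
  (forall j, near_p (u j)) -> near_p p -> lim _ u p ->
  exists n0, forall n j, (n0 <= n)%nat -> (n0 <= j)%nat ->
    d (g n (fst (fst (fst (u j)))) (snd (u j) n)) (snd (fst (fst (u j)))) <=
      2 * C * (tol (snd (fst (u j))) n / 4 ^ n).
Proof.
  intros Hu Hp [[[L1 L2] L3] L4].
  destruct (cv_bounded _ _ (tol_cv (fun j => snd (fst (u j))) _ O L3)) as (B & HB & HBj).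
  destruct (H_p (fun j => fst (fst (u j))) (fst (fst p)) B) as [n0 Hn0].
  { intro j; apply (Hu j). } { apply Hp. } { split; auto. }
  exists n0. intros n j Hn Hj. destruct (Hu j) as [[Hw Hpos] Hgap].
  set (eta := snd (fst (u j))) in *.
  assert (Ht : tol eta n / 4 ^ n <= B / 4 ^ n).
  { apply Rmult_le_compat_r. left; apply Rinv_0_lt_compat, pow4_pos.
    specialize (HBj j). fold eta in HBj. pose proof (Rle_abs (tol eta 0)).
    pose proof (tol_decr_add eta 0 n Hpos). cbn [Nat.add] in *. lra. }
  eapply Rle_trans. apply (Hn0 n j (snd (u j) n) (tol eta n / 4 ^ n) Hn Hj Ht).
  - intros k Hk. left. eapply (proj2 (gap_lt _ n _ _ (tol_pos eta n Hpos))); auto.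
  - pose proof (tail8 eta n Hpos). pose proof C_pos. nra.
Qed.

Lemma lim_const_p p : lim (prodS (prodS (prodS SB (metS M d)) Rws) RRs) (fun _ => p) p.
Proof.
  repeat split; cbn. apply SB_const. rewrite d_refl. apply cv_const.
  intro; apply cv_const. intros n k; apply cv_const.
Qed.

Lemma p_lim p : near_p p ->
  Un_cv (fun n => d (g n (fst (fst (fst p))) (snd p n)) (snd (fst (fst p)))) 0.
Proof.
  intro Hp. destruct (p_rate (fun _ => p) p) as [n0 H]; auto. apply lim_const_p.
  apply cv0_iff. auto. intros e He.
  destruct (tol_unull (fun _ => snd (fst p)) (snd (fst p)) (fun k => cv_const (snd (fst p) k))
    (e / (2 * C))) as [n1 H1]. apply Rdiv_lt_0_compat; lra.
  exists (max n0 n1). intros n Hn. eapply Rle_lt_trans. apply (H n n0); lia.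
  specialize (H1 n1 n ltac:(lia) ltac:(lia)). destruct Hp as [[_ Hpos] _].
  pose proof (tol_pos _ n Hpos).
  assert (tol (snd (fst p)) n / 4 ^ n <= tol (snd (fst p)) n).
  { apply div_le_iff. apply pow4_pos. pose proof (pow_R1_Rle 4 n ltac:(lra)). nra. }
  assert (2 * C * (e / (2 * C)) = e) by (field; lra). pose proof C_pos. nra.
Qed.

(** Compare through [m]: the tuple at stage [S n] is within its radius of the coordinates of [m],
    and the point recovered at stage [n] is near [m] by [p_rate]. The weight [4 ^ S n] against the
    rate at stage [n] costs a factor [4], giving [1 + 8 * C]. *)
Lemma p_unull (u : nat -> prodS (prodS (prodS SB (metS M d)) Rws) RRs) p :
  (forall j, near_p (u j)) -> near_p p -> lim _ u p ->
  unull (fun j => err_E (fst (fst (fst (u j)))) (snd (u j))).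
Proof.
  intros Hu Hp L. destruct (p_rate u p Hu Hp L) as [n0 H]. pose proof C_pos.
  intros e He. destruct (tol_unull (fun j => snd (fst (u j))) (snd (fst p))
    ltac:(apply L) (e / (1 + 8 * C))) as [n1 H1]. apply Rdiv_lt_0_compat; lra.
  exists (S (max n0 n1)). intros j [|n] Hj Hn. lia. cbn [err_E].
  specialize (H n j ltac:(lia) ltac:(lia)). specialize (H1 j n ltac:(lia) ltac:(lia)).
  destruct (Hu j) as [[_ Hpos] Hgap]. specialize (Hgap (S n)).
  set (b := fst (fst (fst (u j)))) in *. set (m := snd (fst (fst (u j)))) in *.
  set (x := snd (u j)) in *. set (eta := snd (fst (u j))) in *.
  pose proof (gap_lip x (S n) (g n b (x n)) m). pose proof (tol_decr eta n Hpos).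
  pose proof (pow4_pos n).
  assert (E : 4 ^ n * (tol eta n / 4 ^ n) = tol eta n) by (field; lra).
  assert (4 ^ n * d (g n b (x n)) m <= 2 * C * tol eta n) by nra.
  assert (tol eta n * (1 + 8 * C) < e).
  { apply (Rmult_lt_compat_r (1 + 8 * C)) in H1; [|lra].
    replace (e / (1 + 8 * C) * (1 + 8 * C)) with e in H1 by (field; lra). exact H1. }
  cbn [pow] in *. nra.
Qed.

Lemma E_step (u : nat -> prodS (prodS SB Rws) RRs) p :
  (forall j, near_E (u j)) -> near_E p -> lim _ u p ->
  exists n0, forall n j, (n0 <= n)%nat -> (n0 <= j)%nat ->
    d (g (S n) (fst (fst (u j))) (snd (u j) (S n))) (g n (fst (fst (u j))) (snd (u j) n)) <=
      2 * C * (tol (snd (fst (u j))) (S n) / 4 ^ S n).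
Proof.
  intros Hu Hp [[L1 L3] L4].
  destruct (cv_bounded _ _ (tol_cv (fun j => snd (fst (u j))) _ O L3)) as (B & HB & HBj).
  destruct (H_E (fun j => fst (fst (u j))) (fst (fst p)) B) as [n0 Hn0]; auto.
  { intro j; apply (Hu j). } { apply Hp. }
  exists n0. intros n j Hn Hj. destruct (Hu j) as [[Hw Hpos] Hgap].
  set (eta := snd (fst (u j))) in *. specialize (Hgap (S n)).
  assert (Ht : tol eta (S n) / 4 ^ S n <= B / 4 ^ n).
  { apply Rmult_le_compat. left; now apply tol_pos. left; apply Rinv_0_lt_compat, pow4_pos.
    specialize (HBj j). fold eta in HBj. pose proof (Rle_abs (tol eta 0)).
    pose proof (tol_decr_add eta 0 (S n) Hpos). cbn [Nat.add] in *. lra.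
    apply Rinv_le_contravar. apply pow4_pos. cbn [pow]. pose proof (pow4_pos n). lra. }
  eapply Rle_trans. apply (Hn0 n j (snd (u j) n) (snd (u j) (S n)) (tol eta (S n) / 4 ^ S n)); auto.
  - intros k Hk. left. eapply (proj2 (gap_lt _ (S n) _ _ (tol_pos eta (S n) Hpos))); auto.
  - pose proof (tail8 eta (S n) Hpos). pose proof C_pos. nra.
Qed.

(** The steps decay geometrically with ratio [/ 4], so their sum is at most [4 / 3] times the first
    bound, and [8 / 3 * C <= 3 * C]. *)
Lemma E_tail (u : nat -> prodS (prodS SB Rws) RRs) p :
  (forall j, near_E (u j)) -> near_E p -> lim _ u p ->
  exists n0, forall n j q, (n0 <= n)%nat -> (n0 <= j)%nat ->
    d (g (n + q) (fst (fst (u j))) (snd (u j) (n + q)%nat)) (g n (fst (fst (u j))) (snd (u j) n)) <=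
      3 * C * (tol (snd (fst (u j))) (S n) / 4 ^ S n).
Proof.
  intros Hu Hp L. destruct (E_step u p Hu Hp L) as [n0 H]. exists n0. intros n j q Hn Hj.
  destruct (Hu j) as [[_ Hpos] _].
  set (eta := snd (fst (u j))) in *. set (b := fst (fst (u j))) in *. set (x := snd (u j)) in *.
  set (A := 2 * C * (tol eta (S n) / 4 ^ S n)).
  assert (HA : 0 < A).
  { unfold A. pose proof C_pos. pose proof (tol_pos eta (S n) Hpos). pose proof (pow4_pos (S n)).
    apply Rmult_lt_0_compat. lra. now apply Rdiv_lt_0_compat. }
  eapply Rle_trans. apply (geom_tail (fun n => g n b (x n)) A n).
  - intro q'. rewrite Nat.add_succ_r. eapply Rle_trans. apply (H (n + q')%nat j); lia.
    fold eta. unfold A. rewrite (Rmult_assoc (2 * C)). apply Rmult_le_compat_l. pose proof C_pos; lra.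
    change (S (n + q')) with (S n + q')%nat. rewrite pow_add, pow_inv.
    pose proof (tol_decr_add eta (S n) q' Hpos). pose proof (pow4_pos (S n)).
    pose proof (pow4_pos q').
    replace (tol eta (S n) / 4 ^ S n * / 4 ^ q') with (tol eta (S n) / (4 ^ S n * 4 ^ q'))
      by (field; lra).
    apply Rmult_le_compat_r; auto. left. apply Rinv_0_lt_compat. nra.
  - unfold A in *. nra.
Qed.

Lemma lim_const_E p : lim (prodS (prodS SB Rws) RRs) (fun _ => p) p.
Proof.
  repeat split; cbn. apply SB_const. intro; apply cv_const. intros n k; apply cv_const.
Qed.

Lemma E_lim p : near_E p ->
  W (fst (fst p)) (mlim (fst (fst p)) (snd p)) /\
  Un_cv (fun n => d (g n (fst (fst p)) (snd p n)) (mlim (fst (fst p)) (snd p))) 0.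
Proof.
  intro Hp. destruct (E_step (fun _ => p) p) as [n0 H]; auto. apply lim_const_E.
  destruct Hp as [[Hb Hpos] _].
  destruct (H_lim (fst (fst p)) (snd p) (2 * C * tol (snd (fst p)) O) n0) as (m & Hm & Hc); auto.
  { intros n Hn. eapply Rle_trans. apply (H n n0); lia. unfold Rdiv.
    rewrite <- Rmult_assoc. pose proof C_pos. pose proof (pow4_pos n).
    pose proof (tol_decr_add (snd (fst p)) 0 (S n) Hpos). cbn [Nat.add] in *.
    pose proof (tol_pos (snd (fst p)) (S n) Hpos).
    apply Rmult_le_compat. nra. left; apply Rinv_0_lt_compat, pow4_pos. nra.
    apply Rinv_le_contravar; auto. cbn [pow]. lra. }
  rewrite (mlim_unique _ _ m Hm Hc). auto.
Qed.

Lemma E_tail_lim (u : nat -> prodS (prodS SB Rws) RRs) p :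
  (forall j, near_E (u j)) -> near_E p -> lim _ u p ->
  exists n0, forall n j, (n0 <= n)%nat -> (n0 <= j)%nat ->
    d (mlim (fst (fst (u j))) (snd (u j))) (g n (fst (fst (u j))) (snd (u j) n)) <=
      3 * C * (tol (snd (fst (u j))) (S n) / 4 ^ S n).
Proof.
  intros Hu Hp L. destruct (E_tail u p Hu Hp L) as [n0 H]. exists n0. intros n j Hn Hj.
  apply (d_lim_le (fun n => g n (fst (fst (u j))) (snd (u j) n)) _ _ _ n).
  apply E_lim; auto. intro q. now apply H.
Qed.

(** Dual to [p_unull]: now the comparison passes through the point recovered at stage [n], whose
    distance to the limit is the tail of the series. *)
Lemma E_unull (u : nat -> prodS (prodS SB Rws) RRs) p :
  (forall j, near_E (u j)) -> near_E p -> lim _ u p ->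
  unull (fun j n => 4 ^ n * gap (snd (u j)) n (mlim (fst (fst (u j))) (snd (u j)))).
Proof.
  intros Hu Hp L. destruct (E_tail_lim u p Hu Hp L) as [n0 H]. pose proof C_pos.
  intros e He. destruct (tol_unull (fun j => snd (fst (u j))) (snd (fst p))
    ltac:(apply L) (e / (1 + 3 * C))) as [n1 H1]. apply Rdiv_lt_0_compat; lra.
  exists (S (max n0 n1)). intros j [|n] Hj Hn. lia.
  specialize (H n j ltac:(lia) ltac:(lia)). specialize (H1 j (S n) ltac:(lia) ltac:(lia)).
  destruct (Hu j) as [[_ Hpos] Hgap]. specialize (Hgap (S n)). cbn [err_E] in Hgap.
  set (b := fst (fst (u j))) in *. set (m := mlim b (snd (u j))) in *.
  set (x := snd (u j)) in *. set (eta := snd (fst (u j))) in *.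
  pose proof (gap_lip x (S n) m (g n b (x n))). pose proof (pow4_pos (S n)).
  assert (E : 4 ^ S n * (tol eta (S n) / 4 ^ S n) = tol eta (S n)) by (field; lra).
  assert (4 ^ S n * d m (g n b (x n)) <= 3 * C * tol eta (S n)) by nra.
  assert (tol eta (S n) * (1 + 3 * C) < e).
  { apply (Rmult_lt_compat_r (1 + 3 * C)) in H1; [|lra].
    replace (e / (1 + 3 * C) * (1 + 3 * C)) with e in H1 by (field; lra). exact H1. }
  nra.
Qed.

(** The recovered points converge to [mlim] uniformly along the sequence, so continuity of a single
    late [g n] gives continuity of the limit by a three-term estimate. *)
Lemma E_cont (u : nat -> prodS (prodS SB Rws) RRs) p :
  (forall j, near_E (u j)) -> near_E p -> lim _ u p ->
  Un_cv (fun j => d (mlim (fst (fst (u j))) (snd (u j))) (mlim (fst (fst p)) (snd p))) 0.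
Proof.
  intros Hu Hp L. apply cv0_iff. auto. intros e He.
  destruct (E_tail_lim u p Hu Hp L) as [n0 H]. pose proof C_pos.
  destruct (tol_unull (fun j => snd (fst (u j))) (snd (fst p)) ltac:(apply L) (e / (9 * C)))
    as [n1 H1]. apply Rdiv_lt_0_compat; lra.
  destruct (proj1 (cv0_iff _ (fun n => d_ge0 _ _)) (proj2 (E_lim p Hp)) (e / 3)) as [n2 H2]. lra.
  set (n := max n0 (max n1 n2)).
  assert (G : Un_cv (fun j => d (g n (fst (fst (u j))) (snd (u j) n))
                                (g n (fst (fst p)) (snd p n))) 0).
  { apply g_cont. intro j; apply (Hu j). apply Hp. apply L. intros k _. apply L. }
  destruct (proj1 (cv0_iff _ (fun n => d_ge0 _ _)) G (e / 3)) as [n3 H3]. lra.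
  exists (max n0 (max n1 n3)). intros j Hj.
  specialize (H n j ltac:(lia) ltac:(lia)). specialize (H1 j (S n) ltac:(lia) ltac:(lia)).
  specialize (H2 n ltac:(lia)). specialize (H3 j ltac:(lia)). cbn beta in *.
  assert (tol (snd (fst (u j))) (S n) / 4 ^ S n <= tol (snd (fst (u j))) (S n)).
  { destruct (Hu j) as [[_ Hpos] _]. pose proof (tol_pos _ (S n) Hpos).
    apply div_le_iff. apply pow4_pos. pose proof (pow_R1_Rle 4 (S n) ltac:(lra)). nra. }
  assert (3 * C * tol (snd (fst (u j))) (S n) < e / 3).
  { apply (Rmult_lt_compat_l (3 * C)) in H1; [|lra].
    replace (3 * C * (e / (9 * C))) with (e / 3) in H1 by (field; lra). exact H1. }
  pose proof (d_tri (mlim (fst (fst (u j))) (snd (u j))) (g n (fst (fst (u j))) (snd (u j) n))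
    (mlim (fst (fst p)) (snd p))).
  pose proof (d_tri (g n (fst (fst (u j))) (snd (u j) n)) (g n (fst (fst p)) (snd p n))
    (mlim (fst (fst p)) (snd p))).
  nra.
Qed.

Lemma err_E_cv (u : nat -> prodS (prodS SB Rws) RRs) p n :
  (forall j, PB (fst (fst (u j)))) -> PB (fst (fst p)) -> lim _ u p ->
  Un_cv (fun j => err_E (fst (fst (u j))) (snd (u j)) n) (err_E (fst (fst p)) (snd p) n).
Proof.
  intros Hu Hp [[L1 L2] L3]. destruct n; cbn [err_E]. apply cv_const.
  apply (CV_mult (fun _ => _)). apply cv_const. apply gap_cv. apply L3.
  apply g_cont; auto. intros k _. apply L3.
Qed.

(** Each side is straightened from boxes by [heq_boxes]. In the middle stand the points [(b, m, x)]
    with two parameters subject to both families of inequalities: seen from the left, the added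
    parameter dominates [err_E]; seen from the right, the added one dominates the gaps to [mlim].
    There [m] equals [mlim b x], so forgetting [m] and exchanging the parameters is invertible. *)
Theorem telescope :
  heq (S := prodS (prodS (prodS (prodS SB (metS M d)) Rws) RRs) Rws)
      (S' := prodS (prodS (prodS SB Rws) RRs) Rws)
    (prodP (prodP (prodP (fun p => W (fst p) (snd p)) Pos) full) Pos)
    (prodP (prodP (prodP PB Pos) full) Pos).
Proof.
  assert (Hrad : forall n a, 0 < a -> 0 < a / 4 ^ n).
  { intros. apply Rdiv_lt_0_compat; auto. apply pow4_pos. }
  assert (Hcv : forall (v : nat -> nat -> R) v0 n, (forall k, Un_cv (fun j => v j k) (v0 k)) ->
    Un_cv (fun j => tol (v j) n / 4 ^ n) (tol v0 n / 4 ^ n)).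
  { intros. apply (CV_mult _ (fun _ => _)). now apply tol_cv. apply cv_const. }
  assert (A1 : heq (S := prodS (prodS (prodS SB (metS M d)) Rws) RRs)
                   (S' := prodS (prodS (prodS SB (metS M d)) Rws) RRs)
    (prodP (prodP (fun p => W (fst p) (snd p)) Pos) full) near_p).
  { eapply heq_trans.
    apply (heq_boxes (prodS (prodS SB (metS M d)) Rws) _ N
      (fun p n _ k => f n k (snd (fst p))) (fun p n => tol (snd p) n / 4 ^ n)).
    - intros p n [_ Hp]. apply Hrad. now apply tol_pos.
    - intros u p n _ _ [_ L]. now apply Hcv.
    - intros u p v v0 n k _ _ [[_ L] _] _ _.
      apply (cv_squeeze _ _ (fun j => d (snd (fst (u j))) (snd (fst p)))); auto.
    - apply heq_iff. intros [[[b m] eta] x]. unfold near_p, prodP; cbn [fst snd].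
      split; intros [H1 H2]; split; auto; intro n; apply gap_lt; auto; apply tol_pos; apply H1. }
  assert (A2 : heq (S := prodS (prodS SB Rws) RRs) (S' := prodS (prodS SB Rws) RRs)
    (prodP (prodP PB Pos) full) near_E).
  { eapply heq_trans.
    (* Stage [0] gets an empty box, since there is no earlier tuple to compare with. *)
    apply (heq_boxes (prodS SB Rws) _ (fun n => match n with O => O | _ => N n end)
      (fun p n pr k => match n with O => 0 | S n' => f n k (g n' (fst p) pr) end)
      (fun p n => tol (snd p) n / 4 ^ n)).
    - intros p n [_ Hp]. apply Hrad. now apply tol_pos.
    - intros u p n _ _ [_ L]. now apply Hcv.
    - intros u p v v0 n k Hu Hp [L1 L2] Lv Hk. destruct n. lia.
      apply (cv_squeeze _ _ (fun j => d (g n (fst (u j)) (v j)) (g n (fst p) v0))). intro; auto.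
      apply g_cont; auto. intro j; apply Hu. apply Hp.
    - apply heq_iff. intros [[b eta] x]. unfold near_E, prodP; cbn [fst snd].
      split; intros [H1 H2]; split; auto; intros [|n].
      + cbn [err_E]. apply tol_pos, H1.
      + cbn [err_E]. apply gap_lt. apply tol_pos, H1. apply (H2 (S n)).
      + intros; lia.
      + apply gap_lt. apply tol_pos, H1. apply (H2 (S n)). }
  assert (D : forall z : prodS (prodS (prodS SB (metS M d)) Rws) RRs, near_p z ->
     mlim (fst (fst (fst z))) (snd z) = snd (fst (fst z))).
  { intros z Hz. apply mlim_unique. apply Hz. now apply p_lim. }
  eapply heq_trans. { apply heq_prod. exact A1. apply heq_refl. }
  eapply heq_trans.
  { apply (heq_dominate _ near_p (fun z => err_E (fst (fst (fst z))) (snd z))).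
    - intros z Hz. apply unull_const. apply (p_unull (fun _ => z) z); auto. apply lim_const_p.
    - intros u z Hu Hz L. split. now apply (p_unull u z). intro n.
      apply (err_E_cv (fun j => ((fst (fst (fst (u j))), snd (fst (u j))), snd (u j)))
        ((fst (fst (fst z)), snd (fst z)), snd z)).
      + intro j. destruct (Hu j) as [[K _] _]. now apply W_base in K.
      + destruct Hz as [[K _] _]. now apply W_base in K.
      + destruct L as [[[L1 L2] L3] L4]. repeat split; auto. }
  eapply heq_trans.
  2: { apply heq_sym. eapply heq_trans. { apply heq_prod. exact A2. apply heq_refl. }
    apply (heq_dominate _ near_E
      (fun z n => 4 ^ n * gap (snd z) n (mlim (fst (fst z)) (snd z)))).
    - intros z Hz. apply unull_const. apply (E_unull (fun _ => z) z); auto. apply lim_const_E.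
    - intros u z Hu Hz L. split. now apply (E_unull u z). intro n.
      apply (CV_mult (fun _ => _)). apply cv_const. apply gap_cv. apply L. now apply E_cont. }
  exists (fun z => (((fst (fst (fst (fst z))), snd z), snd (fst z)), snd (fst (fst z)))),
    (fun z => ((((fst (fst (fst z)), mlim (fst (fst (fst z))) (snd (fst z))), snd z),
      snd (fst z)), snd (fst (fst z)))).
  split; [|split; [|split]].
  - intros [[[[b m] eta] x] eta'] (H1 & H2 & H3).
    assert (E := D _ H1). cbn [fst snd] in *. rewrite E. split; auto.
    destruct H1 as [[K1 K2] K3]. cbn [fst snd] in *. split; [|split]; auto.
    split; auto. cbn. split; auto. now apply W_base in K1.
  - intros [[[b eta'] x] eta] (H1 & H2 & H3). cbn [fst snd] in *. split; auto.
    destruct (E_lim _ H1) as [E1 E2]. destruct H1 as [[K1 K2] K3]. cbn [fst snd] in *.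
    split; [|split]; auto. split; auto.
  - intros u z _ _ [[[[L1 L2] L3] L4] L5]. repeat split; auto.
  - intros u z Hu Hz [[[L1 L2] L3] L4]. repeat split; auto. cbn.
    apply (E_cont (fun j => fst (u j)) (fst z)). intro j; apply (Hu j). apply Hz.
    repeat split; auto.
Qed.

Corollary telescope_Rw :
  heq (S := prodS (prodS SB (metS M d)) Rws) (S' := prodS SB Rws)
    (prodP (fun p => W (fst p) (snd p)) full) (prodP PB full).
Proof.
  apply (heq_trans _ _ _ _ _ _ (heq_sym _ _ _ _ (heq_absorb_all (prodS SB (metS M d)) _))).
  exact (heq_trans _ _ _ _ _ _ telescope (heq_absorb_all SB _)).
Qed.

End Telescope.

Definition unitS : space := Space unit (fun _ _ => True).

Lemma heq_unit (S : space) (P : S -> Prop) :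
  heq (S := prodS unitS S) (S' := S) (prodP full P) P.
Proof.
  exists snd, (fun x => (tt, x)). split; [|split; [|split]].
  - intros [[] x] [_ H]; split; auto.
  - intros y H; repeat split; auto.
  - intros u x _ _ [_ L]; exact L.
  - intros u x _ _ L; split; auto. exact Logic.I.
Qed.

Lemma cv_Rabs_iff (u : nat -> R) l : Un_cv (fun j => Rabs (u j - l)) 0 <-> Un_cv u l.
Proof.
  split; intros H e He; destruct (H e He) as [N HN]; exists N; intros n Hn;
    specialize (HN n Hn); unfold Rdist in *; rewrite Rminus_0_r, Rabs_Rabsolu in *; auto.
Qed.

(** * Half-lines are absorbed *)

(** The telescope over a one-point base, with fibre the half-line, one coordinate and recovery by
    clipping at [0]. Clipping does not increase the distance to a nonnegative number, which gives
    both error estimates. *)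
Lemma heq_halfline :
  heq (S := prodS Rsp Rws) (S' := Rws) (prodP (fun t => 0 <= t) full) full.
Proof.
  assert (T := telescope_Rw unitS full R (fun a b => Rabs (a - b)) (fun _ t => 0 <= t)
    (fun _ => 1%nat) (fun _ _ t => t) (fun _ _ x => Rmax (x O) 0) 1).
  assert (H : heq (S := prodS (prodS unitS (metS R (fun a b => Rabs (a - b)))) Rws)
    (S' := prodS unitS Rws) (prodP (fun p => 0 <= snd p) full) (prodP full full)).
  { apply T; clear T.
    - intro; exact Logic.I.
    - intros; apply Rabs_pos.
    - intros; apply Rabs_minus_sym.
    - intros a b c. replace (a - c) with ((a - b) + (b - c)) by ring. apply Rabs_triang.
    - intro; rewrite Rminus_diag; apply Rabs_R0.
    - intros _ a b _ _ H. destruct (Req_dec a b); auto. apply Rabs_no_R0 with (r := a - b) in H.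
      destruct H. lra.
    - intros; exact Logic.I.
    - intros; lra.
    - intros n u b x x0 _ _ _ H. apply cv_Rabs_iff. apply cv_max. apply H; lia. apply cv_const.
    - lra.
    - intros u p R0 Hu Hp _. exists O. intros n j x r _ _ _ H. specialize (H O ltac:(lia)).
      specialize (Hu j). cbn in *. assert (0 < / 8 ^ n) by apply Rinv_0_lt_compat, pow8_pos.
      apply Rabs_le_iff in H. apply Rabs_le. unfold Rmax. destruct Rle_dec; lra.
    - intros u p R0 _ _ _. exists O. intros n j x x' r _ _ _ H. specialize (H O ltac:(lia)).
      pose proof (Rmax_r (x O) 0).
      assert (0 < / 8 ^ S n) by apply Rinv_0_lt_compat, pow8_pos.
      apply Rabs_le_iff in H. apply Rabs_le. unfold Rmax at 1 3. destruct Rle_dec; lra.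
    - intros b x R0 n0 _ H.
      destruct (R_complete (fun n => Rmax (x n O) 0)) as [l Hl].
      + intros e He.
        assert (HR : 0 <= R0).
        { specialize (H n0 (Nat.le_refl _)). pose proof (pow4_pos n0).
          match type of H with ?A <= _ => assert (0 <= A) by apply Rabs_pos end.
          apply (Rmult_le_compat_r (4 ^ n0)) in H; [|lra].
          unfold Rdiv in H. rewrite (Rmult_assoc R0), Rinv_l in H by lra. nra. }
        assert (K : forall n q, (n0 <= n)%nat ->
          Rabs (Rmax (x (n + q)%nat O) 0 - Rmax (x n O) 0) <= 4 / 3 * (R0 / 4 ^ n)).
        { intros n q Hn. apply (geom_tail R (fun a b => Rabs (a - b)) )
            with (m := fun n => Rmax (x n O) 0).
          - intros; apply Rabs_pos.
          - intros a c c'. replace (a - c') with ((a - c) + (c - c')) by ring. apply Rabs_triang.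
          - intro; rewrite Rminus_diag; apply Rabs_R0.
          - intro q'. rewrite Nat.add_succ_r. eapply Rle_trans. apply H. lia.
            rewrite pow_add, pow_inv. right. field. split; apply pow_nonzero; lra. }
        destruct (pow2_unbounded (3 * R0 / e)) as [n1 Hn1].
        assert (L : 4 / 3 * (R0 / 4 ^ (max n0 n1)) < e / 2).
        { assert (2 ^ n1 <= 4 ^ max n0 n1).
          { transitivity (4 ^ n1). apply pow_incr; lra. apply Rle_pow. lra. lia. }
          apply div_lt_iff in Hn1; auto. pose proof (pow4_pos (max n0 n1)).
          enough (R0 / 4 ^ max n0 n1 < e * (3 / 8)) by lra. apply div_lt_iff; auto. nra. }
        exists (max n0 n1). intros n m Hn Hm. unfold Rdist.
        pose proof (K (max n0 n1) (n - max n0 n1)%nat ltac:(lia)) as K1.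
        pose proof (K (max n0 n1) (m - max n0 n1)%nat ltac:(lia)) as K2.
        replace (max n0 n1 + (n - max n0 n1))%nat with n in K1 by lia.
        replace (max n0 n1 + (m - max n0 n1))%nat with m in K2 by lia.
        apply Rabs_le_iff in K1, K2. apply Rabs_def1; lra.
      + exists l. split.
        * destruct (Rle_lt_dec 0 l); auto. destruct (Hl (- l)) as [q Hq]. lra.
          specialize (Hq q (Nat.le_refl _)). unfold Rdist in Hq. pose proof (Rmax_r (x q O) 0).
          apply Rabs_def2 in Hq. lra.
        * now apply cv_Rabs_iff. }
  apply (fun K => heq_trans _ _ _ _ _ _ K (heq_trans _ _ _ _ _ _ H (heq_unit Rws full))).
  clear H T.
  exists (fun z => ((tt, fst z), snd z)), (fun z => (snd (fst z), snd z)).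
  split; [|split; [|split]].
  - intros [t x] [H _]; repeat split; auto.
  - intros [[[] t] x] [H _]; repeat split; auto.
  - intros u x _ _ [L1 L2]; repeat split; auto. cbn. now apply cv_Rabs_iff.
  - intros u x _ _ [[_ L1] L2]; repeat split; auto. cbn. now apply cv_Rabs_iff.
Qed.

Definition NN (p : nat -> R) : Prop := forall i, 0 <= p i.

(** [R^w] is a countable power of itself, so every half-line can be given its own factor [R^w] to be
    absorbed in. *)
Lemma heq_halflines :
  heq (S := prodS Rws Rws) (S' := Rws) (prodP NN full) full.
Proof.
  eapply heq_trans.
  { apply heq_prod. apply heq_refl. apply heq_sym, heq_Rw_pow. }
  eapply heq_trans.
  2: { eapply heq_trans. apply (heq_pow nat _ _ _ _ heq_halfline).
    eapply heq_trans. 2: apply heq_Rw_pow. apply heq_iff; split; repeat intro; exact Logic.I. }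
  apply heq_sym. eapply heq_trans. apply heq_pow_prod.
  apply heq_prod. apply heq_refl. apply heq_iff; split; repeat intro; exact Logic.I.
Qed.

(** * Closed max-times convex subsets of the cube *)

Definition inf_spec (E : R -> Prop) (m : R) : Prop :=
  0 <= m <= 1 /\ (forall r, 0 <= r -> E r -> m <= r) /\
  (forall c, m < c -> c <= 1 -> exists r, 0 <= r < c /\ E r).

(** The infimum of the nonnegative elements of [E], capped at [1]. *)
Definition infc (E : R -> Prop) : R := epsilon (inhabits 0) (inf_spec E).

Lemma infc_spec E : inf_spec E (infc E).
Proof.
  apply (epsilon_spec (inhabits 0) (inf_spec E)).
  (* The infimum is minus the supremum of the negatives; adjoining [- 1] makes the set nonempty and
     produces the cap at [1]. *)
  destruct (completeness (fun s => s = - 1 \/ (s <= 0 /\ E (- s)))) as [l [Hl1 Hl2]].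
  - exists 0. intros s [->|[H _]]; lra.
  - exists (- 1). now left.
  - exists (- l). split; [|split].
    + split. assert (l <= 0). { apply Hl2. intros s [->|[H _]]; lra. } lra.
      assert (- 1 <= l). { apply Hl1. now left. } lra.
    + intros r Hr He. assert (- r <= l). { apply Hl1. right. rewrite Ropp_involutive. split; auto; lra. }
      lra.
    + intros c Hc Hc1. apply NNPP. intro H.
      assert (l <= - c); [|lra]. apply Hl2. intros s [->|[Hs He]]. lra.
      destruct (Rle_lt_dec s (- c)); auto. destruct H. exists (- s). split; auto. lra.
Qed.

Lemma infc_ge0 E : 0 <= infc E. Proof. apply (proj1 (infc_spec E)). Qed.
Lemma infc_le1 E : infc E <= 1. Proof. apply (proj1 (infc_spec E)). Qed.
Lemma infc_le E r : 0 <= r -> E r -> infc E <= r.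
Proof. apply (proj1 (proj2 (infc_spec E))). Qed.
Lemma infc_ex E c : infc E < c -> c <= 1 -> exists r, 0 <= r < c /\ E r.
Proof. apply (proj2 (proj2 (infc_spec E))). Qed.

(** Common source of the triangle inequality for [hd] and of the Lipschitz bounds for margins and
    coordinate minima: move a witness at cost [e]. *)
Lemma infc_shift (E E' : R -> Prop) e : 0 <= e ->
  (forall r, 0 <= r -> E r -> E' (r + e)) -> infc E' <= infc E + e.
Proof.
  intros He H. destruct (Rle_lt_dec (infc E') (infc E + e)); auto.
  pose proof (infc_le1 E'). destruct (infc_ex E (infc E' - e)) as (r0 & Hr & K); try lra.
  pose proof (infc_le E' (r0 + e) ltac:(lra) (H r0 ltac:(lra) K)). lra.
Qed.

Lemma infc_mono (E E' : R -> Prop) :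
  (forall r, 0 <= r -> E r -> E' r) -> infc E' <= infc E.
Proof.
  intro H. rewrite <- (Rplus_0_r (infc E)). apply infc_shift. lra.
  intros. rewrite Rplus_0_r. auto.
Qed.

Definition rle (u v : Rw) (r : R) : Prop := forall i, Rabs (u i - v i) <= 2 ^ i * r.

Lemma rle_sym u v r : rle u v r -> rle v u r.
Proof. intros H i. rewrite Rabs_minus_sym. apply H. Qed.
Lemma rle_refl u r : 0 <= r -> rle u u r.
Proof. intros H i. rewrite Rminus_diag, Rabs_R0. pose proof (pow2_pos i). nra. Qed.
Lemma rle_tri u v w r s : rle u v r -> rle v w s -> rle u w (r + s).
Proof.
  intros H K i. specialize (H i). specialize (K i).
  replace (u i - w i) with ((u i - v i) + (v i - w i)) by ring.
  pose proof (Rabs_triang (u i - v i) (v i - w i)). lra.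
Qed.
Lemma rle_mono u v r s : r <= s -> rle u v r -> rle u v s.
Proof. intros H K i. specialize (K i). pose proof (pow2_pos i). nra. Qed.

Definition dle (U V : Rw -> Prop) (r : R) : Prop :=
  (forall u, U u -> exists v, V v /\ rle u v r) /\
  (forall v, V v -> exists u, U u /\ rle v u r).

(** The Hausdorff distance for the metric [sup_i 2^-i |u i - v i|], capped at [1]. *)
Definition hd (U V : Rw -> Prop) : R := infc (dle U V).

Lemma dle_sym U V r : dle U V r -> dle V U r.
Proof. intros [H K]; split; auto. Qed.
Lemma dle_mono U V r s : r <= s -> dle U V r -> dle U V s.
Proof.
  intros L [H K]; split; intros u Hu; [destruct (H u Hu) as (v & ? & ?) | destruct (K u Hu) as (v & ? & ?)];
    exists v; split; auto; now apply (rle_mono _ _ r).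
Qed.
Lemma dle_tri U V W r s : dle U V r -> dle V W s -> dle U W (r + s).
Proof.
  intros [H K] [H' K']; split.
  - intros u Hu. destruct (H u Hu) as (v & Hv & L). destruct (H' v Hv) as (w & Hw & L').
    exists w; split; auto. now apply (rle_tri u v w).
  - intros u Hu. destruct (K' u Hu) as (v & Hv & L). destruct (K v Hv) as (w & Hw & L').
    exists w; split; auto. rewrite Rplus_comm. now apply (rle_tri u v w).
Qed.

Lemma hd_ge0 U V : 0 <= hd U V. Proof. apply infc_ge0. Qed.
Lemma hd_le1 U V : hd U V <= 1. Proof. apply infc_le1. Qed.
Lemma hd_le U V r : 0 <= r -> dle U V r -> hd U V <= r. Proof. apply infc_le. Qed.
Lemma hd_dle U V r : hd U V < r -> r <= 1 -> dle U V r.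
Proof.
  intros H K. destruct (infc_ex _ _ H K) as (s & Hs & L). now apply (dle_mono _ _ s); try lra.
Qed.
Lemma hd_sym U V : hd U V = hd V U.
Proof. apply Rle_antisym; apply infc_mono; intros; now apply dle_sym. Qed.
Lemma hd_refl U : hd U U = 0.
Proof.
  apply Rle_antisym; [|apply hd_ge0]. apply hd_le. lra.
  split; intros u Hu; exists u; split; auto; apply rle_refl; lra.
Qed.
Lemma hd_tri U V W : hd U W <= hd U V + hd V W.
Proof.
  destruct (Rle_lt_dec 1 (hd V W)).
  { pose proof (hd_le1 U W). pose proof (hd_ge0 U V). lra. }
  apply le_epsilon. intros e He.
  (* [hd_dle] provides an actual correspondence between the sets only for radii at most [1], hence
     the minimum. *)
  set (s := Rmin 1 (hd V W + e)).
  assert (Hs : hd V W < s <= 1) by (unfold s, Rmin; destruct Rle_dec; lra).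
  pose proof (hd_ge0 V W).
  assert (hd U W <= hd U V + s).
  { apply infc_shift. lra. intros t Ht K. apply (dle_tri _ V). auto. now apply hd_dle. }
  pose proof (Rmin_r 1 (hd V W + e)). unfold s in *. lra.
Qed.

Definition cube (u : Rw) : Prop := forall i, 0 <= u i <= 1.
Definition ones : Rw := fun _ => 1.
Definition clos (U : Rw -> Prop) : Rw -> Prop :=
  fun y => forall e, 0 < e -> exists u, U u /\ rle u y e.

Record Fset (U : Rw -> Prop) : Prop := {
  F_cube : forall u, U u -> cube u;
  F_one : U ones;
  F_conv : forall u v a, U u -> U v -> 0 <= a <= 1 -> U (fun i => Rmax (u i) (a * v i));
  F_closed : forall y, clos U y -> U y }.

Lemma pred_ext (A : Type) (P Q : A -> Prop) : (forall x, P x <-> Q x) -> P = Q.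
Proof.
  intro H. apply functional_extensionality; intro x. now apply propositional_extensionality.
Qed.

Lemma hd_eq U V : Fset U -> Fset V -> hd U V = 0 -> U = V.
Proof.
  intros HU HV H. apply pred_ext. intro y.
  assert (K : forall e, 0 < e -> dle U V e).
  { intros e He. apply (dle_mono _ _ (Rmin 1 e)). apply Rmin_r.
    apply hd_dle; [|apply Rmin_l]. rewrite H. apply Rmin_glb_lt; lra. }
  split; intro Hy.
  - apply (F_closed V HV). intros e He. destruct (proj1 (K e He) y Hy) as (v & ? & ?).
    exists v; split; auto; now apply rle_sym.
  - apply (F_closed U HU). intros e He. destruct (proj2 (K e He) y Hy) as (v & ? & ?).
    exists v; split; auto; now apply rle_sym.
Qed.

Definition one_set : Rw -> Prop := fun y => y = ones.

Lemma F_one_set : Fset one_set.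
Proof.
  split.
  - intros u -> i. unfold ones. lra.
  - reflexivity.
  - intros u v a -> -> Ha. apply functional_extensionality; intro i. unfold ones.
    rewrite Rmult_1_r. apply Rmax_left. lra.
  - intros y Hy. apply functional_extensionality; intro i.
    destruct (Req_dec (y i) (ones i)); auto.
    assert (P : 0 < Rabs (ones i - y i)) by (apply Rabs_pos_lt; lra).
    destruct (Hy (Rabs (ones i - y i) / 2 ^ i / 2)) as (u & -> & Hu).
    { pose proof (pow2_pos i). apply Rdiv_lt_0_compat; [|lra]. now apply Rdiv_lt_0_compat. }
    specialize (Hu i). pose proof (pow2_pos i).
    replace (2 ^ i * (Rabs (ones i - y i) / 2 ^ i / 2)) with (Rabs (ones i - y i) / 2) in Hu
      by (field; lra). lra.
Qed.

Lemma F_conv_fmax U : Fset U -> forall N (k : nat -> R) (c : nat -> Rw) u,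
  U u -> (forall q, (q < N)%nat -> U (c q) /\ 0 <= k q <= 1) ->
  U (fun i => Rmax (u i) (fmax (fun q => k q * c q i) N)).
Proof.
  intros HU N k c u Hu. induction N; intro H.
  - replace (fun i => _) with u; auto. apply functional_extensionality; intro i. cbn.
    symmetry. apply Rmax_left. apply (F_cube U HU u Hu).
  - replace (fun i => _) with (fun i => Rmax (Rmax (u i) (fmax (fun q => k q * c q i) N)) (k N * c N i)).
    + apply (F_conv U HU); try apply H; try lia. apply IHN. intros; apply H; lia.
    + apply functional_extensionality; intro i. cbn. now rewrite Rmax_assoc.
Qed.

(** * The margin of a set inside an open set *)

(* [U] stands for the set of all [x i + ln (u i)], [u] in [U]; the margin is
   measured in the coordinates satisfying [J]. *)
Definition mu (J : nat -> Prop) (X : Rw -> Prop) (x : Rw) (U : Rw -> Prop) : R :=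
  infc (fun r => exists u z, U u /\ ~ X z /\
    forall i, J i -> Rmin 1 (Rabs (u i - exp (z i - x i))) <= 2 ^ i * r).

Lemma Rmin1_lip a b c : Rmin 1 (Rabs (a - c)) <= Rmin 1 (Rabs (b - c)) + Rabs (a - b).
Proof.
  pose proof (Rabs_triang (a - b) (b - c)). replace (a - b + (b - c)) with (a - c) in H by ring.
  pose proof (Rabs_pos (a - b)). unfold Rmin. repeat destruct Rle_dec; lra.
Qed.

Lemma mu_lip J X x U V : mu J X x V <= mu J X x U + hd U V.
Proof.
  destruct (Rle_lt_dec 1 (hd U V)).
  { pose proof (infc_le1 (fun r => exists u z, V u /\ ~ X z /\
    forall i, J i -> Rmin 1 (Rabs (u i - exp (z i - x i))) <= 2 ^ i * r)).
    unfold mu at 1. pose proof (infc_ge0 (fun r => exists u z, U u /\ ~ X z /\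
    forall i, J i -> Rmin 1 (Rabs (u i - exp (z i - x i))) <= 2 ^ i * r)). unfold mu. lra. }
  apply le_epsilon. intros e He.
  set (s := Rmin 1 (hd U V + e)).
  assert (Hs : hd U V < s <= 1) by (unfold s, Rmin; destruct Rle_dec; lra).
  pose proof (hd_ge0 U V).
  assert (mu J X x V <= mu J X x U + s).
  { apply infc_shift. lra. intros t Ht (u & z & Hu & Hz & K).
    destruct (proj1 (hd_dle _ _ _ (proj1 Hs) (proj2 Hs)) u Hu) as (v & Hv & L).
    exists v, z. repeat split; auto. intros i Hi. specialize (K i Hi). specialize (L i).
    rewrite Rabs_minus_sym in L. pose proof (Rmin1_lip (v i) (u i) (exp (z i - x i))). lra. }
  pose proof (Rmin_r 1 (hd U V + e)). unfold s in *. lra.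
Qed.

Lemma mu_lip_abs J X x U V : Rabs (mu J X x U - mu J X x V) <= hd U V.
Proof.
  apply Rabs_le. pose proof (mu_lip J X x U V). pose proof (mu_lip J X x V U).
  rewrite (hd_sym V U) in H0. lra.
Qed.

Lemma mu_anti J X x U V : (forall u, U u -> V u) -> mu J X x V <= mu J X x U.
Proof. intro H. apply infc_mono. intros r _ (u & z & Hu & K). exists u, z. auto. Qed.

Lemma mu_le1 J X x U : mu J X x U <= 1. Proof. apply infc_le1. Qed.
Lemma mu_ge0 J X x U : 0 <= mu J X x U. Proof. apply infc_ge0. Qed.

Lemma mu_dep J X x x' U : (forall i, J i -> x i = x' i) -> mu J X x U = mu J X x' U.
Proof.
  intro H. apply Rle_antisym; apply infc_mono; intros r _ (u & z & Hu & Hz & K); exists u, z;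
    repeat split; auto; intros i Hi; specialize (K i Hi); rewrite H in *; auto.
Qed.

(** If [Rabs (u - q) < 1] then [q < 2], so scaling [q] by [th] moves it by at most
    [2 * Rabs (th - 1)]; otherwise the right side is already at least [1]. *)
Lemma Rmin1_scale u q th : 0 <= u <= 1 -> 0 <= q ->
  Rmin 1 (Rabs (u - q * th)) <= Rmin 1 (Rabs (u - q)) + 2 * Rabs (th - 1).
Proof.
  intros Hu Hq. pose proof (Rabs_pos (th - 1)).
  destruct (Rle_lt_dec 1 (Rabs (u - q))).
  - rewrite (Rmin_left 1 (Rabs (u - q))) by auto. pose proof (Rmin_l 1 (Rabs (u - q * th))). lra.
  - rewrite (Rmin_right 1 (Rabs (u - q))) by lra. eapply Rle_trans. apply Rmin_r.
    apply Rabs_def2 in r.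
    replace (u - q * th) with ((u - q) + - (q * (th - 1))) by ring.
    eapply Rle_trans. apply Rabs_triang. rewrite Rabs_Ropp, Rabs_mult, (Rabs_pos_eq q) by auto.
    apply Rplus_le_compat_l. apply Rmult_le_compat_r; lra.
Qed.

(** Replacing [x] by [x'] multiplies the target values by [exp (x i - x' i)]. Where [2 ^ i * e >= 1]
    the cap by [1] makes the inequality automatic, so only finitely many coordinates of [x] matter;
    this is what makes the margin continuous for pointwise convergence. *)
Lemma mu_x_aux J X x x' U e : 0 <= e -> (forall u, U u -> cube u) ->
  (forall i, 2 ^ i * e < 1 -> 2 * Rabs (exp (x i - x' i) - 1) <= 2 ^ i * e) ->
  mu J X x' U <= mu J X x U + e.
Proof.
  intros He HU H. apply infc_shift; auto. intros r Hr (u & z & Hu & Hz & K).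
  exists u, z. repeat split; auto. intros i Hi. specialize (K i Hi). pose proof (pow2_pos i).
  destruct (Rle_lt_dec 1 (2 ^ i * e)).
  - pose proof (Rmin_l 1 (Rabs (u i - exp (z i - x' i)))). nra.
  - specialize (H i r0). replace (z i - x' i) with ((z i - x i) + (x i - x' i)) by ring.
    rewrite exp_plus.
    pose proof (Rmin1_scale (u i) (exp (z i - x i)) (exp (x i - x' i)) (HU u Hu i)
      (Rlt_le _ _ (exp_pos _))). lra.
Qed.

Lemma mu_cv J X (x : nat -> Rw) x0 (U : nat -> Rw -> Prop) U0 :
  (forall j u, U j u -> cube u) -> (forall i, Un_cv (fun j => x j i) (x0 i)) ->
  Un_cv (fun j => hd (U j) U0) 0 ->
  Un_cv (fun j => mu J X (x j) (U j)) (mu J X x0 U0).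
Proof.
  intros HU Hx Hh e He.
  destruct (pow2_unbounded (3 / e)) as [I HI].
  assert (HI' : 1 < 2 ^ I * (e / 3)) by (apply div_lt_iff in HI; lra).
  destruct (eventually_all (fun i j => 2 * Rabs (exp (x0 i - x j i) - 1) <= e / 3 /\
      2 * Rabs (exp (x j i - x0 i) - 1) <= e / 3) I) as [N1 H1].
  { intros i _. apply eventually_and.
    - destruct (cv_near (fun j => exp (x0 i - x j i)) 1 (e / 6)) as [N HN]. lra.
      rewrite <- exp_0, <- (Rminus_diag (x0 i)). apply cv_exp. apply (CV_minus (fun _ => _)).
      apply cv_const. apply Hx. exists N. intros j Hj. specialize (HN j Hj). lra.
    - destruct (cv_near (fun j => exp (x j i - x0 i)) 1 (e / 6)) as [N HN]. lra.
      rewrite <- exp_0, <- (Rminus_diag (x0 i)). apply cv_exp. apply (CV_minus _ (fun _ => _)).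
      apply Hx. apply cv_const. exists N. intros j Hj. specialize (HN j Hj). lra. }
  destruct (proj1 (cv0_iff _ (fun j => hd_ge0 _ _)) Hh (e / 3)) as [N2 H2]. lra.
  exists (max N1 N2). intros j Hj. specialize (H1 j ltac:(lia)). specialize (H2 j ltac:(lia)).
  assert (G : forall i, 2 ^ i * (e / 3) < 1 -> (i < I)%nat).
  { intros i Hi. destruct (Nat.lt_ge_cases i I); auto.
    assert (2 ^ I <= 2 ^ i) by (apply Rle_pow; [lra | auto]). nra. }
  assert (A : forall i, e / 3 <= 2 ^ i * (e / 3)) by (intro i; pose proof (pow2_ge1 i); nra).
  pose proof (mu_x_aux J X x0 (x j) (U j) (e / 3) ltac:(lra) (HU j)
    (fun i Hi => Rle_trans _ _ _ (proj1 (H1 i (G i Hi))) (A i))).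
  pose proof (mu_x_aux J X (x j) x0 (U j) (e / 3) ltac:(lra) (HU j)
    (fun i Hi => Rle_trans _ _ _ (proj2 (H1 i (G i Hi))) (A i))).
  pose proof (mu_lip_abs J X x0 (U j) U0). apply Rabs_le_iff in H3.
  unfold Rdist. apply Rabs_def1; lra.
Qed.

Definition upto (n i : nat) : Prop := (i <= n)%nat.
Definition all_idx (i : nat) : Prop := True.

Lemma mu_upto_mono X x U n m : (n <= m)%nat -> mu (upto n) X x U <= mu (upto m) X x U.
Proof.
  intro H. apply infc_mono. intros r _ (u & z & Hu & Hz & K). exists u, z. repeat split; auto.
  intros i Hi. apply K. unfold upto in *. lia.
Qed.

Lemma mu_upto_le X x U n : mu (upto n) X x U <= mu all_idx X x U.
Proof.
  apply infc_mono. intros r _ (u & z & Hu & Hz & K). exists u, z. repeat split; auto.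
  intros i Hi. apply K. exact Logic.I.
Qed.

(** Capped differences in coordinates beyond [n] weigh at most [/ 2 ^ n]. If the margin seen up to
    [n] vanished, the full margin would be at most [/ 2 ^ n], which fails for large [n]. *)
Lemma mu_pos_upto X x U : 0 < mu all_idx X x U -> exists n, 0 < mu (upto n) X x U.
Proof.
  intro H. destruct (pow2_unbounded (/ mu all_idx X x U)) as [n Hn]. exists n.
  assert (Hn' : 1 < 2 ^ n * mu all_idx X x U).
  { apply (Rmult_lt_compat_r (mu all_idx X x U)) in Hn; auto. rewrite Rinv_l in Hn; lra. }
  apply Rnot_le_lt. intro L. pose proof (pow2_pos n). pose proof (pow2_ge1 n).
  assert (P : 0 < / 2 ^ n <= 1).
  { split. now apply Rinv_0_lt_compat. rewrite <- Rinv_1. apply Rinv_le_contravar; lra. }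
  destruct (infc_ex _ (/ 2 ^ n) (Rle_lt_trans _ _ _ L (proj1 P)) (proj2 P))
    as (r & Hr & u & z & Hu & Hz & K).
  assert (mu all_idx X x U <= / 2 ^ n).
  { apply infc_le. lra. exists u, z. repeat split; auto. intros i _.
    destruct (Nat.le_gt_cases i n).
    - specialize (K i H2). pose proof (pow2_pos i). nra.
    - eapply Rle_trans. apply Rmin_l. assert (2 ^ n <= 2 ^ i) by (apply Rle_pow; [lra | lia]).
      apply (Rmult_le_reg_r (2 ^ n)); auto. rewrite Rmult_assoc, Rinv_l by lra. lra. }
  apply (Rmult_le_compat_l (2 ^ n)) in H2; [|lra]. rewrite Rinv_r in H2; lra.
Qed.

(** * Open subsets absorb [R^w] *)

(** Keep [y 0 .. y n] and mix the later coordinates of [y] with [z], pair by pair, by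
    the matrix [[1-th, th], [-th, 1-th]].  At [th = 1] this is [ins (S n) 0]: the
    alternating sign compensates the quarter turn. *)
Definition ins (n : nat) (th : R) (y z : nat -> R) (p : nat) : R :=
  if Nat.leb p n then y p else
  let j := Nat.div2 (p - n - 1) in
  if Nat.even (p - n - 1)
  then (1 - th) * ((-1) ^ n * z j) + th * y (n + 1 + j)%nat
  else - th * ((-1) ^ n * z j) + (1 - th) * y (n + 1 + j)%nat.

Definition ins_y (n : nat) (th : R) (o : nat -> R) (i : nat) : R :=
  if Nat.leb i n then o i else
  let j := (i - n - 1)%nat in
  (th * o (n + 1 + 2 * j)%nat + (1 - th) * o (n + 1 + 2 * j + 1)%nat) / ((1 - th) ^ 2 + th ^ 2).
Definition ins_z (n : nat) (th : R) (o : nat -> R) (j : nat) : R :=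
  (-1) ^ n * (((1 - th) * o (n + 1 + 2 * j)%nat - th * o (n + 1 + 2 * j + 1)%nat)
                / ((1 - th) ^ 2 + th ^ 2)).

Lemma ins_det_pos th : 0 < (1 - th) ^ 2 + th ^ 2.
Proof. nra. Qed.
Lemma sgn_sq n : (-1) ^ n * (-1) ^ n = 1.
Proof. rewrite <- Rpow_mult_distr. replace (-1 * -1) with 1 by ring. apply pow1. Qed.

Lemma sgn_cancel n w : (-1) ^ n * ((-1) ^ n * w) = w.
Proof. rewrite <- Rmult_assoc, sgn_sq. ring. Qed.

Lemma ins_low n th y z p : (p <= n)%nat -> ins n th y z p = y p.
Proof. intro H. unfold ins. apply Nat.leb_le in H. now rewrite H. Qed.

Lemma ins_even n th y z j : ins n th y z (n + 1 + 2 * j)%nat =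
  (1 - th) * ((-1) ^ n * z j) + th * y (n + 1 + j)%nat.
Proof.
  unfold ins. destruct (Nat.leb_spec (n + 1 + 2 * j) n). lia.
  replace (n + 1 + 2 * j - n - 1)%nat with (2 * j)%nat by lia.
  rewrite Nat.even_mul; cbn [Nat.even orb]. now rewrite Nat.div2_double.
Qed.

Lemma ins_odd n th y z j : ins n th y z (n + 1 + 2 * j + 1)%nat =
  - th * ((-1) ^ n * z j) + (1 - th) * y (n + 1 + j)%nat.
Proof.
  unfold ins. destruct (Nat.leb_spec (n + 1 + 2 * j + 1) n). lia.
  replace (n + 1 + 2 * j + 1 - n - 1)%nat with (S (2 * j)) by lia.
  rewrite Nat.even_succ, Nat.odd_mul; cbn [Nat.odd Nat.even andb negb].
  now rewrite Nat.div2_succ_double.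
Qed.

Lemma ins_index n p : (p <= n)%nat \/ exists j, p = (n + 1 + 2 * j)%nat \/ p = (n + 1 + 2 * j + 1)%nat.
Proof.
  destruct (Nat.le_gt_cases p n). now left. right.
  destruct (Nat.Even_or_Odd (p - n - 1)) as [[j Hj]|[j Hj]]; exists j; lia.
Qed.

Lemma ins_y_ins n th y z : ins_y n th (ins n th y z) = y.
Proof.
  apply functional_extensionality; intro i. unfold ins_y.
  destruct (Nat.leb_spec i n). now apply ins_low. cbv zeta. rewrite ins_even, ins_odd.
  replace (n + 1 + (i - n - 1))%nat with i by lia. pose proof (ins_det_pos th). field. lra.
Qed.

Lemma ins_z_ins n th y z : ins_z n th (ins n th y z) = z.
Proof.
  apply functional_extensionality; intro j. unfold ins_z. rewrite ins_even, ins_odd.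
  pose proof (ins_det_pos th). transitivity ((-1) ^ n * ((-1) ^ n * z j)).
  f_equal. field. lra. apply sgn_cancel.
Qed.

Lemma ins_ins n th o : ins n th (ins_y n th o) (ins_z n th o) = o.
Proof.
  apply functional_extensionality; intro p. pose proof (ins_det_pos th).
  destruct (ins_index n p) as [H0|[j [-> | ->]]].
  - rewrite ins_low by auto. unfold ins_y. apply Nat.leb_le in H0. now rewrite H0.
  - rewrite ins_even. unfold ins_z, ins_y. rewrite sgn_cancel.
    destruct (Nat.leb_spec (n + 1 + j) n). lia. cbv zeta.
    replace (n + 1 + j - n - 1)%nat with j by lia. field. lra.
  - rewrite ins_odd. unfold ins_z, ins_y. rewrite sgn_cancel.
    destruct (Nat.leb_spec (n + 1 + j) n). lia. cbv zeta.
    replace (n + 1 + j - n - 1)%nat with j by lia. field. lra.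
Qed.

Lemma ins_step n y z : ins n 1 y z = ins (S n) 0 y z.
Proof.
  apply functional_extensionality; intro p.
  destruct (ins_index n p) as [H|[[|j] [-> | ->]]].
  - rewrite !ins_low by lia. reflexivity.
  - rewrite ins_even, ins_low by lia. rewrite !Nat.add_0_r. ring.
  - rewrite ins_odd. replace (n + 1 + 2 * 0 + 1)%nat with (S n + 1 + 2 * 0)%nat by lia.
    rewrite ins_even. cbn [pow]. ring.
  - rewrite ins_even. replace (n + 1 + 2 * S j)%nat with (S n + 1 + 2 * j + 1)%nat by lia.
    rewrite ins_odd. replace (S n + 1 + j)%nat with (n + 1 + S j)%nat by lia. ring.
  - rewrite ins_odd. replace (n + 1 + 2 * S j + 1)%nat with (S n + 1 + 2 * S j)%nat by lia.
    rewrite ins_even. cbn [pow]. ring.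
Qed.

Lemma ins_step_y n o : ins_y n 1 o = ins_y (S n) 0 o.
Proof. rewrite <- (ins_ins n 1 o), ins_y_ins, ins_step. now rewrite ins_y_ins. Qed.
Lemma ins_step_z n o : ins_z n 1 o = ins_z (S n) 0 o.
Proof. rewrite <- (ins_ins n 1 o), ins_z_ins, ins_step. now rewrite ins_z_ins. Qed.

Lemma ins_cv n (th : nat -> R) th0 (y z : nat -> nat -> R) y0 z0 :
  Un_cv th th0 -> (forall i, Un_cv (fun j => y j i) (y0 i)) ->
  (forall i, Un_cv (fun j => z j i) (z0 i)) ->
  forall p, Un_cv (fun j => ins n (th j) (y j) (z j) p) (ins n th0 y0 z0 p).
Proof.
  intros Ht Hy Hz p. unfold ins. destruct Nat.leb. apply Hy. cbv zeta.
  assert (Un_cv (fun j => 1 - th j) (1 - th0)) by (apply (CV_minus (fun _ => _)); [apply cv_const | auto]).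
  destruct Nat.even; apply CV_plus; apply CV_mult; auto;
    try (apply (CV_mult (fun _ => _)); [apply cv_const | apply Hz]).
  now apply CV_opp.
Qed.

Lemma ins_det_cv th th0 : Un_cv th th0 ->
  Un_cv (fun j => / ((1 - th j) ^ 2 + th j ^ 2)) (/ ((1 - th0) ^ 2 + th0 ^ 2)).
Proof.
  intro H. apply cv_inv. pose proof (ins_det_pos th0); lra.
  apply (cv_cont (fun t => (1 - t) ^ 2 + t ^ 2)); auto. apply derivable_continuous_pt. reg.
Qed.

Lemma ins_y_cv n (th : nat -> R) th0 (o : nat -> nat -> R) o0 :
  Un_cv th th0 -> (forall i, Un_cv (fun j => o j i) (o0 i)) ->
  forall p, Un_cv (fun j => ins_y n (th j) (o j) p) (ins_y n th0 o0 p).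
Proof.
  intros Ht Ho p. unfold ins_y. destruct Nat.leb. apply Ho. cbv zeta.
  apply CV_mult. 2: now apply ins_det_cv.
  apply CV_plus; apply CV_mult; auto. apply (CV_minus (fun _ => _)). apply cv_const. auto.
Qed.

Lemma ins_z_cv n (th : nat -> R) th0 (o : nat -> nat -> R) o0 :
  Un_cv th th0 -> (forall i, Un_cv (fun j => o j i) (o0 i)) ->
  forall p, Un_cv (fun j => ins_z n (th j) (o j) p) (ins_z n th0 o0 p).
Proof.
  intros Ht Ho p. unfold ins_z. apply (CV_mult (fun _ => _)). apply cv_const.
  apply CV_mult. 2: now apply ins_det_cv.
  apply CV_minus; apply CV_mult; auto. apply (CV_minus (fun _ => _)). apply cv_const. auto.
Qed.

Lemma cv_either (u a b : nat -> R) l N :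
  (forall j, (N <= j)%nat -> u j = a j \/ u j = b j) -> Un_cv a l -> Un_cv b l -> Un_cv u l.
Proof.
  intros H Ha Hb e He. destruct (Ha e He) as [N1 H1], (Hb e He) as [N2 H2].
  exists (max N (max N1 N2)). intros n Hn. destruct (H n ltac:(lia)) as [-> | ->].
  apply H1; lia. apply H2; lia.
Qed.

Definition setS : space := metS (Rw -> Prop) hd.
Definition pairS : space := prodS Rws setS.

Section Stable.
Variables (X : Rw -> Prop) (G : (Rw -> Prop) -> Prop).
Hypothesis G_cube : forall U, G U -> forall u, U u -> cube u.

Definition inside (p : pairS) : Prop := G (snd p) /\ 0 < mu all_idx X (fst p) (snd p).

Definition lev (p : pairS) (n : nat) : R := mu (upto n) X (fst p) (snd p).
Fixpoint psum (p : pairS) (n : nat) : R :=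
  match n with O => 0 | S m => psum p m + lev p m end.
(** [psum], interpolated linearly, is a clock, and [stop + frac] is the time at which it reaches
    [1]. Levels are nondecreasing and eventually positive, so this time exists. It depends only on
    the coordinates of [x] up to index [stop], those which [ins] leaves alone. *)
Definition stop (p : pairS) : nat :=
  epsilon (inhabits O) (fun n => psum p n < 1 <= psum p (S n)).
Definition frac (p : pairS) (n : nat) : R := (1 - psum p n) / lev p n.

Lemma lev_mono p n m : (n <= m)%nat -> lev p n <= lev p m.
Proof. apply mu_upto_mono. Qed.
Lemma lev_ge0 p n : 0 <= lev p n.
Proof. apply mu_ge0. Qed.
Lemma psum_mono p n m : (n <= m)%nat -> psum p n <= psum p m.
Proof.
  induction 1. lra. cbn [psum]. pose proof (lev_ge0 p m). lra.
Qed.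

Lemma psum_le p n : psum p n <= INR n * lev p n.
Proof.
  induction n. cbn; lra. cbn [psum]. rewrite S_INR. pose proof (lev_mono p n (S n) ltac:(lia)).
  pose proof (pos_INR n). nra.
Qed.

Lemma lev_pos p n : 1 <= psum p (S n) -> 0 < lev p n.
Proof.
  intro H. destruct (lev_ge0 p n); auto. cbn [psum] in H. pose proof (psum_le p n). nra.
Qed.

Lemma stop_unique p n : psum p n < 1 <= psum p (S n) -> stop p = n.
Proof.
  intro H. assert (X1 : exists n, psum p n < 1 <= psum p (S n)) by (now exists n).
  assert (K := epsilon_spec (inhabits O) _ X1). fold (stop p) in K. cbn beta in K.
  destruct (Nat.lt_trichotomy (stop p) n) as [L|[L|L]]; auto.
  pose proof (psum_mono p (S (stop p)) n L). lra.
  pose proof (psum_mono p (S n) (stop p) L). lra.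
Qed.

Lemma stop_spec p : inside p -> psum p (stop p) < 1 <= psum p (S (stop p)).
Proof.
  intros [_ H]. apply (epsilon_spec (inhabits O) (fun n => psum p n < 1 <= psum p (S n))).
  destruct (mu_pos_upto _ _ _ H) as [n Hn]. fold (lev p n) in Hn.
  assert (K : forall q, INR q * lev p n <= psum p (n + q)).
  { induction q. cbn [INR]. rewrite Rmult_0_l. apply (psum_mono p O). lia.
    rewrite S_INR, Nat.add_succ_r. cbn [psum]. pose proof (lev_mono p n (n + q) ltac:(lia)). lra. }
  destruct (INR_unbounded (/ lev p n)) as [q Hq]. specialize (K q).
  assert (1 <= psum p (n + q)).
  { apply (Rmult_lt_compat_r (lev p n)) in Hq; auto. rewrite Rinv_l in Hq; lra. }
  clear K Hq. remember (n + q)%nat as m. clear Heqm. induction m.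
  - cbn in H0. lra.
  - destruct (Rle_lt_dec 1 (psum p m)); auto. exists m. split; auto.
Qed.

Lemma psum_dep x x' U n : (forall i, (i <= n)%nat -> x i = x' i) ->
  forall m, (m <= S n)%nat -> psum (x, U) m = psum (x', U) m.
Proof.
  intros H. induction m; intro Hm; cbn [psum]. reflexivity.
  rewrite IHm by lia. f_equal. apply mu_dep. intros i Hi. apply H. unfold upto in Hi. lia.
Qed.

(** The clock up to this stage reads only unchanged coordinates, so a modified point has the same
    [stop] and [frac], and the inverse map can find them. A positive level at [stop] already bounds
    the full margin from below. *)
Lemma stop_dep x x' U : inside (x, U) -> (forall i, (i <= stop (x, U))%nat -> x i = x' i) ->
  inside (x', U) /\ stop (x', U) = stop (x, U) /\
  frac (x', U) (stop (x, U)) = frac (x, U) (stop (x, U)).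
Proof.
  intros Hin H. pose proof (stop_spec _ Hin) as K. set (n := stop (x, U)) in *.
  assert (E : lev (x', U) n = lev (x, U) n).
  { symmetry. apply mu_dep. exact H. }
  split; [|split].
  - split. apply Hin. apply Rlt_le_trans with (lev (x', U) n). rewrite E. now apply lev_pos.
    apply mu_upto_le.
  - apply stop_unique. now rewrite <- !(psum_dep x x' U n H) by lia.
  - unfold frac. now rewrite E, (psum_dep x x' U n H) by lia.
Qed.

Lemma lev_cv (u : nat -> pairS) p n : (forall j, inside (u j)) -> lim pairS u p ->
  Un_cv (fun j => lev (u j) n) (lev p n).
Proof.
  intros Hu [L1 L2]. apply (mu_cv _ _ (fun j => fst (u j)) _ (fun j => snd (u j))); auto.
  intro j. apply G_cube, Hu.
Qed.

Lemma psum_cv (u : nat -> pairS) p n : (forall j, inside (u j)) -> lim pairS u p ->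
  Un_cv (fun j => psum (u j) n) (psum p n).
Proof.
  intros Hu L. induction n; cbn [psum]. apply cv_const. apply CV_plus; auto. now apply lev_cv.
Qed.

Lemma frac_cv (u : nat -> pairS) p n : (forall j, inside (u j)) -> lim pairS u p ->
  0 < lev p n -> Un_cv (fun j => frac (u j) n) (frac p n).
Proof.
  intros Hu L Hp. unfold frac. apply CV_mult. apply (CV_minus (fun _ => _)). apply cv_const.
  now apply psum_cv. apply cv_inv. lra. now apply lev_cv.
Qed.

(** The stage can jump only when the clock reaches [1] exactly at the end of stage [n]: nearby
    points then stop in [n] with [frac] near [1], or in [S n] with [frac] near [0]. Later stages are
    excluded because [lev p (S n) >= lev p n > 0] pushes the next sum above [1]. *)
Lemma stop_cases (u : nat -> pairS) p : (forall j, inside (u j)) -> inside p ->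
  lim pairS u p -> let n := stop p in
  Un_cv (fun j => frac (u j) n) (frac p n) /\
  exists N, (forall j, (N <= j)%nat -> stop (u j) = n) \/
    (frac p n = 1 /\ Un_cv (fun j => frac (u j) (S n)) 0 /\
     forall j, (N <= j)%nat -> stop (u j) = n \/ stop (u j) = S n).
Proof.
  intros Hu Hp L n. pose proof (stop_spec p Hp) as K. fold n in K.
  pose proof (lev_pos p n (proj2 K)) as Pn. split. now apply frac_cv.
  assert (B : forall m c, psum p m < c -> exists N, forall j, (N <= j)%nat -> psum (u j) m < c).
  { intros m c H. destruct (cv_near _ _ (c - psum p m) ltac:(lra) (psum_cv u p m Hu L)) as [N HN].
    exists N. intros j Hj. specialize (HN j Hj). apply Rabs_def2 in HN. lra. }
  assert (A : forall m c, c < psum p m -> exists N, forall j, (N <= j)%nat -> c < psum (u j) m).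
  { intros m c H. destruct (cv_near _ _ (psum p m - c) ltac:(lra) (psum_cv u p m Hu L)) as [N HN].
    exists N. intros j Hj. specialize (HN j Hj). apply Rabs_def2 in HN. lra. }
  destruct (Rle_lt_or_eq_dec _ _ (proj2 K)) as [S1|S1].
  - destruct (eventually_and _ _ (B n 1 (proj1 K)) (A (S n) 1 S1)) as [N HN].
    exists N. left. intros j Hj. apply stop_unique. destruct (HN j Hj). lra.
  - pose proof (lev_mono p n (S n) ltac:(lia)) as M.
    assert (S2 : 1 < psum p (S (S n))).
    { change (psum p (S (S n))) with (psum p (S n) + lev p (S n)). lra. }
    destruct (eventually_and _ _ (B n 1 (proj1 K)) (A (S (S n)) 1 S2)) as [N HN].
    exists N. right. split; [|split].
    + unfold frac. replace (1 - psum p n) with (lev p n) by (cbn [psum] in S1; lra). field. lra.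
    + replace 0 with (frac p (S n)). apply frac_cv; auto. lra. unfold frac. rewrite <- S1.
      unfold Rdiv. ring.
    + intros j Hj. destruct (HN j Hj). destruct (Rle_lt_dec 1 (psum (u j) (S n))).
      left. now apply stop_unique. right. apply stop_unique. lra.
Qed.

Lemma stop_cv (h : nat -> R -> nat -> R) (h0 : nat -> R -> R) (u : nat -> pairS) p :
  (forall j, inside (u j)) -> inside p -> lim pairS u p ->
  (forall n th th0, Un_cv th th0 -> Un_cv (fun j => h n (th j) j) (h0 n th0)) ->
  (forall n, h0 n 1 = h0 (S n) 0) ->
  Un_cv (fun j => h (stop (u j)) (frac (u j) (stop (u j))) j) (h0 (stop p) (frac p (stop p))).
Proof.
  intros Hu Hp L Hh Hs. destruct (stop_cases u p Hu Hp L) as (C & N & [H|(E & C' & H)]).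
  - apply (cv_ext_eventually (fun j => h (stop p) (frac (u j) (stop p)) j) _ _ N).
    intros j Hj. now rewrite (H j Hj). now apply Hh.
  - apply (cv_either _ (fun j => h (stop p) (frac (u j) (stop p)) j)
      (fun j => h (S (stop p)) (frac (u j) (S (stop p))) j) _ N).
    + intros j Hj. destruct (H j Hj) as [-> | ->]; auto.
    + now apply Hh.
    + rewrite E, Hs. now apply Hh.
Qed.

Theorem heq_stable :
  heq (S := prodS pairS Rws) (S' := pairS) (prodP inside full) inside.
Proof.
  exists (fun q => let n := stop (fst q) in
      (ins n (frac (fst q) n) (fst (fst q)) (snd q), snd (fst q))),
    (fun p => let n := stop p in
      ((ins_y n (frac p n) (fst p), snd p), ins_z n (frac p n) (fst p))).
  split; [|split; [|split]].
  - intros [[x U] z] [H _]. cbv zeta. cbn [fst snd] in *.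
    destruct (stop_dep x (ins (stop (x, U)) (frac (x, U) (stop (x, U))) x z) U H) as (E1 & E2 & E3).
    { intros i Hi. symmetry. now apply ins_low. }
    split; auto. revert E1 E2 E3.
    set (n := stop (x, U)). set (t := frac (x, U) n). set (p := (ins n t x z, U) : pairS).
    intros _ E2 E3.
    change (stop p = n) in E2. change (frac p n = t) in E3.
    change ((ins_y (stop p) (frac p (stop p)) (fst p), U,
      ins_z (stop p) (frac p (stop p)) (fst p)) = (x, U, z)).
    rewrite E2, E3. cbn [fst p]. now rewrite ins_y_ins, ins_z_ins.
  - intros [x U] H. cbv zeta. cbn [fst snd].
    destruct (stop_dep x (ins_y (stop (x, U)) (frac (x, U) (stop (x, U))) x) U H) as (E1 & E2 & E3).
    { intros i Hi. unfold ins_y. apply Nat.leb_le in Hi. now rewrite Hi. }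
    split. split; auto. exact Logic.I. revert E1 E2 E3.
    set (n := stop (x, U)). set (t := frac (x, U) n). set (p := (ins_y n t x, U) : pairS).
    intros _ E2 E3.
    change (stop p = n) in E2. change (frac p n = t) in E3.
    change ((ins (stop p) (frac p (stop p)) (fst p) (ins_z n t x), U) = (x, U)).
    rewrite E2, E3. cbn [fst p]. now rewrite ins_ins.
  - intros u q Hu Hq [L1 L2]. split; cbn [fst snd]. 2: apply L1. intro i.
    apply (stop_cv (fun n th j => ins n th (fst (fst (u j))) (snd (u j)) i)
      (fun n th => ins n th (fst (fst q)) (snd q) i) (fun j => fst (u j)) (fst q)).
    + intro j; apply (Hu j).
    + apply Hq.
    + exact L1.
    + intros n th th0 Ht. apply ins_cv; auto. apply L1.
    + intro n. now rewrite ins_step.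
  - intros u p Hu Hp L. split; [split|]; cbn [fst snd]. 2: apply L.
    + intro i. apply (stop_cv (fun n th j => ins_y n th (fst (u j)) i)
        (fun n th => ins_y n th (fst p) i) u p); auto.
      intros n th th0 Ht. apply ins_y_cv; auto. apply L. intro n. now rewrite ins_step_y.
    + intro i. apply (stop_cv (fun n th j => ins_z n th (fst (u j)) i)
        (fun n th => ins_z n th (fst p) i) u p); auto.
      intros n th th0 Ht. apply ins_z_cv; auto. apply L. intro n. now rewrite ins_step_z.
Qed.
End Stable.

(** * Finite nets of sets *)

Lemma interval_net e : 0 < e -> exists L : list R, forall t, 0 <= t <= 1 ->
  exists v, In v L /\ Rabs (t - v) <= e.
Proof.
  intro He.
  assert (K : forall k, exists L : list R, forall t, 0 <= t <= INR k * e ->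
    exists v, In v L /\ Rabs (t - v) <= e).
  { induction k as [|k [L HL]].
    - exists (0 :: nil). intros t Ht. exists 0. split. now left. cbn in Ht.
      apply Rabs_le. lra.
    - exists (INR k * e :: L). intros t Ht. rewrite S_INR in Ht.
      destruct (Rle_lt_dec t (INR k * e)).
      + destruct (HL t ltac:(lra)) as (v & Hv & E). exists v. split; auto. now right.
      + exists (INR k * e). split. now left. apply Rabs_le. lra. }
  destruct (INR_unbounded (/ e)) as [k Hk]. destruct (K k) as [L HL]. exists L.
  intros t Ht. apply HL. apply (Rmult_lt_compat_r e) in Hk; auto. rewrite Rinv_l in Hk; lra.
Qed.

Lemma cube_net e I : 0 < e -> exists L : list Rw, forall u, cube u ->
  exists v, In v L /\ forall i, (i < I)%nat -> Rabs (u i - v i) <= e.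
Proof.
  intro He. destruct (interval_net e He) as [L1 H1]. induction I as [|I [L HL]].
  - exists (ones :: nil). intros u _. exists ones. split. now left. intros; lia.
  - exists (map (fun p : Rw * R => fun i => if Nat.eqb i I then snd p else fst p i) (list_prod L L1)).
    intros u Hu. destruct (HL u Hu) as (v & Hv & E). destruct (H1 (u I) (Hu I)) as (w & Hw & E').
    exists (fun i => if Nat.eqb i I then w else v i). split.
    + apply (in_map_iff _ _ _). exists (v, w). split; auto. now apply in_prod.
    + intros i Hi. destruct (Nat.eqb_spec i I). now subst. apply E. lia.
Qed.

(** Splitting [P] successively by nearness to each [a] leaves finitely many realized patterns; one
    representative of each is kept, so the representatives again satisfy [P]. *)
Lemma finite_reps (A B : Type) (near : A -> B -> Prop) (L : list A) (P : B -> Prop) :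
  exists L' : list B, (forall C, In C L' -> P C) /\
    forall U, P U -> exists C, In C L' /\ forall a, In a L -> (near a U <-> near a C).
Proof.
  revert P. induction L as [|a L IH]; intro P.
  - destruct (classic (exists U, P U)) as [[U HU]|H].
    + exists (U :: nil). split. intros C [<-|[]]; auto. intros V _. exists U. split. now left.
      intros ? [].
    + exists nil. split. intros ? []. intros U HU. destruct H. now exists U.
  - destruct (IH (fun U => P U /\ near a U)) as (L1 & H1 & K1).
    destruct (IH (fun U => P U /\ ~ near a U)) as (L2 & H2 & K2).
    exists (L1 ++ L2). split.
    + intros C HC. apply in_app_or in HC. destruct HC as [HC|HC]. now apply H1. now apply H2.
    + intros U HU. destruct (classic (near a U)) as [N|N].
      * destruct (K1 U (conj HU N)) as (C & HC & E). exists C. split. apply in_or_app; auto.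
        intros b [<-|Hb]; auto. split; intros _; auto. now apply H1.
      * destruct (K2 U (conj HU N)) as (C & HC & E). exists C. split. apply in_or_app; auto.
        intros b [<-|Hb]; auto. split; intro Q. now destruct N. now apply H2 in Q.
Qed.

(** Record which points of a finite [e / 2]-net, in the first [I] coordinates of the cube, are
    approached by the set. Sets with equal records are within [e]: coordinates from [I] on impose
    nothing since [2 ^ I * e > 1]. *)
Lemma Fset_net e : 0 < e -> exists L : list (Rw -> Prop),
  (forall C, In C L -> Fset C) /\ forall U, Fset U -> exists C, In C L /\ dle U C e.
Proof.
  intro He. destruct (pow2_unbounded (/ e)) as [I HI].
  assert (HI' : 1 < 2 ^ I * e).
  { apply (Rmult_lt_compat_r e) in HI; auto. rewrite Rinv_l in HI; lra. }
  destruct (cube_net (e / 2) I ltac:(lra)) as [G HG].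
  destruct (finite_reps Rw (Rw -> Prop)
    (fun g U => exists u, U u /\ forall i, (i < I)%nat -> Rabs (u i - g i) <= e / 2) G Fset)
    as (L & HL & K).
  exists L. split; auto. intros U HU. destruct (K U HU) as (C & HC & E). exists C. split; auto.
  assert (Q : forall V W, Fset V -> Fset W ->
    (forall a, In a G ->
       (exists u, V u /\ forall i, (i < I)%nat -> Rabs (u i - a i) <= e / 2) ->
       exists u, W u /\ forall i, (i < I)%nat -> Rabs (u i - a i) <= e / 2) ->
    forall u, V u -> exists w, W w /\ rle u w e).
  { intros V W HV HW H u Hu. destruct (HG u (F_cube V HV u Hu)) as (g & Hg & D).
    destruct (H g Hg) as (w & Hw & D'). now exists u. exists w. split; auto. intro i.
    pose proof (pow2_ge1 i). destruct (Nat.lt_ge_cases i I).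
    - specialize (D i H1). specialize (D' i H1). apply Rabs_le_iff in D, D'.
      assert (e <= 2 ^ i * e) by nra. apply Rabs_le. lra.
    - assert (2 ^ I <= 2 ^ i) by (apply Rle_pow; [lra | auto]).
      pose proof (F_cube V HV u Hu i). pose proof (F_cube W HW w Hw i).
      assert (1 <= 2 ^ i * e) by nra. apply Rabs_le. lra. }
  pose proof (HL C HC). split; apply Q; auto; intros a Ha; now apply E.
Qed.

Definition net (n : nat) : list (Rw -> Prop) :=
  epsilon (inhabits nil) (fun L => (forall C, In C L -> Fset C) /\
    forall U, Fset U -> exists C, In C L /\ dle U C (/ 8 ^ n)).

Lemma net_spec n : (forall C, In C (net n) -> Fset C) /\
    forall U, Fset U -> exists C, In C (net n) /\ dle U C (/ 8 ^ n).
Proof.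
  apply (epsilon_spec (inhabits nil) (fun L => (forall C, In C L -> Fset C) /\
    forall U, Fset U -> exists C, In C L /\ dle U C (/ 8 ^ n))).
  apply Fset_net. apply Rinv_0_lt_compat, pow8_pos.
Qed.

Definition netN (n : nat) : nat := length (net n).
(** The default [one_set] is itself an [Fset], so no index bound is needed in [netC_F]. *)
Definition netC (n k : nat) : Rw -> Prop := nth k (net n) one_set.

Lemma netC_F n k : Fset (netC n k).
Proof.
  unfold netC. destruct (nth_in_or_default k (net n) one_set) as [H|H].
  now apply (proj1 (net_spec n)). rewrite H. apply F_one_set.
Qed.

Lemma netC_dense n U : Fset U -> exists k, (k < netN n)%nat /\ dle U (netC n k) (/ 8 ^ n).
Proof.
  intro HU. destruct (proj2 (net_spec n) U HU) as (C & HC & D).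
  destruct (In_nth _ _ one_set HC) as (k & Hk & E). exists k. split; auto. unfold netC.
  now rewrite E.
Qed.

Lemma netN_pos n : (0 < netN n)%nat.
Proof. destruct (netC_dense n _ F_one_set) as (k & Hk & _). lia. Qed.

(** * Closures, mixtures and truncations *)

Lemma clos_incl (A : Rw -> Prop) u : A u -> clos A u.
Proof. intros H e He. exists u. split; auto. apply rle_refl. lra. Qed.

Lemma clos_dle A B r : dle A B r -> forall e, 0 < e -> dle (clos A) (clos B) (r + e).
Proof.
  intros [H K] e He. split.
  - intros u Hu. destruct (Hu e He) as (a & Ha & L). destruct (H a Ha) as (b & Hb & L').
    exists b. split. now apply clos_incl. rewrite Rplus_comm. apply (rle_tri u a b); auto.
    now apply rle_sym.
  - intros u Hu. destruct (Hu e He) as (a & Ha & L). destruct (K a Ha) as (b & Hb & L').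
    exists b. split. now apply clos_incl. rewrite Rplus_comm. apply (rle_tri u a b); auto.
    now apply rle_sym.
Qed.

Lemma hd_clos A B r : 0 <= r -> dle A B r -> hd (clos A) (clos B) <= r.
Proof.
  intros Hr H. apply le_epsilon. intros e He. apply hd_le. lra. now apply clos_dle.
Qed.

Lemma clos_Fset U : Fset U -> clos U = U.
Proof.
  intro H. apply pred_ext; intro y; split. apply (F_closed U H). apply clos_incl.
Qed.

Lemma clos_ge A i c : (forall u, A u -> c <= u i) -> forall u, clos A u -> c <= u i.
Proof.
  intros H u Hu. apply le_epsilon. intros e He.
  destruct (Hu (e / 2 ^ i)) as (a & Ha & L). apply Rdiv_lt_0_compat; auto. apply pow2_pos.
  specialize (L i). specialize (H a Ha). pose proof (pow2_pos i).
  replace (2 ^ i * (e / 2 ^ i)) with e in L by (field; lra). apply Rabs_le_iff in L. lra.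
Qed.

Lemma clos_le A i c : (forall u, A u -> u i <= c) -> forall u, clos A u -> u i <= c.
Proof.
  intros H u Hu. apply le_epsilon. intros e He.
  destruct (Hu (e / 2 ^ i)) as (a & Ha & L). apply Rdiv_lt_0_compat; auto. apply pow2_pos.
  specialize (L i). specialize (H a Ha). pose proof (pow2_pos i).
  replace (2 ^ i * (e / 2 ^ i)) with e in L by (field; lra). apply Rabs_le_iff in L. lra.
Qed.

Lemma Rmax_dist a b c d e : Rabs (a - c) <= e -> Rabs (b - d) <= e ->
  Rabs (Rmax a b - Rmax c d) <= e.
Proof.
  intros H K. apply Rabs_le_iff in H, K. apply Rabs_le. unfold Rmax.
  repeat destruct Rle_dec; lra.
Qed.

Lemma scaled_dist a u v e : 0 <= a <= 1 -> Rabs (u - v) <= e -> Rabs (a * u - a * v) <= e.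
Proof.
  intros Ha H. rewrite <- Rmult_minus_distr_l, Rabs_mult, (Rabs_pos_eq a) by lra.
  pose proof (Rabs_pos (u - v)). nra.
Qed.

Lemma Fset_clos A : (forall u, A u -> cube u) -> A ones ->
  (forall u v a, A u -> A v -> 0 <= a <= 1 -> A (fun i => Rmax (u i) (a * v i))) ->
  Fset (clos A).
Proof.
  intros H1 H2 H3. split.
  - intros u Hu i. split. apply (clos_ge A i 0); auto. intros; now apply H1.
    apply (clos_le A i 1); auto. intros; now apply H1.
  - now apply clos_incl.
  - intros u v a Hu Hv Ha e He. destruct (Hu e He) as (u' & Hu' & L).
    destruct (Hv e He) as (v' & Hv' & L'). exists (fun i => Rmax (u' i) (a * v' i)).
    split; auto. intro i. apply Rmax_dist. apply L. apply scaled_dist; auto.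
  - intros y Hy e He. destruct (Hy (e / 2) ltac:(lra)) as (u & Hu & L).
    destruct (Hu (e / 2) ltac:(lra)) as (a & Ha & L'). exists a. split; auto.
    replace e with (e / 2 + e / 2) by field. now apply (rle_tri a u y).
Qed.

(** A max-times linear combination of the sets [C q], joined with [gam] to keep every coordinate
    bounded below. [mixset] takes the closure so that [F_closed] holds by construction. *)
Definition rawmix (N : nat) (C : nat -> Rw -> Prop) (k : nat -> R) (gam : Rw) : Rw -> Prop :=
  fun y => exists c : nat -> Rw, (forall q, (q < N)%nat -> C q (c q)) /\
    forall i, y i = Rmax (gam i) (fmax (fun q => k q * c q i) N).
Definition mixset N C k gam := clos (rawmix N C k gam).

Lemma fmax_dist h h' N e : 0 <= e ->
  (forall q, (q < N)%nat -> Rabs (h q - h' q) <= e) -> Rabs (fmax h N - fmax h' N) <= e.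
Proof.
  intros He H. induction N; cbn. rewrite Rminus_diag, Rabs_R0; auto.
  apply Rmax_dist. apply IHN; intros; apply H; lia. apply H; lia.
Qed.

(** The max-times analogue of nonnegative coefficients with sum one. *)
Definition weights (N : nat) (k : nat -> R) : Prop :=
  (forall q, (q < N)%nat -> 0 <= k q <= 1) /\ exists q, (q < N)%nat /\ k q = 1.

Lemma fmax_weights N k t : weights N k -> 0 <= t -> fmax (fun q => k q * t) N = t.
Proof.
  intros [H (q & Hq & E)] Ht. apply Rle_antisym.
  - apply fmax_le; auto. intros r Hr. specialize (H r Hr). nra.
  - replace t with (k q * t) at 1 by (rewrite E; ring).
    apply (fmax_ge (fun q => k q * t)); auto.
Qed.

Lemma fmax_scale h N a : 0 <= a -> a * fmax h N = fmax (fun q => a * h q) N.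
Proof.
  intro Ha. induction N; cbn. ring. rewrite <- IHN. symmetry. now apply RmaxRmult.
Qed.

Lemma fmax_max h h' N : Rmax (fmax h N) (fmax h' N) = fmax (fun q => Rmax (h q) (h' q)) N.
Proof.
  induction N; cbn. apply Rmax_left; lra. rewrite <- IHN. unfold Rmax.
  repeat destruct Rle_dec; lra.
Qed.

Lemma F_mixset N C k gam : (forall q, (q < N)%nat -> Fset (C q)) -> weights N k ->
  (forall i, 0 <= gam i <= 1) -> Fset (mixset N C k gam).
Proof.
  intros HC Hk Hg. apply Fset_clos.
  - intros u (c & Hc & E) i. rewrite E. split.
    + eapply Rle_trans; [apply (Hg i) | apply Rmax_l].
    + apply Rmax_lub. apply Hg. apply fmax_le. lra. intros q Hq.
      pose proof (F_cube _ (HC q Hq) _ (Hc q Hq) i). destruct Hk as [Hk _].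
      specialize (Hk q Hq). nra.
  - exists (fun _ => ones). split. intros q Hq. apply (F_one _ (HC q Hq)).
    intro i. unfold ones. rewrite fmax_weights; auto; try lra. symmetry. apply Rmax_right, Hg.
  - intros u v a (c & Hc & E) (c' & Hc' & E') Ha.
    exists (fun q i => Rmax (c q i) (a * c' q i)). split.
    + intros q Hq. apply (F_conv _ (HC q Hq)); auto.
    + intro i. rewrite E, E'. rewrite <- RmaxRmult by lra. rewrite fmax_scale by lra.
      transitivity (Rmax (gam i) (Rmax (fmax (fun q => k q * c q i) N)
        (fmax (fun q => a * (k q * c' q i)) N))).
      * assert (a * gam i <= gam i) by (specialize (Hg i); nra).
        unfold Rmax. repeat destruct Rle_dec; lra.
      * rewrite fmax_max. f_equal. apply fmax_ext. intros q Hq.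
        rewrite <- RmaxRmult by (apply Hk; auto). f_equal. ring.
Qed.

Lemma mixset_ge N C k gam u i : mixset N C k gam u -> gam i <= u i.
Proof. apply clos_ge. intros v (c & _ & E). rewrite E. apply Rmax_l. Qed.

Lemma mixset_hd N C k k' gam gam' r : 0 <= r ->
  (forall q, (q < N)%nat -> Fset (C q)) ->
  (forall q, (q < N)%nat -> Rabs (k q - k' q) <= r) ->
  (forall i, Rabs (gam i - gam' i) <= 2 ^ i * r) ->
  hd (mixset N C k gam) (mixset N C k' gam') <= r.
Proof.
  intros Hr HC Hk Hg. apply hd_clos; auto.
  assert (D : forall c i, (forall q, (q < N)%nat -> C q (c q)) ->
    Rabs (Rmax (gam i) (fmax (fun q => k q * c q i) N) -
          Rmax (gam' i) (fmax (fun q => k' q * c q i) N)) <= 2 ^ i * r).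
  { intros c i Hc. pose proof (pow2_ge1 i). apply Rmax_dist. auto. apply fmax_dist. nra.
    intros q Hq. specialize (Hk q Hq). pose proof (F_cube _ (HC q Hq) _ (Hc q Hq) i).
    rewrite <- Rmult_minus_distr_r, Rabs_mult, (Rabs_pos_eq (c q i)) by lra.
    pose proof (Rabs_pos (k q - k' q)). nra. }
  split; intros u (c & Hc & E).
  - exists (fun i => Rmax (gam' i) (fmax (fun q => k' q * c q i) N)). split. now exists c.
    intro i. rewrite E. now apply D.
  - exists (fun i => Rmax (gam i) (fmax (fun q => k q * c q i) N)). split. now exists c.
    intro i. rewrite E, Rabs_minus_sym. now apply D.
Qed.

(* A mixture of sets close to a convex [U] is close to [U]: pick the components
   near a given point of [U], respectively replace them by points of [U]. *)
Lemma mixset_near N C k gam U r : 0 <= r -> Fset U -> weights N k ->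
  (forall q, (q < N)%nat -> Fset (C q)) ->
  (forall q, (q < N)%nat -> 0 < k q -> dle U (C q) r) ->
  (forall i u, U u -> gam i <= u i) ->
  hd (mixset N C k gam) U <= r.
Proof.
  intros Hr HU Hk HC HD Hg. rewrite <- (clos_Fset U HU). apply hd_clos; auto.
  assert (D : forall c c' i, (forall q, (q < N)%nat -> 0 < k q -> rle (c q) (c' q) r) ->
    Rabs (Rmax (gam i) (fmax (fun q => k q * c q i) N) -
          Rmax (gam i) (fmax (fun q => k q * c' q i) N)) <= 2 ^ i * r).
  { intros c c' i Hc. pose proof (pow2_ge1 i). apply Rmax_dist.
    rewrite Rminus_diag, Rabs_R0. nra. apply fmax_dist. nra.
    intros q Hq. destruct (proj1 Hk q Hq) as [[P|P] P1].
    - apply scaled_dist. lra. apply Hc; auto.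
    - rewrite <- P, !Rmult_0_l, Rminus_diag, Rabs_R0. nra. }
  split.
  - intros u (c & Hc & E).
    assert (X1 : forall q, exists v, (q < N)%nat -> U v /\ (0 < k q -> rle (c q) v r)).
    { intro q. destruct (Nat.lt_ge_cases q N). 2: { exists ones. intros; lia. }
      destruct (Rlt_le_dec 0 (k q)).
      - destruct (proj2 (HD q H r0) _ (Hc q H)) as (v & Hv & L). exists v. intros _. now split.
      - exists ones. intros _. split. apply (F_one U HU). intros; lra. }
    set (c' := fun q => proj1_sig (constructive_indefinite_description _ (X1 q))).
    assert (Hc' : forall q, (q < N)%nat -> U (c' q) /\ (0 < k q -> rle (c q) (c' q) r)).
    { intro q. unfold c'. now destruct constructive_indefinite_description. }
    exists (fun i => fmax (fun q => k q * c' q i) N).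
    assert (HV : U (fun i => fmax (fun q => k q * c' q i) N)).
    { destruct Hk as [Hk (q & Hq & Eq)].
      replace (fun i => fmax _ N) with (fun i => Rmax (c' q i) (fmax (fun q => k q * c' q i) N)).
      - apply (F_conv_fmax U HU). now apply Hc'. intros; split. now apply Hc'. now apply Hk.
      - apply functional_extensionality; intro i. apply Rmax_right.
        replace (c' q i) with (k q * c' q i) by (rewrite Eq; ring).
        apply (fmax_ge (fun q => k q * c' q i)); auto. }
    split; auto. intro i. rewrite E.
    rewrite <- (Rmax_right (gam i) (fmax (fun q => k q * c' q i) N)).
    apply D. intros q Hq. now apply Hc'. apply (Hg i _ HV).
  - intros u Hu.
    assert (X1 : forall q, exists v, (q < N)%nat -> C q v /\ (0 < k q -> rle u v r)).
    { intro q. destruct (Nat.lt_ge_cases q N). 2: { exists ones. intros; lia. }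
      destruct (Rlt_le_dec 0 (k q)).
      - destruct (proj1 (HD q H r0) _ Hu) as (v & Hv & L). exists v. intros _. now split.
      - exists ones. intros _. split. apply (F_one _ (HC q H)). intros; lra. }
    set (c := fun q => proj1_sig (constructive_indefinite_description _ (X1 q))).
    assert (Hc : forall q, (q < N)%nat -> C q (c q) /\ (0 < k q -> rle u (c q) r)).
    { intro q. unfold c. now destruct constructive_indefinite_description. }
    exists (fun i => Rmax (gam i) (fmax (fun q => k q * c q i) N)). split.
    + exists c. split; auto. intros q Hq. now apply Hc.
    + intro i. replace (u i) with (Rmax (gam i) (fmax (fun q => k q * u i) N)).
      apply (D (fun _ => u)). intros q Hq. now apply Hc.
      rewrite fmax_weights; auto. apply Rmax_right. now apply Hg. apply (F_cube U HU u Hu).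
Qed.

Definition trunc (k : R) (U : Rw -> Prop) : Rw -> Prop := fun y => U y /\ forall i, k <= y i.

Lemma F_trunc k U : 0 <= k <= 1 -> Fset U -> Fset (trunc k U).
Proof.
  intros Hk HU. split.
  - intros u [Hu _]. now apply (F_cube U HU).
  - split. apply (F_one U HU). intro; apply Hk.
  - intros u v a [Hu Lu] [Hv Lv] Ha. split. now apply (F_conv U HU).
    intro i. eapply Rle_trans; [apply (Lu i) | apply Rmax_l].
  - intros y Hy. split.
    + apply (F_closed U HU). intros e He. destruct (Hy e He) as (u & [Hu _] & L). now exists u.
    + intro i. apply (clos_ge (trunc k U)); auto. intros u [_ L]. apply L.
Qed.

Lemma hd_trunc k k' U U' : 0 <= k <= 1 -> 0 <= k' <= 1 -> Fset U -> Fset U' ->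
  hd (trunc k U) (trunc k' U') <= hd U U' + Rabs (k - k').
Proof.
  intros Hk Hk' HU HU'. pose proof (Rabs_pos (k - k')). pose proof (hd_ge0 U U').
  destruct (Rle_lt_dec 1 (hd U U')). { pose proof (hd_le1 (trunc k U) (trunc k' U')). lra. }
  apply le_epsilon. intros e He.
  set (s := Rmin 1 (hd U U' + e)).
  assert (Hs : hd U U' < s <= 1) by (unfold s, Rmin; destruct Rle_dec; lra).
  assert (hd (trunc k U) (trunc k' U') <= s + Rabs (k - k')).
  { apply hd_le. lra. destruct (hd_dle _ _ _ (proj1 Hs) (proj2 Hs)) as [D1 D2].
    assert (Q : forall V l l' u v, Fset V -> 0 <= l' <= 1 -> Rabs (l - l') = Rabs (k - k') ->
      V v -> rle u v s -> (forall i, l <= u i) ->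
      exists w, trunc l' V w /\ rle u w (s + Rabs (k - k'))).
    (* Joining [v] with [l' * ones] lifts it above the level [l'] and stays in [V], because [V] is
       convex and contains [ones]. *)
    { intros V l l' u v HV Hl' El Hv L Lu. exists (fun i => Rmax (v i) (l' * ones i)).
      split. split. apply (F_conv V HV); auto. apply (F_one V HV).
      intro i. unfold ones. rewrite Rmult_1_r. apply Rmax_r.
      intro i. unfold ones. rewrite Rmult_1_r. rewrite <- (Rmax_left (u i) l) by auto.
      specialize (L i). pose proof (pow2_ge1 i).
      apply Rmax_dist. nra. rewrite El. nra. }
    split; intros u [Hu Lu].
    - destruct (D1 u Hu) as (v & Hv & L). now apply (Q U' k k' u v).
    - destruct (D2 u Hu) as (v & Hv & L). apply (Q U k' k u v); auto. apply Rabs_minus_sym. }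
  pose proof (Rmin_r 1 (hd U U' + e)). unfold s in *. lra.
Qed.

Lemma trunc_id k U : (forall u i, U u -> k <= u i) -> trunc k U = U.
Proof. intro H. apply pred_ext; intro y; split. now intros [? _]. intro Hy; split; auto. Qed.

Lemma trunc1 U : Fset U -> trunc 1 U = one_set.
Proof.
  intro HU. apply pred_ext; intro y; split.
  - intros [Hy L]. apply functional_extensionality; intro i. unfold ones.
    pose proof (F_cube U HU y Hy i). specialize (L i). lra.
  - intros ->. split. apply (F_one U HU). intro; unfold ones; lra.
Qed.

Lemma hd_one_set k U : 0 <= k <= 1 -> Fset U -> hd (trunc k U) one_set <= 1 - k.
Proof.
  intros Hk HU. rewrite <- (trunc1 U HU). eapply Rle_trans. apply hd_trunc; auto; lra.
  rewrite hd_refl, Rabs_minus_sym, Rabs_pos_eq; lra.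
Qed.

(** * Completeness *)

Lemma small_pow q c e : 0 <= q < 1 -> 0 < e -> exists n0, forall n, (n0 <= n)%nat -> c * q ^ n < e.
Proof.
  intros Hq He. destruct (pow_lt_1_zero q ltac:(rewrite Rabs_pos_eq; lra) (e / (Rabs c + 1)))
    as [N HN]. pose proof (Rabs_pos c). apply Rdiv_lt_0_compat; lra.
  exists N. intros n Hn. specialize (HN n Hn). pose proof (Rabs_pos c). pose proof (Rle_abs c).
  assert (0 <= q ^ n) by (apply pow_le; lra). rewrite Rabs_pos_eq in HN by auto.
  apply (Rmult_lt_compat_l (Rabs c + 1)) in HN; [|lra].
  replace ((Rabs c + 1) * (e / (Rabs c + 1))) with e in HN by (field; lra). nra.
Qed.

Section Complete.
Variables (U : nat -> Rw -> Prop) (A : R) (n0 : nat).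
Hypothesis HF : forall n, Fset (U n).
Hypothesis A_pos : 0 < A.
Hypothesis HD : forall n, (n0 <= n)%nat -> dle (U n) (U (S n)) (A / 4 ^ n).

(** The lower Kuratowski limit; since consecutive distances are summable it is also the Hausdorff
    limit. *)
Definition klim : Rw -> Prop := fun y => forall e, 0 < e -> exists N, forall n, (N <= n)%nat ->
  exists u, U n u /\ rle u y e.

Lemma quarter_step n q : A / 4 ^ (n + q) = A / 4 ^ n * (/ 4) ^ q.
Proof.
  rewrite pow_add, pow_inv. pose proof (pow4_pos n). pose proof (pow4_pos q). field. lra.
Qed.

Lemma quarter_sum n q :
  2 * (A / 4 ^ n) * (1 - (/ 4) ^ q) + A / 4 ^ (n + q) <= 2 * (A / 4 ^ n) * (1 - (/ 4) ^ S q).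
Proof.
  rewrite quarter_step. cbn [pow]. assert (0 < (/ 4) ^ q) by (apply pow_lt; lra).
  assert (0 < A / 4 ^ n) by (apply Rdiv_lt_0_compat; auto; apply pow4_pos). nra.
Qed.

Lemma dle_chain n q : (n0 <= n)%nat -> dle (U n) (U (n + q)) (2 * (A / 4 ^ n) * (1 - (/ 4) ^ q)).
Proof.
  intro Hn. induction q.
  - rewrite Nat.add_0_r. cbn [pow]. rewrite Rminus_diag, Rmult_0_r.
    split; intros u Hu; exists u; split; auto; apply rle_refl; lra.
  - rewrite Nat.add_succ_r. eapply dle_mono. apply quarter_sum.
    eapply dle_tri. exact IHq. apply HD. lia.
Qed.

(** Starting from [u], a point of the next set within the allowed step is chosen again and again.
    The chain is Cauchy in each coordinate and its total length is below [2 * (A / 4 ^ n)]. *)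
Lemma klim_reach n u : (n0 <= n)%nat -> U n u -> exists y, klim y /\ rle u y (2 * (A / 4 ^ n)).
Proof.
  intros Hn Hu.
  set (nxt := fun q (v : Rw) => epsilon (inhabits v)
     (fun w => U (n + S q)%nat w /\ rle v w (A / 4 ^ (n + q)))).
  set (a := fix a q := match q with O => u | S q' => nxt q' (a q') end).
  assert (Hs : forall q v, U (n + q)%nat v ->
    U (n + S q)%nat (nxt q v) /\ rle v (nxt q v) (A / 4 ^ (n + q))).
  { intros q v Hv. unfold nxt.
    apply (epsilon_spec (inhabits v) (fun w => U (n + S q)%nat w /\ rle v w (A / 4 ^ (n + q)))).
    rewrite Nat.add_succ_r. apply HD; auto. lia. }
  assert (Ha : forall q, U (n + q)%nat (a q)).
  { induction q. now rewrite Nat.add_0_r. now apply Hs. }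
  assert (La : forall q, rle (a q) (a (S q)) (A / 4 ^ (n + q))).
  { intro q. now apply Hs. }
  assert (Lc : forall q r, rle (a q) (a (q + r)%nat) (2 * (A / 4 ^ (n + q)) * (1 - (/ 4) ^ r))).
  { intros q r. induction r.
    - rewrite Nat.add_0_r. cbn [pow]. rewrite Rminus_diag, Rmult_0_r. apply rle_refl; lra.
    - rewrite Nat.add_succ_r. eapply rle_mono. apply quarter_sum.
      eapply rle_tri. exact IHr. rewrite <- Nat.add_assoc. apply La. }
  assert (Lb : forall q r, rle (a q) (a (q + r)%nat) (2 * (A / 4 ^ (n + q)))).
  { intros q r. eapply rle_mono; [|apply Lc].
    assert (0 < (/ 4) ^ r) by (apply pow_lt; lra).
    assert (0 < A / 4 ^ (n + q)) by (apply Rdiv_lt_0_compat; auto; apply pow4_pos). nra. }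
  assert (Sm : forall e, 0 < e -> exists q, 2 * (A / 4 ^ (n + q)) < e).
  { intros e He. destruct (small_pow (/ 4) (2 * (A / 4 ^ n)) e ltac:(lra) He) as [q Hq].
    exists q. rewrite quarter_step. specialize (Hq q ltac:(lia)). lra. }
  assert (X1 : forall i, exists l, Un_cv (fun q => a q i) l).
  { intro i. destruct (R_complete (fun q => a q i)) as [l Hl].
    - intros e He. pose proof (pow2_pos i).
      destruct (Sm (e / 2 / 2 ^ i)) as [q Hq]. apply Rdiv_lt_0_compat; lra.
      assert (Hq' : 2 ^ i * (2 * (A / 4 ^ (n + q))) < e / 2).
      { apply (Rmult_lt_compat_l (2 ^ i)) in Hq; auto.
        replace (2 ^ i * (e / 2 / 2 ^ i)) with (e / 2) in Hq by (field; lra). exact Hq. }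
      exists q. intros m m' Hm Hm'. unfold Rdist.
      pose proof (Lb q (m - q)%nat i) as K1. pose proof (Lb q (m' - q)%nat i) as K2.
      replace (q + (m - q))%nat with m in K1 by lia.
      replace (q + (m' - q))%nat with m' in K2 by lia.
      apply Rabs_le_iff in K1, K2. apply Rabs_def1; lra.
    - now exists l. }
  set (y := fun i => proj1_sig (constructive_indefinite_description _ (X1 i))).
  assert (Hy : forall i, Un_cv (fun q => a q i) (y i)).
  { intro i. unfold y. now destruct constructive_indefinite_description. }
  assert (Ly : forall q, rle (a q) y (2 * (A / 4 ^ (n + q)))).
  { intros q i. apply (cv_le (fun r => Rabs (a q i - a (q + r)%nat i))).
    - apply cv_abs. apply (CV_minus (fun _ => _)). apply cv_const.
      intros e He. destruct (Hy i e He) as [N HN]. exists N. intros m Hm. apply HN. lia.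
    - intro r. apply Lb. }
  exists y. split.
  - intros e He. destruct (Sm e He) as [q Hq]. exists (n + q)%nat. intros m Hm.
    exists (a (m - n)%nat). split. replace m with (n + (m - n))%nat at 1 by lia. apply Ha.
    apply (rle_mono _ _ (2 * (A / 4 ^ (n + (m - n))))). 2: apply Ly.
    assert (A / 4 ^ (n + (m - n)) <= A / 4 ^ (n + q)).
    { apply Rmult_le_compat_l. lra. apply Rinv_le_contravar. apply pow4_pos.
      apply Rle_pow. lra. lia. }
    lra.
  - specialize (Ly O). rewrite Nat.add_0_r in Ly. exact Ly.
Qed.

Lemma klim_dle n e : (n0 <= n)%nat -> 0 < e -> dle (U n) klim (2 * (A / 4 ^ n) + e).
Proof.
  intros Hn He. split.
  - intros u Hu. destruct (klim_reach n u Hn Hu) as (y & Hy & L). exists y. split; auto.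
    apply (rle_mono _ _ (2 * (A / 4 ^ n))); auto. lra.
  - intros y Hy. destruct (Hy e He) as [N HN]. destruct (HN (n + N)%nat ltac:(lia)) as (u & Hu & L).
    destruct (proj2 (dle_chain n N Hn) u Hu) as (w & Hw & L'). exists w. split; auto.
    rewrite Rplus_comm. apply (rle_tri y u w). now apply rle_sym.
    eapply rle_mono; [|exact L']. assert (0 < (/ 4) ^ N) by (apply pow_lt; lra).
    assert (0 < A / 4 ^ n) by (apply Rdiv_lt_0_compat; auto; apply pow4_pos). nra.
Qed.

Lemma klim_hd n : (n0 <= n)%nat -> hd (U n) klim <= 2 * (A / 4 ^ n).
Proof.
  intro Hn. apply le_epsilon. intros e He. apply hd_le.
  assert (0 < A / 4 ^ n) by (apply Rdiv_lt_0_compat; auto; apply pow4_pos). lra.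
  now apply klim_dle.
Qed.

Lemma klim_ge i c : (forall n u, U n u -> c <= u i) -> forall y, klim y -> c <= y i.
Proof.
  intros H y Hy. apply (clos_ge (fun u => exists n, U n u) i c).
  - intros u [n Hn]. now apply (H n).
  - intros e He. destruct (Hy e He) as [N HN]. destruct (HN N (Nat.le_refl _)) as (u & Hu & L).
    exists u. split; auto. now exists N.
Qed.

Lemma F_klim : Fset klim.
Proof.
  split.
  - intros y Hy i. split. apply (klim_ge i 0); auto. intros n u Hu. apply (F_cube _ (HF n) u Hu).
    apply (clos_le (fun u => exists n, U n u) i 1).
    + intros u [n Hn]. apply (F_cube _ (HF n) u Hn).
    + intros e He. destruct (Hy e He) as [N HN]. destruct (HN N (Nat.le_refl _)) as (u & Hu & L).
      exists u. split; auto. now exists N.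
  - intros e He. exists O. intros n _. exists ones. split. apply (F_one _ (HF n)).
    apply rle_refl. lra.
  - intros u v a Hu Hv Ha e He. destruct (Hu e He) as [N HN], (Hv e He) as [N' HN'].
    exists (max N N'). intros n Hn. destruct (HN n ltac:(lia)) as (u' & Hu' & L).
    destruct (HN' n ltac:(lia)) as (v' & Hv' & L'). exists (fun i => Rmax (u' i) (a * v' i)).
    split. now apply (F_conv _ (HF n)). intro i. apply Rmax_dist. apply L. apply scaled_dist; auto.
  - intros y Hy e He. destruct (Hy (e / 2) ltac:(lra)) as (u & Hu & L).
    destruct (Hu (e / 2) ltac:(lra)) as [N HN]. exists N. intros n Hn.
    destruct (HN n Hn) as (w & Hw & L'). exists w. split; auto.
    replace e with (e / 2 + e / 2) by field. now apply (rle_tri w u y).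
Qed.
End Complete.

(** * Approximation inside an open set *)

Fixpoint fmin (x : nat -> R) (K : nat) : R :=
  match K with O => x O | S k => Rmin (fmin x k) (x (S k)) end.

Lemma fmin_le x K k : (k <= K)%nat -> fmin x K <= x k.
Proof.
  induction K; intro H; cbn [fmin]. replace k with O by lia. lra.
  destruct (Nat.eq_dec k (S K)). subst. apply Rmin_r. eapply Rle_trans. apply Rmin_l.
  apply IHK. lia.
Qed.

Lemma fmin_attained x K : exists k, (k <= K)%nat /\ fmin x K = x k.
Proof.
  induction K as [|K (k & Hk & E)]; cbn [fmin]. now exists O.
  unfold Rmin. destruct Rle_dec. exists k. split; auto. exists (S K). now split.
Qed.

Lemma fmin_cv (x : nat -> nat -> R) x0 K :
  (forall k, (k <= K)%nat -> Un_cv (fun j => x j k) (x0 k)) ->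
  Un_cv (fun j => fmin (x j) K) (fmin x0 K).
Proof.
  induction K; intro H; cbn [fmin]. apply H; lia. apply cv_min. apply IHK; intros; apply H; lia.
  apply H; lia.
Qed.

(** Weight [1] at the smallest entry, falling linearly to [0] at height [/ 8 ^ n] above it: a
    continuous substitute for choosing the nearest net element. [fmin] includes its upper index,
    hence [pred]. *)
Definition kw (n : nat) (x : nat -> R) (q : nat) : R :=
  Rmax 0 (1 - (x q - fmin x (pred (netN n))) * 8 ^ n).

Lemma kw_weights n x : weights (netN n) (kw n x).
Proof.
  pose proof (netN_pos n). split.
  - intros q Hq. unfold kw. pose proof (fmin_le x (pred (netN n)) q ltac:(lia)).
    pose proof (pow8_pos n). split. apply Rmax_l. apply Rmax_lub. lra. nra.
  - destruct (fmin_attained x (pred (netN n))) as (q & Hq & E). exists q. split. lia.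
    unfold kw. rewrite E, Rminus_diag, Rmult_0_l. rewrite Rmax_right; lra.
Qed.

Lemma kw_cv n (x : nat -> nat -> R) x0 q :
  (forall k, (k < netN n)%nat -> Un_cv (fun j => x j k) (x0 k)) -> (q < netN n)%nat ->
  Un_cv (fun j => kw n (x j) q) (kw n x0 q).
Proof.
  intros H Hq. unfold kw. apply cv_max. apply cv_const. apply (CV_minus (fun _ => _)).
  apply cv_const. apply (CV_mult _ (fun _ => _)). 2: apply cv_const. apply CV_minus.
  now apply H. apply fmin_cv. intros. apply H. lia.
Qed.

Definition gamma (p : Rw) : Rw := fun i => / (1 + p i).

Lemma gamma_range p i : NN p -> 0 < gamma p i <= 1.
Proof.
  intro H. specialize (H i). unfold gamma. split. apply Rinv_0_lt_compat; lra.
  rewrite <- Rinv_1. apply Rinv_le_contravar; lra.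
Qed.

Definition mixn (n : nat) (p : Rw) (x : nat -> R) : Rw -> Prop :=
  mixset (netN n) (netC n) (kw n x) (gamma p).

Lemma F_mixn n p x : NN p -> Fset (mixn n p x).
Proof.
  intro Hp. apply F_mixset. intros; apply netC_F. apply kw_weights.
  intro i. pose proof (gamma_range p i Hp). lra.
Qed.

(** Let [k] be a net element within [/ 8 ^ n] of [U]. An index [q] of positive weight has
    [x q < x k + / 8 ^ n], and passing from entries to true distances costs [r] twice; so all sets
    really mixed are within [2 * (r + / 8 ^ n)] of [U]. *)
Lemma mixn_near n p x U r : NN p -> Fset U -> (forall i u, U u -> gamma p i <= u i) ->
  (forall k, (k < netN n)%nat -> Rabs (x k - hd U (netC n k)) <= r) ->
  hd (mixn n p x) U <= 2 * (r + / 8 ^ n).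
Proof.
  intros Hp HU Hg H. pose proof (netN_pos n) as HN.
  assert (Hr : 0 <= r). { specialize (H O HN). pose proof (Rabs_pos (x O - hd U (netC n O))). lra. }
  pose proof (pow8_pos n) as P8. assert (P : 0 < / 8 ^ n) by now apply Rinv_0_lt_compat.
  destruct (Rle_lt_dec 1 (2 * (r + / 8 ^ n))).
  { pose proof (hd_le1 (mixn n p x) U). lra. }
  apply mixset_near; auto. lra. apply kw_weights. intros; apply netC_F.
  intros q Hq Hk. apply hd_dle; [|lra].
  destruct (netC_dense n U HU) as (k & Hk1 & D). apply hd_le in D; [|lra].
  pose proof (H k Hk1) as K1. pose proof (H q Hq) as K2. apply Rabs_le_iff in K1, K2.
  pose proof (fmin_le x (pred (netN n)) k ltac:(lia)).
  unfold kw in Hk.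
  assert (0 < 1 - (x q - fmin x (pred (netN n))) * 8 ^ n).
  { unfold Rmax in Hk. destruct Rle_dec; lra. }
  assert (x q - fmin x (pred (netN n)) < / 8 ^ n).
  { apply (Rmult_lt_reg_r (8 ^ n)); auto. rewrite Rinv_l; lra. }
  lra.
Qed.

Lemma gamma_lip p p' i : NN p -> NN p' -> Rabs (gamma p i - gamma p' i) <= 1.
Proof.
  intros H H'. pose proof (gamma_range p i H). pose proof (gamma_range p' i H').
  apply Rabs_le. lra.
Qed.

Lemma mixn_cv n (p : nat -> Rw) p0 (x : nat -> nat -> R) x0 :
  (forall j, NN (p j)) -> NN p0 -> (forall i, Un_cv (fun j => p j i) (p0 i)) ->
  (forall k, (k < netN n)%nat -> Un_cv (fun j => x j k) (x0 k)) ->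
  Un_cv (fun j => hd (mixn n (p j) (x j)) (mixn n p0 x0)) 0.
Proof.
  intros Hp Hp0 Lp Lx. apply cv0_iff. intro; apply hd_ge0. intros e He.
  destruct (pow2_unbounded (/ (e / 2))) as [I HI].
  assert (HI' : 1 < 2 ^ I * (e / 2)).
  { apply (Rmult_lt_compat_r (e / 2)) in HI; [|lra]. rewrite Rinv_l in HI; lra. }
  destruct (eventually_all (fun q j => Rabs (kw n (x j) q - kw n x0 q) < e / 2) (netN n))
    as [N1 H1].
  { intros q Hq. apply cv_near. lra. now apply kw_cv. }
  destruct (eventually_all (fun i j => Rabs (gamma (p j) i - gamma p0 i) < e / 2) I) as [N2 H2].
  { intros i _. apply cv_near. lra. apply cv_inv. specialize (Hp0 i); lra.
    apply (CV_plus (fun _ => _)). apply cv_const. apply Lp. }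
  exists (max N1 N2). intros j Hj. specialize (H1 j ltac:(lia)). specialize (H2 j ltac:(lia)).
  apply Rle_lt_trans with (e / 2); [|lra]. apply mixset_hd. lra. intros; apply netC_F.
  intros q Hq. left. now apply H1.
  intro i. pose proof (pow2_ge1 i). destruct (Nat.lt_ge_cases i I).
  - specialize (H2 i H0). assert (e / 2 <= 2 ^ i * (e / 2)) by nra. lra.
  - assert (2 ^ I <= 2 ^ i) by (apply Rle_pow; [lra | auto]).
    pose proof (gamma_lip (p j) p0 i (Hp j) Hp0). nra.
Qed.

(** * Truncation levels that restore the margin *)

Section Inside.
Variable X : Rw -> Prop.

Definition marg (x : Rw) (U : Rw -> Prop) : R := mu all_idx X x U.

(* Larger truncation levels give smaller sets, hence larger margins; the decreasing
   threshold makes the optimal level depend continuously on the set. *)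
Definition kapE (x : Rw) (v : R) (V : Rw -> Prop) (eps k : R) : Prop :=
  k <= 1 /\ 1 + eps * (1 - k) <= v * marg x (trunc k V).
Definition kap x v V eps : R := infc (kapE x v V eps).

Lemma scale_pos x v U : 1 < v * marg x U -> 1 < v.
Proof.
  intro H. pose proof (mu_ge0 all_idx X x U). pose proof (mu_le1 all_idx X x U).
  unfold marg in H. destruct (Rle_lt_dec v 1); auto. nra.
Qed.

Lemma marg_lip x U V : Rabs (marg x U - marg x V) <= hd U V.
Proof. apply mu_lip_abs. Qed.

Lemma marg_trunc_lip x V k k' : Fset V -> 0 <= k <= 1 -> 0 <= k' <= 1 ->
  Rabs (marg x (trunc k V) - marg x (trunc k' V)) <= Rabs (k - k').
Proof.
  intros HV Hk Hk'. eapply Rle_trans. apply marg_lip. eapply Rle_trans. now apply hd_trunc.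
  rewrite hd_refl. lra.
Qed.

Lemma kapE_up x v V eps k k' : 0 < eps -> 0 < v -> kapE x v V eps k -> k <= k' <= 1 ->
  kapE x v V eps k'.
Proof.
  intros He Hv [H1 H2] H. split. apply H.
  assert (marg x (trunc k V) <= marg x (trunc k' V)).
  { apply mu_anti. intros u [Hu L]. split; auto. intro i. specialize (L i). lra. }
  nra.
Qed.

(** The infimum is attained, the margin being Lipschitz in the level; level [1] is always admissible
    because truncation there gives [one_set]. *)
Lemma kapE_kap x v V eps : Fset V -> 0 < eps -> 1 < v * marg x one_set ->
  kapE x v V eps (kap x v V eps).
Proof.
  intros HV He Hv. pose proof (scale_pos x v _ Hv). set (k := kap x v V eps).
  assert (Hk : 0 <= k <= 1) by (split; [apply infc_ge0 | apply infc_le1]).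
  split. lra. destruct (Rle_lt_dec (1 + eps * (1 - k)) (v * marg x (trunc k V))) as [|D]; auto.
  destruct (Req_dec k 1) as [E|E].
  { rewrite E, trunc1 in * by auto. lra. }
  (* A change of level by less than [c] alters [v] times the margin and the threshold together by
     less than [(v + eps) * c], the deficit at [k]; so no admissible level lies just above [k]. *)
  set (c := (1 + eps * (1 - k) - v * marg x (trunc k V)) / (v + eps)).
  assert (Hc : 0 < c) by (apply Rdiv_lt_0_compat; lra).
  destruct (infc_ex (kapE x v V eps) (Rmin 1 (k + c))) as (r & Hr & Hr1 & Hr2).
  { fold (kap x v V eps). fold k. apply Rmin_glb_lt; lra. } { apply Rmin_l. }
  pose proof (infc_le (kapE x v V eps) r ltac:(lra) (conj Hr1 Hr2)) as Hkr.
  fold (kap x v V eps) in Hkr. fold k in Hkr.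
  pose proof (Rmin_r 1 (k + c)).
  pose proof (marg_trunc_lip x V r k HV ltac:(lra) Hk) as L.
  rewrite (Rabs_pos_eq (r - k)) in L by lra. apply Rabs_le_iff in L.
  assert (Ec : c * (v + eps) = 1 + eps * (1 - k) - v * marg x (trunc k V)).
  { unfold c. field. lra. }
  nra.
Qed.

Lemma kap_ge0 x v V eps : 0 <= kap x v V eps.
Proof. apply infc_ge0. Qed.
Lemma kap_le1 x v V eps : kap x v V eps <= 1.
Proof. apply infc_le1. Qed.

Lemma kap_le x v V eps k : 0 <= k -> kapE x v V eps k -> kap x v V eps <= k.
Proof. apply infc_le. Qed.

(** The solution [s] of [v * (marg x one_set - s) = 1 + s]. Truncation at level [1 - s] is then
    admissible for every [Fset], so [1 - kap] is bounded below in terms of the base point alone. *)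
Definition slack (x : Rw) (v : R) : R := (v * marg x one_set - 1) / (v + 1).

Lemma slack_range x v : 1 < v * marg x one_set -> 0 < slack x v <= 1.
Proof.
  intro H. pose proof (scale_pos x v _ H). pose proof (mu_le1 all_idx X x one_set).
  unfold slack. split. apply Rdiv_lt_0_compat; lra. apply div_le_iff. lra.
  unfold marg in *. nra.
Qed.

Lemma kap_slack x v V eps : Fset V -> 0 < eps <= 1 -> 1 < v * marg x one_set ->
  slack x v <= 1 - kap x v V eps.
Proof.
  intros HV He Hv. pose proof (scale_pos x v _ Hv). pose proof (slack_range x v Hv) as Hs.
  assert (kap x v V eps <= 1 - slack x v); [|lra]. apply kap_le. lra. split. lra.
  pose proof (marg_lip x (trunc (1 - slack x v) V) one_set) as L.
  pose proof (hd_one_set (1 - slack x v) V ltac:(lra) HV). apply Rabs_le_iff in L.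
  assert (E : slack x v * (v + 1) = v * marg x one_set - 1) by (unfold slack; field; lra).
  nra.
Qed.

(** The threshold strictly decreases in [k] while the margin does not decrease, so slightly above
    the optimal level the inequality is strict; slightly below, it fails strictly by minimality.
    Strict inequalities at fixed levels persist for nearby data. *)
Lemma kap_cv (x : nat -> Rw) x0 (v : nat -> R) v0 (V : nat -> Rw -> Prop) V0 eps :
  0 < eps -> (forall j, Fset (V j)) -> Fset V0 ->
  (forall i, Un_cv (fun j => x j i) (x0 i)) -> Un_cv v v0 -> Un_cv (fun j => hd (V j) V0) 0 ->
  (forall j, 1 < v j * marg (x j) one_set) -> 1 < v0 * marg x0 one_set ->
  Un_cv (fun j => kap (x j) (v j) (V j) eps) (kap x0 v0 V0 eps).
Proof.
  intros He HV HV0 Lx Lv LV Hj H0.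
  assert (C : forall k, 0 <= k <= 1 ->
    Un_cv (fun j => v j * marg (x j) (trunc k (V j))) (v0 * marg x0 (trunc k V0))).
  { intros k Hk. apply CV_mult; auto. apply mu_cv; auto.
    - intros j u [Hu _]. now apply (F_cube _ (HV j)).
    - apply (cv_squeeze _ _ (fun j => hd (V j) V0)); auto. intro j.
      rewrite Rminus_0_r, Rabs_pos_eq by apply hd_ge0.
      eapply Rle_trans. now apply hd_trunc. rewrite Rminus_diag, Rabs_R0. lra. }
  intros e Hpe. set (k := kap x0 v0 V0 eps).
  pose proof (kap_ge0 x0 v0 V0 eps) as K0. pose proof (kap_le1 x0 v0 V0 eps) as K1. fold k in K0, K1.
  assert (UP : exists N, forall j, (N <= j)%nat -> kap (x j) (v j) (V j) eps < k + e).
  { destruct (Rle_lt_dec 1 (k + e / 2)).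
    { exists O. intros j _. pose proof (kap_le1 (x j) (v j) (V j) eps). lra. }
    assert (Q : 1 + eps * (1 - (k + e / 2)) < v0 * marg x0 (trunc (k + e / 2) V0)).
    { destruct (kapE_kap x0 v0 V0 eps HV0 He H0) as [_ Q]. fold k in Q.
      assert (marg x0 (trunc k V0) <= marg x0 (trunc (k + e / 2) V0)).
      { apply mu_anti. intros u [Hu L]. split; auto. intro i. specialize (L i). lra. }
      pose proof (scale_pos _ _ _ H0). nra. }
    destruct (cv_near _ _ (v0 * marg x0 (trunc (k + e / 2) V0) - (1 + eps * (1 - (k + e / 2))))
      ltac:(lra) (C (k + e / 2) ltac:(lra))) as [N HN].
    exists N. intros j Hj'. specialize (HN j Hj'). apply Rabs_def2 in HN.
    apply Rle_lt_trans with (k + e / 2); [|lra]. apply kap_le. lra. split; lra. }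
  assert (LO : exists N, forall j, (N <= j)%nat -> k - e < kap (x j) (v j) (V j) eps).
  { destruct (Rle_lt_dec (k - e / 2) 0).
    { exists O. intros j _. pose proof (kap_ge0 (x j) (v j) (V j) eps). lra. }
    assert (Q : v0 * marg x0 (trunc (k - e / 2) V0) < 1 + eps * (1 - (k - e / 2))).
    { apply Rnot_le_lt. intro Q. assert (k <= k - e / 2); [|lra].
      apply kap_le. lra. split; lra. }
    destruct (cv_near _ _ (1 + eps * (1 - (k - e / 2)) - v0 * marg x0 (trunc (k - e / 2) V0))
      ltac:(lra) (C (k - e / 2) ltac:(lra))) as [N HN].
    exists N. intros j Hj'. specialize (HN j Hj'). apply Rabs_def2 in HN.
    apply Rnot_le_lt. intro B.
    destruct (kapE_up (x j) (v j) (V j) eps (kap (x j) (v j) (V j) eps) (k - e / 2) He)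
      as [_ Q']. pose proof (scale_pos _ _ _ (Hj j)); lra. now apply kapE_kap. lra. lra. }
  destruct (eventually_and _ _ UP LO) as [N HN]. exists N. intros j Hj'.
  destruct (HN j Hj'). unfold Rdist. apply Rabs_def1; lra.
Qed.

Definition BS : space := prodS (prodS Rws Rws) Rsp.

Definition baseP (b : BS) : Prop :=
  NN (snd (fst b)) /\ 1 < snd b * marg (fst (fst b)) one_set.
Definition fibP (b : BS) (U : Rw -> Prop) : Prop :=
  NN (snd (fst b)) /\ Fset U /\ (forall i u, U u -> gamma (snd (fst b)) i <= u i) /\
  1 < snd b * marg (fst (fst b)) U.

Definition kapn (n : nat) (b : BS) (x : nat -> R) : R :=
  kap (fst (fst b)) (snd b) (mixn n (snd (fst b)) x) ((/ 3) ^ n).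
Definition appr (n : nat) (b : BS) (x : nat -> R) : Rw -> Prop :=
  trunc (kapn n b x) (mixn n (snd (fst b)) x).

Lemma third_range n : 0 < (/ 3) ^ n <= 1.
Proof.
  split. apply pow_lt; lra. rewrite <- (pow1 n). apply pow_incr. lra.
Qed.

Lemma fibP_base b U : fibP b U -> baseP b.
Proof.
  intros (H1 & H2 & H3 & H4). split; auto. pose proof (scale_pos _ _ _ H4).
  assert (marg (fst (fst b)) U <= marg (fst (fst b)) one_set).
  { apply mu_anti. intros u ->. apply (F_one U H2). }
  nra.
Qed.

Lemma kapn_range n b x : 0 <= kapn n b x <= 1.
Proof. split. apply kap_ge0. apply kap_le1. Qed.

Lemma F_appr n b x : baseP b -> Fset (appr n b x).
Proof. intros [H _]. apply F_trunc. apply kapn_range. now apply F_mixn. Qed.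

Lemma appr_ge n b x i u : appr n b x u -> gamma (snd (fst b)) i <= u i.
Proof. intros [H _]. now apply (mixset_ge _ _ _ _ _ _ H). Qed.

Lemma appr_margin n b x : baseP b ->
  1 + (/ 3) ^ n * (1 - kapn n b x) <= snd b * marg (fst (fst b)) (appr n b x) /\
  slack (fst (fst b)) (snd b) <= 1 - kapn n b x.
Proof.
  intros [H1 H2]. split.
  - apply kapE_kap; auto. now apply F_mixn. apply third_range.
  - apply kap_slack; auto. now apply F_mixn. apply third_range.
Qed.

Lemma appr_cv n (u : nat -> BS) b (x : nat -> nat -> R) x0 :
  (forall j, baseP (u j)) -> baseP b -> lim BS u b ->
  (forall k, (k < netN n)%nat -> Un_cv (fun j => x j k) (x0 k)) ->
  Un_cv (fun j => hd (appr n (u j) (x j)) (appr n b x0)) 0.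
Proof.
  intros Hu Hb [[L1 L2] L3] Lx.
  assert (LV : Un_cv (fun j => hd (mixn n (snd (fst (u j))) (x j)) (mixn n (snd (fst b)) x0)) 0).
  { apply mixn_cv; auto. intro j; apply Hu. apply Hb. }
  assert (LK : Un_cv (fun j => kapn n (u j) (x j)) (kapn n b x0)).
  { apply (kap_cv (fun j => fst (fst (u j))) _ (fun j => snd (u j)) _
      (fun j => mixn n (snd (fst (u j))) (x j))); auto.
    apply third_range. intro; apply F_mixn, Hu. apply F_mixn, Hb. intro j; apply Hu. apply Hb. }
  apply (cv_squeeze _ _ (fun j => hd (mixn n (snd (fst (u j))) (x j)) (mixn n (snd (fst b)) x0)
     + Rabs (kapn n (u j) (x j) - kapn n b x0))).
  - intro j. rewrite Rminus_0_r, Rabs_pos_eq by apply hd_ge0.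
    apply hd_trunc; try apply kapn_range. apply F_mixn, Hu. apply F_mixn, Hb.
  - rewrite <- (Rplus_0_r 0). apply CV_plus; auto. now apply cv_Rabs_iff.
Qed.

Lemma inv8_le n : / 8 ^ n <= / 4 ^ n.
Proof. apply Rinv_le_contravar. apply pow4_pos. apply pow_incr. lra. Qed.

Lemma radius_bound r R0 n : r <= R0 / 4 ^ n -> 2 * (r + / 8 ^ n) <= 2 * (Rabs R0 + 1) * (/ 4) ^ n.
Proof.
  intro H. rewrite pow_inv. pose proof (inv8_le n). pose proof (Rle_abs R0).
  assert (0 < / 4 ^ n) by apply Rinv_0_lt_compat, pow4_pos. unfold Rdiv in H. nra.
Qed.

Lemma appr_p (u : nat -> BS * (Rw -> Prop)) (p : BS * (Rw -> Prop)) R0 :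
  (forall j, fibP (fst (u j)) (snd (u j))) -> fibP (fst p) (snd p) ->
  lim (prodS BS setS) u p ->
  exists n0, forall n j x r, (n0 <= n)%nat -> (n0 <= j)%nat -> r <= R0 / 4 ^ n ->
    (forall k, (k < netN n)%nat -> Rabs (x k - hd (snd (u j)) (netC n k)) <= r) ->
    hd (appr n (fst (u j)) x) (snd (u j)) <= 2 * (r + / 8 ^ n).
Proof.
  intros Hu Hp [[[L1 L2] L3] L4].
  set (t := snd (fst p) * marg (fst (fst (fst p))) (snd p) - 1).
  assert (Ht : 0 < t) by (destruct Hp as (_ & _ & _ & Hp); unfold t; lra).
  assert (C : Un_cv (fun j => snd (fst (u j)) * marg (fst (fst (fst (u j)))) (snd (u j)))
                (snd (fst p) * marg (fst (fst (fst p))) (snd p))).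
  { apply CV_mult; auto. apply (mu_cv _ _ (fun j => fst (fst (fst (u j)))) _ (fun j => snd (u j))); auto.
    intros j w Hw. destruct (Hu j) as (_ & HF & _). now apply (F_cube _ HF). }
  destruct (cv_near _ _ (t / 2) ltac:(lra) C) as [N1 H1].
  destruct (cv_near _ _ 1 Rlt_0_1 L3) as [N2 H2].
  set (v0 := snd (fst p)) in *.
  destruct (small_pow (/ 4) ((v0 + 1) * (2 * (Rabs R0 + 1))) (t / 4) ltac:(lra) ltac:(lra)) as [N3 H3].
  destruct (small_pow (/ 3) 1 (t / 4) ltac:(lra) ltac:(lra)) as [N4 H4].
  exists (max (max N1 N2) (max N3 N4)). intros n j x r Hn Hj Hr H.
  specialize (H1 j ltac:(lia)). specialize (H2 j ltac:(lia)). specialize (H3 n ltac:(lia)).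
  specialize (H4 n ltac:(lia)). apply Rabs_def2 in H1, H2.
  destruct (Hu j) as (K1 & K2 & K3 & K4).
  set (b := fst (u j)) in *. set (U := snd (u j)) in *.
  assert (H2' : snd b - v0 < 1) by apply H2.
  pose proof (mixn_near n (snd (fst b)) x U r K1 K2 K3 H) as D.
  (* Of the reserve [t], half goes to the perturbation along the sequence, a quarter to the mixture
     error and a quarter to [(/ 3) ^ n]. Level [0] is therefore admissible and nothing is
     truncated. *)
  assert (E : kapn n b x = 0).
  { apply Rle_antisym; [|apply kapn_range]. apply kap_le. lra. split. lra.
    rewrite trunc_id. 2: { intros w i Hw. apply (F_cube _ (F_mixn n _ x K1) w Hw). }
    pose proof (marg_lip (fst (fst b)) (mixn n (snd (fst b)) x) U) as L.
    apply Rabs_le_iff in L. pose proof (radius_bound r R0 n Hr).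
    pose proof (scale_pos _ _ _ K4). pose proof (hd_ge0 (mixn n (snd (fst b)) x) U). unfold t in *.
    assert (snd b * hd (mixn n (snd (fst b)) x) U <= (v0 + 1) * (2 * (Rabs R0 + 1) * (/ 4) ^ n)).
    { apply Rmult_le_compat; [lra | auto | lra |]. eapply Rle_trans; eauto. }
    assert (snd b * marg (fst (fst b)) U - snd b * hd (mixn n (snd (fst b)) x) U
      <= snd b * marg (fst (fst b)) (mixn n (snd (fst b)) x)) by nra.
    lra. }
  unfold appr. rewrite E, trunc_id; auto.
  intros w i Hw. apply (F_cube _ (F_mixn n _ x K1) w Hw).
Qed.

Lemma slack_cv (u : nat -> BS) b : (forall j, baseP (u j)) -> baseP b -> lim BS u b ->
  Un_cv (fun j => slack (fst (fst (u j))) (snd (u j))) (slack (fst (fst b)) (snd b)).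
Proof.
  intros Hu Hb [[L1 L2] L3]. unfold slack. apply CV_mult.
  - apply (CV_minus _ (fun _ => _)). 2: apply cv_const. apply CV_mult. exact L3.
    apply (mu_cv _ _ (fun j => fst (fst (u j))) _ (fun _ => one_set)); auto.
    intros _. apply (F_cube _ F_one_set). rewrite hd_refl. apply cv_const.
  - pose proof (scale_pos _ _ _ (proj2 Hb)). apply cv_inv. lra.
    apply (CV_plus _ (fun _ => _)). exact L3. apply cv_const.
Qed.

(** The new mixture is close to [m]; it remains to see that the new truncation does no harm. Once
    its level is at most the old one, it leaves [m] fixed, and truncation at a common level does not
    increase distances. *)
Lemma appr_E (u : nat -> BS) b R0 :
  (forall j, baseP (u j)) -> baseP b -> lim BS u b ->
  exists n0, forall n j x x' r, (n0 <= n)%nat -> (n0 <= j)%nat -> r <= R0 / 4 ^ n ->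
    (forall k, (k < netN (S n))%nat -> Rabs (x' k - hd (appr n (u j) x) (netC (S n) k)) <= r) ->
    hd (appr (S n) (u j) x') (appr n (u j) x) <= 2 * (r + / 8 ^ S n).
Proof.
  intros Hu Hb L. pose proof (slack_range _ _ (proj2 Hb)) as Hs0.
  set (s := slack (fst (fst b)) (snd b)) in *.
  destruct (cv_near _ _ (s / 2) ltac:(lra) (slack_cv u b Hu Hb L)) as [N1 H1].
  destruct L as [[L1 L2] L3].
  destruct (cv_near _ _ 1 Rlt_0_1 L3) as [N2 H2].
  set (v0 := snd b) in *.
  destruct (small_pow (3 / 4) ((v0 + 1) * (2 * (Rabs R0 + 1))) (s / 3) ltac:(lra) ltac:(lra))
    as [N3 H3].
  exists (max (max N1 N2) N3). intros n j x x' r Hn Hj Hr H.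
  specialize (H1 j ltac:(lia)). specialize (H2 j ltac:(lia)). specialize (H3 n ltac:(lia)).
  fold s in H1. apply Rabs_def2 in H1, H2. pose proof (Hu j) as Hbj. set (c := u j) in *.
  assert (H2' : snd c - v0 < 1) by apply H2.
  set (k := kapn n c x) in *. set (m := appr n c x) in *. set (k' := kapn (S n) c x').
  set (V' := mixn (S n) (snd (fst c)) x').
  pose proof (F_appr n c x Hbj) as Fm. fold m in Fm.
  destruct (appr_margin n c x Hbj) as [M1 M2]. fold k in M1, M2. fold m in M1.
  pose proof (kapn_range n c x) as Hk. fold k in Hk.
  assert (FV : Fset V') by (apply F_mixn; apply Hbj).
  pose proof (scale_pos _ _ _ (proj2 Hbj)) as Hv.
  assert (D : hd V' m <= 2 * (r + / 8 ^ S n)).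
  { apply mixn_near; auto. apply Hbj. apply appr_ge. }
  assert (D' : 2 * (r + / 8 ^ S n) <= 2 * (Rabs R0 + 1) * (/ 4) ^ n).
  { eapply Rle_trans; [|apply (radius_bound r R0 n Hr)].
    assert (/ 8 ^ S n <= / 8 ^ n).
    { apply Rinv_le_contravar. apply pow8_pos. cbn [pow]. pose proof (pow8_pos n). lra. }
    lra. }
  assert (Tm : forall l, l <= k -> trunc l m = m).
  { intros l Hl. apply trunc_id. intros w i [_ Hw]. specialize (Hw i). fold k in Hw. lra. }
  (* At level [k] the threshold drops by [2 / 3 * (/ 3) ^ n * (1 - k)] from stage [n] to the next.
     As [1 - k] exceeds [s / 2] near [b], this is at least [(/ 3) ^ n * (s / 3)], which outweighs
     the error of order [(/ 4) ^ n]. *)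
  assert (Hkk : k' <= k).
  { apply kap_le. lra. split. lra.
    pose proof (hd_trunc k k V' m Hk Hk FV Fm) as T. rewrite Rminus_diag, Rabs_R0, (Tm k) in T by lra.
    pose proof (marg_lip (fst (fst c)) (trunc k V') m) as LL. apply Rabs_le_iff in LL.
    fold V'.
    assert (B : snd c * hd V' m <= (v0 + 1) * (2 * (Rabs R0 + 1) * (/ 4) ^ n)).
    { pose proof (hd_ge0 V' m). apply Rmult_le_compat; lra. }
    assert (Q : (v0 + 1) * (2 * (Rabs R0 + 1) * (/ 4) ^ n) <= (/ 3) ^ n * (s / 3)).
    { replace ((/ 4) ^ n) with ((/ 3) ^ n * (3 / 4) ^ n).
      2: { rewrite <- Rpow_mult_distr. f_equal. field. }
      pose proof (third_range n). nra. }
    assert (snd c * marg (fst (fst c)) m - snd c * hd V' m <=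
      snd c * marg (fst (fst c)) (trunc k V')) by nra.
    cbn [pow]. pose proof (third_range n).
    assert ((/ 3) ^ n * (s / 3) <= (/ 3) ^ n * ((2 / 3) * (1 - k))).
    { apply Rmult_le_compat_l; lra. }
    nra. }
  unfold appr at 1. fold k' V'.
  pose proof (kapn_range (S n) c x') as Hk'. fold k' in Hk'.
  rewrite <- (Tm k' Hkk). eapply Rle_trans. apply hd_trunc; auto.
  rewrite Rminus_diag, Rabs_R0. lra.
Qed.

Lemma appr_lim b (x : nat -> nat -> R) R0 n0 : baseP b ->
  (forall n, (n0 <= n)%nat -> hd (appr (S n) b (x (S n))) (appr n b (x n)) <= R0 / 4 ^ n) ->
  exists m, fibP b m /\ Un_cv (fun n => hd (appr n b (x n)) m) 0.
Proof.
  intros Hb H. set (A := Rabs R0 + 1). set (U := fun n => appr n b (x n)).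
  assert (HA : 0 < A) by (unfold A; pose proof (Rabs_pos R0); lra).
  destruct (small_pow (/ 4) A 1 ltac:(lra) Rlt_0_1) as [n1 H1].
  assert (HF : forall n, Fset (U n)) by (intro; now apply F_appr).
  assert (HD : forall n, (max n0 n1 <= n)%nat -> dle (U n) (U (S n)) (A / 4 ^ n)).
  { intros n Hn. specialize (H1 n ltac:(lia)). rewrite pow_inv in H1. apply hd_dle.
    - rewrite hd_sym. eapply Rle_lt_trans. apply (H n); lia.
      apply Rmult_lt_compat_r. apply Rinv_0_lt_compat, pow4_pos. unfold A.
      pose proof (Rle_abs R0). lra.
    - unfold Rdiv. lra. }
  pose proof (klim_hd U A (max n0 n1) HA HD) as K. exists (klim U).
  assert (Cv : Un_cv (fun n => hd (U n) (klim U)) 0).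
  { apply cv0_iff. intro; apply hd_ge0. intros e He.
    destruct (small_pow (/ 4) (2 * A) e ltac:(lra) He) as [n2 H2].
    exists (max (max n0 n1) n2). intros n Hn. specialize (H2 n ltac:(lia)).
    eapply Rle_lt_trans. apply K; lia. rewrite pow_inv in H2. unfold Rdiv. lra. }
  split; auto. split; [apply Hb|split; [|split]].
  - now apply (F_klim U).
  - intros i y Hy. apply (klim_ge U i (gamma (snd (fst b)) i)); auto. intros n u. apply appr_ge.
  (* At stage [n] the reserve is at least [(/ 3) ^ n * s], while the remaining distance to the limit
     costs at most [v * 2 * A / 4 ^ n]; for one large [n] the reserve wins. *)
  - pose proof (slack_range _ _ (proj2 Hb)) as Hs.
    set (s := slack (fst (fst b)) (snd b)) in *. pose proof (scale_pos _ _ _ (proj2 Hb)) as Hv.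
    destruct (small_pow (3 / 4) (snd b * (2 * A)) s ltac:(lra) (proj1 Hs)) as [n2 H2].
    set (n := max (max n0 n1) n2). specialize (H2 n ltac:(lia)). specialize (K n ltac:(lia)).
    destruct (appr_margin n b (x n) Hb) as [M1 M2]. fold s in M2. change (appr n b (x n)) with (U n) in M1.
    pose proof (marg_lip (fst (fst b)) (U n) (klim U)) as LL. apply Rabs_le_iff in LL.
    pose proof (third_range n).
    assert (Q : snd b * (2 * (A / 4 ^ n)) < (/ 3) ^ n * s).
    { replace (A / 4 ^ n) with (A * ((/ 3) ^ n * (3 / 4) ^ n)).
      2: { rewrite <- Rpow_mult_distr. unfold Rdiv at 2. rewrite <- pow_inv. f_equal. f_equal. field. }
      nra. }
    nra.
Qed.

Theorem heq_fib :
  heq (S := prodS (prodS BS setS) Rws) (S' := prodS BS Rws)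
    (prodP (fun p => fibP (fst p) (snd p)) full) (prodP baseP full).
Proof.
  apply (telescope_Rw BS baseP (Rw -> Prop) hd fibP netN (fun n k U => hd U (netC n k)) appr 2).
  - intros [[x p] v]. repeat split; cbn; try (intro; apply cv_const); apply cv_const.
  - apply hd_ge0.
  - apply hd_sym.
  - apply hd_tri.
  - apply hd_refl.
  - intros b m m' (_ & H & _) (_ & H' & _). now apply hd_eq.
  - apply fibP_base.
  - intros n k m m'. pose proof (hd_tri m m' (netC n k)). pose proof (hd_tri m' m (netC n k)).
    rewrite (hd_sym m' m) in H0. apply Rabs_le. lra.
  - intros n u b x x0. apply appr_cv.
  - lra.
  - apply appr_p.
  - apply appr_E.
  - apply appr_lim.
Qed.
End Inside.

(** * Splitting off half-lines *)

Definition imin (i : nat) (U : Rw -> Prop) : R := infc (fun r => exists u, U u /\ u i <= r).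

Lemma imin_le i U u : U u -> 0 <= u i -> imin i U <= u i.
Proof. intros Hu H. apply infc_le; auto. exists u. split; auto; lra. Qed.

Lemma imin_ge i U c : c <= 1 -> (forall u, U u -> c <= u i) -> c <= imin i U.
Proof.
  intros Hc H. apply Rnot_lt_le. intro L. destruct (infc_ex _ _ L Hc) as (r & Hr & u & Hu & K).
  specialize (H u Hu). lra.
Qed.

Lemma imin_lip i U V : imin i V <= imin i U + 2 ^ i * hd U V.
Proof.
  pose proof (pow2_ge1 i) as P. pose proof (hd_ge0 U V) as H0.
  destruct (Rle_lt_dec 1 (hd U V)).
  { pose proof (infc_le1 (fun r => exists u, V u /\ u i <= r)).
    pose proof (infc_ge0 (fun r => exists u, U u /\ u i <= r)). unfold imin. nra. }
  apply le_epsilon. intros e He.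
  set (s := Rmin 1 (hd U V + e / 2 ^ i)).
  assert (Q : 0 < e / 2 ^ i) by (apply Rdiv_lt_0_compat; lra).
  assert (Hs : hd U V < s <= 1) by (unfold s, Rmin; destruct Rle_dec; lra).
  assert (imin i V <= imin i U + 2 ^ i * s).
  { apply infc_shift. nra. intros t Ht (u & Hu & K).
    destruct (proj1 (hd_dle _ _ _ (proj1 Hs) (proj2 Hs)) u Hu) as (v & Hv & L).
    exists v. split; auto. specialize (L i). apply Rabs_le_iff in L. lra. }
  pose proof (Rmin_r 1 (hd U V + e / 2 ^ i)). fold s in H1.
  assert (2 ^ i * (e / 2 ^ i) = e) by (field; lra). nra.
Qed.

Lemma imin_cv i (U : nat -> Rw -> Prop) U0 : Un_cv (fun j => hd (U j) U0) 0 ->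
  Un_cv (fun j => imin i (U j)) (imin i U0).
Proof.
  intro H. apply (cv_squeeze _ _ (fun j => 2 ^ i * hd (U j) U0)).
  - intro j. apply Rabs_le. pose proof (imin_lip i (U j) U0). pose proof (imin_lip i U0 (U j)).
    rewrite (hd_sym U0) in H1. lra.
  - rewrite <- (Rmult_0_r (2 ^ i)). apply (CV_mult (fun _ => _)); auto. apply cv_const.
Qed.

Section Room.
Variable X : Rw -> Prop.

Definition roomP (G : (Rw -> Prop) -> Prop) (z : prodS BS setS) : Prop :=
  G (snd z) /\ (forall i, / imin i (snd z) - 1 <= snd (fst (fst z)) i) /\
  1 < snd (fst z) * marg X (fst (fst (fst z))) (snd z).

(** For fixed [(x, U)] the admissible [p i] and [v] fill half-lines whose endpoints [/ imin i U - 1]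
    and [/ marg X x U] are continuous in [(x, U)]; translation moves the endpoints to [0]. *)
Lemma heq_room (G : (Rw -> Prop) -> Prop) :
  (forall U, G U -> (forall u, U u -> cube u) /\ forall i, 0 < imin i U) ->
  heq (S := prodS (prodS pairS Rws) Rsp) (S' := prodS BS setS)
    (prodP (prodP (inside X G) NN) (fun t => 0 < t)) (roomP G).
Proof.
  intro HG.
  exists (fun z => (((fst (fst (fst z)), fun i => snd (fst z) i + / imin i (snd (fst (fst z))) - 1),
      snd z + / marg X (fst (fst (fst z))) (snd (fst (fst z)))), snd (fst (fst z)))),
    (fun z => (((fst (fst (fst z)), snd z), fun i => snd (fst (fst z)) i - / imin i (snd z) + 1),
      snd (fst z) - / marg X (fst (fst (fst z))) (snd z))).
  assert (K : forall v m, 0 <= m -> 1 < v * m -> 0 < m /\ 0 < v - / m).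
  { intros v m Hm H. assert (0 < m). { destruct Hm as [|E]; auto. rewrite <- E in H. lra. } split; auto. apply (Rmult_lt_reg_r m); auto.
    rewrite Rmult_minus_distr_r, Rinv_l; lra. }
  assert (K' : forall t m, 0 < m -> 0 < t -> 1 < (t + / m) * m).
  { intros t m Hm Ht. rewrite Rmult_plus_distr_r, Rinv_l by lra. nra. }
  split; [|split; [|split]].
  - intros [[[x U] s] t] [[[H1 H2] H3] H4]; cbn in *. split.
    + split; [|split]; cbn; auto. intro i. specialize (H3 i). cbn in H3. lra.
    + repeat f_equal; try ring. apply functional_extensionality; intro i. ring.
  - intros [[[x p] v] U] (H1 & H2 & H3); cbn in *.
    destruct (K v (marg X x U)) as [K1 K2]; auto. apply mu_ge0. split.
    + repeat split; cbn; auto. intro i. specialize (H2 i). lra.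
    + repeat f_equal; try ring. apply functional_extensionality; intro i. ring.
  - intros u z Hu Hz [[[L1 L2] L3] L4]; cbn in *.
    assert (HC : forall j w, snd (fst (fst (u j))) w -> cube w).
    { intros j. apply HG. apply Hu. }
    destruct Hz as [[[Hz1 Hz2] _] _].
    repeat split; cbn.
    + exact L1.
    + intro i. apply (CV_minus _ (fun _ => 1)). apply CV_plus. apply (L3 i). apply cv_inv.
      apply Rgt_not_eq. now apply HG. now apply imin_cv. apply cv_const.
    + apply CV_plus. exact L4. apply cv_inv. apply Rgt_not_eq. exact Hz2.
      apply (mu_cv _ _ (fun j => fst (fst (fst (u j)))) _ (fun j => snd (fst (fst (u j))))); auto.
    + exact L2.
  - intros u z Hu Hz [[[L1 L2] L3] L4]; cbn in *.
    assert (HC : forall j w, snd (u j) w -> cube w).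
    { intros j. apply HG. apply Hu. }
    destruct Hz as (Hz1 & Hz2 & Hz3).
    repeat split; cbn.
    + exact L1.
    + exact L4.
    + intro i. apply (CV_plus _ (fun _ => 1)). apply CV_minus. apply (L2 i). apply cv_inv.
      apply Rgt_not_eq. now apply HG. now apply imin_cv. apply cv_const.
    + apply CV_minus. exact L3. apply cv_inv. apply Rgt_not_eq.
      now apply (K (snd (fst z))); [apply mu_ge0 |].
      apply (mu_cv _ _ (fun j => fst (fst (fst (u j)))) _ (fun j => snd (u j))); auto.
Qed.

Definition boundedF (U : Rw -> Prop) : Prop :=
  Fset U /\ forall i, exists d, 0 < d /\ forall u, U u -> d <= u i.

Lemma boundedF_good U : boundedF U -> (forall u, U u -> cube u) /\ forall i, 0 < imin i U.
Proof.
  intros [H K]. split. apply (F_cube U H). intro i. destruct (K i) as (d & Hd & L).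
  apply Rlt_le_trans with d; auto. apply imin_ge; auto. apply (L ones). apply (F_one U H).
Qed.

Lemma heq_roomP_fib :
  heq (S := prodS BS setS) (S' := prodS BS setS) (roomP boundedF) (fun p => fibP X (fst p) (snd p)).
Proof.
  apply heq_iff. intros [[[x p] v] U]. unfold roomP, fibP, NN, gamma; cbn. split.
  - intros (HF & H & Hv). destruct (boundedF_good U HF) as [HC Hm].
    assert (Q : forall i, 0 <= p i).
    { intro i. specialize (H i). specialize (Hm i).
      assert (/ 1 <= / imin i U). { apply Rinv_le_contravar; auto. apply infc_le1. }
      rewrite Rinv_1 in H0. lra. }
    split; [auto|split; [apply HF|split; [|auto]]]. intros i u Hu. apply Rle_trans with (imin i U).
    + rewrite <- (Rinv_inv (imin i U)). specialize (H i). apply Rinv_le_contravar.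
      now apply Rinv_0_lt_compat. lra.
    + apply imin_le; auto. now apply HC.
  - intros (Hp & HF & Hg & Hv).
    assert (Q : forall i, 0 < / (1 + p i) <= 1) by (intro i; apply (gamma_range p i Hp)).
    assert (B : boundedF U).
    { split; auto. intro i. exists (/ (1 + p i)). split. apply Q. auto. }
    split; [auto|split; [|auto]]. intro i. specialize (Q i).
    assert (/ (1 + p i) <= imin i U) by (apply imin_ge; [lra | auto]).
    apply Rinv_le_contravar in H; [|lra]. rewrite Rinv_inv in H. lra.
Qed.

Lemma imin_one_set i : imin i one_set = 1.
Proof.
  apply Rle_antisym. apply infc_le1. apply imin_ge. lra. intros u ->. unfold ones. lra.
Qed.

Lemma heq_roomP_base :
  heq (S := prodS BS setS) (S' := BS) (roomP (fun U => U = one_set)) (baseP X).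
Proof.
  exists fst, (fun b => (b, one_set)). split; [|split; [|split]].
  - intros [[[x p] v] U] (H1 & H2 & H3); cbn in *. subst U. split; auto. split; cbn; auto.
    intro i. specialize (H2 i). rewrite imin_one_set, Rinv_1 in H2. lra.
  - intros [[x p] v] (H1 & H2); cbn in *. split; auto. split; [|split]; cbn; auto.
    intro i. rewrite imin_one_set, Rinv_1. specialize (H1 i). lra.
  - intros u z _ _ [L _]. exact L.
  - intros u z _ _ L. split. exact L. cbn. rewrite hd_refl. apply cv_const.
Qed.

Lemma heq_absorb_rays (S : space) (P : S -> Prop) :
  heq (S := prodS (prodS (prodS S Rws) Rsp) Rws) (S' := prodS S Rws)
    (prodP (prodP (prodP P NN) (fun t => 0 < t)) full) (prodP P full).
Proof.
  eapply heq_trans. apply heq_assoc. eapply heq_trans. apply heq_assoc.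
  apply heq_prod. apply heq_refl. eapply heq_trans; [|apply heq_halflines].
  apply heq_prod. apply heq_refl. eapply heq_trans. apply heq_prod. apply heq_Rpos.
  apply heq_refl. eapply heq_trans. apply heq_comm. apply heq_Rw_R.
Qed.

(** [heq_stable] creates a factor [R^w], out of which the half-lines of the parameters are taken. *)
Lemma heq_inside_room (G : (Rw -> Prop) -> Prop) :
  (forall U, G U -> (forall u, U u -> cube u) /\ forall i, 0 < imin i U) ->
  heq (S := pairS) (S' := prodS (prodS BS setS) Rws) (inside X G) (prodP (roomP G) full).
Proof.
  intro HG. eapply heq_trans. apply heq_sym, heq_stable. intros U HU. now apply HG.
  eapply heq_trans. apply heq_sym, heq_absorb_rays. apply heq_prod. now apply heq_room.
  apply heq_refl.
Qed.

Theorem heq_collapse :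
  heq (S := pairS) (S' := pairS) (inside X boundedF) (inside X (fun U => U = one_set)).
Proof.
  eapply heq_trans. apply heq_inside_room. apply boundedF_good.
  eapply heq_trans. apply heq_prod. apply heq_roomP_fib. apply heq_refl.
  eapply heq_trans. apply (heq_fib X).
  eapply heq_trans. apply heq_prod. apply heq_sym, heq_roomP_base. apply heq_refl.
  apply heq_sym, heq_inside_room. intros U ->. split. apply (F_cube _ F_one_set).
  intro i. rewrite imin_one_set. lra.
Qed.
End Room.

(** * Compactness in the countable product of lines *)

Definition near (N : nat) (e : R) (a b : Rw) : Prop :=
  forall k, (k < N)%nat -> Rabs (a k - b k) < e.

Lemma near_sym N e a b : near N e a b -> near N e b a.
Proof. intros H k Hk. rewrite Rabs_minus_sym. auto. Qed.

Lemma near_tri N e e' a b c : near N e a b -> near N e' b c -> near N (e + e') a c.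
Proof.
  intros H H' k Hk. specialize (H k Hk). specialize (H' k Hk).
  replace (a k - c k) with ((a k - b k) + (b k - c k)) by ring.
  pose proof (Rabs_triang (a k - b k) (b k - c k)). lra.
Qed.

Lemma near_mono N N' e e' a b : (N <= N')%nat -> e' <= e -> near N' e' a b -> near N e a b.
Proof. intros HN He H k Hk. specialize (H k ltac:(lia)). lra. Qed.

Lemma near_refl N e a : 0 < e -> near N e a a.
Proof. intros He k _. rewrite Rminus_diag, Rabs_R0. auto. Qed.

Lemma cv_near_all (u : nat -> Rw) x : (forall i, Un_cv (fun j => u j i) (x i)) ->
  forall N e, 0 < e -> exists J, forall j, (J <= j)%nat -> near N e (u j) x.
Proof.
  intros H N e He. destruct (eventually_all (fun i j => Rabs (u j i - x i) < e) N) as [J HJ].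
  intros i _. now apply cv_near. exists J. intros j Hj k Hk. now apply HJ.
Qed.

Lemma margin_list (l : list (nat * R)) : exists N d, 0 < d /\
  forall p, In p l -> 0 < snd p -> (fst p <= N)%nat /\ d <= snd p.
Proof.
  induction l as [|[n r] l (N & d & Hd & IH)].
  - exists O, 1. split. lra. intros p [].
  - exists (max n N), (if Rlt_dec 0 r then Rmin r d else d). split.
    { destruct Rlt_dec; auto. apply Rmin_glb_lt; auto. }
    intros p [<-|Hp] H; cbn in *.
    + split. lia. destruct Rlt_dec; [apply Rmin_l | lra].
    + destruct (IH p Hp H). split. lia. destruct Rlt_dec; auto.
      eapply Rle_trans. apply Rmin_r. auto.
Qed.

(** The Lebesgue number argument for the neighbourhoods [near N d]. *)
Lemma compact_margin K U : Defs.compact prod_open K -> prod_open U -> (forall x, K x -> U x) ->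
  exists N d, 0 < d /\ forall a y, K a -> near N d y a -> U y.
Proof.
  intros HK HU H.
  (* Asking for a radius [h] strictly larger than [snd p] makes these sets open; finitely many pairs
     have a common refinement by [margin_list]. *)
  destruct (HK (nat * R)%type (fun p y => 0 < snd p /\ exists h, snd p < h /\
    forall z, near (fst p) h z y -> U z)) as [l Hl].
  - intros [N d] y (Hd & h & Hh & K1); cbn in *. exists N, ((h - d) / 2). split. lra.
    intros y' Hy. split; auto. exists ((h + d) / 2). split. lra. intros z Hz. apply K1.
    replace h with ((h + d) / 2 + (h - d) / 2) by field. now apply (near_tri _ _ _ _ y').
  - intros x Hx. destruct (HU x (H x Hx)) as (N & e & He & K1). exists (N, e / 2). cbn. split. lra.
    exists e. split. lra. exact K1.
  - destruct (margin_list l) as (N & d & Hd & Hm). exists N, d. split; auto.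
    intros a y Ha Hy. destruct (Hl a Ha) as (p & Hp & Hp0 & h & Hh & K1).
    destruct (Hm p Hp Hp0). apply K1. apply (near_mono _ N _ d); auto. lra.
Qed.

Definition seq_closed (K : Rw -> Prop) : Prop :=
  forall y, (forall N e, 0 < e -> exists a, K a /\ near N e a y) -> K y.

Lemma compact_closed K : Defs.compact prod_open K -> seq_closed K.
Proof.
  intros HK y H. apply NNPP. intro Hy.
  destruct (compact_margin K (fun z => z <> y) HK) as (N & d & Hd & K1).
  - intros z Hz. assert (E : exists n, z n <> y n).
    { apply NNPP. intro E. apply Hz. apply functional_extensionality. intro n. apply NNPP.
      intro. apply E. now exists n. }
    destruct E as [n E]. exists (S n), (Rabs (z n - y n)). split. apply Rabs_pos_lt. lra.
    intros w Hw ->. specialize (Hw n ltac:(lia)). rewrite Rabs_minus_sym in Hw. lra.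
  - intros x Hx ->. auto.
  - destruct (H N d Hd) as (a & Ha & Hn). apply (K1 a y); auto. now apply near_sym.
Qed.

Lemma compact_below K i : Defs.compact prod_open K -> exists b, forall a, K a -> b <= a i.
Proof.
  intro HK. destruct (HK nat (fun n y => - INR n < y i)) as [l Hl].
  - intros n y Hy. exists (S i), (y i + INR n). split. lra. intros z Hz.
    specialize (Hz i ltac:(lia)). apply Rabs_def2 in Hz. lra.
  - intros x _. destruct (INR_unbounded (- x i)) as [n Hn]. exists n. lra.
  - assert (Q : exists M, forall n, In n l -> (n <= M)%nat).
    { clear Hl. induction l as [|m l [M IH]]. exists O. intros n [].
      exists (max m M). intros n [<-|Hn]. lia. specialize (IH n Hn). lia. }
    destruct Q as [M HM]. exists (- INR M). intros a Ha. destruct (Hl a Ha) as (n & Hn & L).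
    apply HM, le_INR in Hn. lra.
Qed.

Definition greatest (K : Rw -> Prop) (x : Rw) : Prop := K x /\ forall a, K a -> forall i, a i <= x i.

Lemma mp_max A a b : mp_convex A -> A a -> A b -> A (fun i => Rmax (a i) (b i)).
Proof.
  intros H Ha Hb. replace (fun i => Rmax (a i) (b i)) with (mp_comb 0 0 a b).
  apply H; auto. now apply Rmax_left, Rle_refl.
  apply functional_extensionality. intro i. unfold mp_comb. now rewrite !Rplus_0_l.
Qed.

(* Without a greatest element the open half-spaces [y i < a i], [a] in [K], cover [K];
   the join of the vectors [a] of a finite subcover would avoid that subcover. *)
Lemma compact_greatest K : (exists x, K x) -> Defs.compact prod_open K -> mp_convex K ->
  exists x, greatest K x.
Proof.
  intros [x0 Hx0] HK HC. apply NNPP. intro HN.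
  destruct (HK (Rw * nat)%type (fun p y => K (fst p) /\ y (snd p) < fst p (snd p))) as [l Hl].
  - intros [a i] y [Ha Hy]; cbn in *. exists (S i), (a i - y i). split. lra. intros z Hz.
    split; auto. specialize (Hz i ltac:(lia)). apply Rabs_def2 in Hz. lra.
  - intros x Hx. apply NNPP. intro Q. apply HN. exists x. split; auto. intros a Ha i.
    apply Rnot_lt_le. intro L. apply Q. now exists (a, i).
  - assert (J : exists m, K m /\ forall p, In p l -> K (fst p) -> forall k, fst p k <= m k).
    { clear Hl. induction l as [|[a i] l (m & Hm & IH)].
      - exists x0. split; auto. intros p [].
      - destruct (classic (K a)) as [Ha|Ha].
        + exists (fun k => Rmax (a k) (m k)). split. now apply mp_max.
          intros p [<-|Hp] Hk k; cbn. apply Rmax_l. eapply Rle_trans. now apply IH. apply Rmax_r.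
        + exists m. split; auto. intros p [<-|Hp] Hk k. contradiction. now apply IH. }
    destruct J as (m & Hm & J). destruct (Hl m Hm) as (p & Hp & Hk & L).
    specialize (J p Hp Hk (snd p)). lra.
Qed.

(** * Closed, coordinatewise bounded sets are compact, by bisection *)

Section Cover.
Variables (I : Type) (V : I -> Rw -> Prop).

Definition bad (S : Rw -> Prop) : Prop :=
  ~ exists l : list I, forall x, S x -> exists i, In i l /\ V i x.

Lemma bad_union S S1 S2 : bad S -> (forall x, S x -> S1 x \/ S2 x) -> bad S1 \/ bad S2.
Proof.
  intros H C. apply NNPP. intro Q. apply not_or_and in Q as [Q1 Q2].
  apply NNPP in Q1 as [l1 Q1]. apply NNPP in Q2 as [l2 Q2]. apply H. exists (l1 ++ l2).
  intros x Hx. destruct (C x Hx) as [Hx1|Hx2].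
  - destruct (Q1 x Hx1) as (i & Hi & K). exists i. split; auto. apply in_or_app; auto.
  - destruct (Q2 x Hx2) as (i & Hi & K). exists i. split; auto. apply in_or_app; auto.
Qed.

Lemma bad_coord m h k : forall S c, bad S -> (forall a, S a -> c <= a m <= c + h * 2 ^ k) ->
  exists S', (forall a, S' a -> S a) /\ bad S' /\
    forall a b, S' a -> S' b -> Rabs (a m - b m) <= h.
Proof.
  induction k; intros S c HS Hc.
  - exists S. repeat split; auto. intros a b Ha Hb. apply Hc in Ha, Hb. cbn in *.
    apply Rabs_le. lra.
  - cbn [pow] in Hc.
    destruct (bad_union S (fun a => S a /\ a m <= c + h * 2 ^ k) (fun a => S a /\ c + h * 2 ^ k <= a m) HS)
      as [B|B].
    { intros x Hx. destruct (Rle_lt_dec (x m) (c + h * 2 ^ k)); [left|right]; split; auto; lra. }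
    + destruct (IHk _ c B) as (S' & H1 & H2 & H3).
      { intros a [Ha L]. apply Hc in Ha. lra. }
      exists S'. repeat split; auto. intros a Ha. now apply H1.
    + destruct (IHk _ (c + h * 2 ^ k) B) as (S' & H1 & H2 & H3).
      { intros a [Ha L]. apply Hc in Ha. lra. }
      exists S'. repeat split; auto. intros a Ha. now apply H1.
Qed.

Variable K : Rw -> Prop.
Hypothesis K_bounded : forall i, exists B, forall a, K a -> Rabs (a i) <= B.

Definition small (n : nat) (h : R) (S : Rw -> Prop) : Prop :=
  forall m a b, (m < n)%nat -> S a -> S b -> Rabs (a m - b m) <= h.

Lemma bad_small h n : 0 < h -> forall S, bad S -> (forall a, S a -> K a) ->
  exists S', (forall a, S' a -> S a) /\ bad S' /\ small n h S'.
Proof.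
  intro Hh. induction n; intros S HS HK.
  - exists S. repeat split; auto. intros m a b Hm. lia.
  - destruct (IHn S HS HK) as (S1 & H1 & H2 & H3). destruct (K_bounded n) as [B HB].
    destruct (pow2_unbounded (2 * B / h)) as [k Hk]. apply div_lt_iff in Hk; auto.
    destruct (bad_coord n h k S1 (- B) H2) as (S' & H4 & H5 & H6).
    { intros a Ha. specialize (HB a ltac:(auto)). apply Rabs_le_iff in HB. lra. }
    exists S'. repeat split; auto. intros m a b Hm Ha Hb.
    destruct (Nat.eq_dec m n). subst; auto. apply H3; auto. lia.
Qed.

Fixpoint shrink (n : nat) : Rw -> Prop :=
  match n with
  | O => K
  | S n => epsilon (inhabits K) (fun S' =>
      (forall a, S' a -> shrink n a) /\ bad S' /\ small n ((/ 2) ^ n) S')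
  end.

Lemma shrink_spec n : bad K ->
  (forall a, shrink (S n) a -> shrink n a) /\ bad (shrink (S n)) /\
  small n ((/ 2) ^ n) (shrink (S n)).
Proof.
  intro HK.
  assert (E : forall n, bad (shrink n) -> (forall a, shrink n a -> K a) ->
    (forall a, shrink (S n) a -> shrink n a) /\ bad (shrink (S n)) /\
    small n ((/ 2) ^ n) (shrink (S n))).
  { clear n. intros n Hb Hs. cbn [shrink].
    match goal with |- context [epsilon ?i ?P] => apply (epsilon_spec i P) end.
    apply bad_small; auto. apply pow_lt; lra. }
  assert (Q : forall n, bad (shrink n) /\ forall a, shrink n a -> K a).
  { clear n. induction n as [|n [B1 B2]]. split; auto.
    destruct (E n B1 B2) as (E1 & E2 & E3). split; auto. }
  apply E; apply Q.
Qed.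

Lemma shrink_mono n m a : bad K -> (n <= m)%nat -> shrink m a -> shrink n a.
Proof.
  intros HK H. induction H; auto. intro Ha. apply IHle. now apply (shrink_spec m HK).
Qed.

Hypothesis K_closed : seq_closed K.
Hypothesis V_open : forall i, prod_open (V i).
Hypothesis V_cover : forall x, K x -> exists i, V i x.

(** Points chosen in the nested sets [shrink] converge to a point [y] of [K]. A member of the cover
    containing [y] contains some whole [shrink] set, which thus has a one-element subcover. *)
Lemma not_bad : ~ bad K.
Proof.
  intro HK.
  assert (P : forall n, exists a, shrink (S n) a).
  { intro n. apply NNPP. intro Q. apply (proj1 (proj2 (shrink_spec n HK))). exists nil.
    intros x Hx. destruct Q. now exists x. }
  destruct (choice (fun n a => shrink (S n) a) P) as [a Ha].
  assert (D : forall p q m, (m < p)%nat -> (p <= q)%nat ->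
    forall b, shrink (S p) b -> Rabs (b m - a q m) <= (/ 2) ^ p).
  { intros p q m Hm Hq b Hb. apply (proj2 (proj2 (shrink_spec p HK))); auto.
    apply (shrink_mono _ (S q)); auto. lia. }
  assert (Sm : forall e, 0 < e -> exists n0, forall n, (n0 <= n)%nat -> (/ 2) ^ n < e).
  { intros e He. destruct (small_pow (/ 2) 1 e ltac:(lra) He) as [n0 Hn].
    exists n0. intros n H. specialize (Hn n H). lra. }
  assert (C : forall m, exists l, Un_cv (fun n => a n m) l).
  { intro m. destruct (R_complete (fun n => a n m)) as [l Hl]; [|now exists l].
    intros e He. destruct (Sm (e / 2) ltac:(lra)) as [n0 Hn]. set (p := max n0 (S m)).
    exists p. intros q q' Hq Hq'. specialize (Hn p ltac:(lia)).
    pose proof (D p q m ltac:(lia) ltac:(lia) (a p) (Ha p)) as D1.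
    pose proof (D p q' m ltac:(lia) ltac:(lia) (a p) (Ha p)) as D2.
    unfold Rdist. apply Rabs_le_iff in D1, D2. apply Rabs_def1; lra. }
  destruct (choice (fun m l => Un_cv (fun n => a n m) l) C) as [y Hy].
  assert (L : forall p m b, (m < p)%nat -> shrink (S p) b -> Rabs (b m - y m) <= (/ 2) ^ p).
  { intros p m b Hm Hb. apply (cv_le (fun n => Rabs (b m - a (n + p)%nat m))).
    - apply cv_abs. apply (CV_minus (fun _ => _)). apply cv_const.
      intros e He. destruct (Hy m e He) as [N HN]. exists N. intros n Hn. apply HN. lia.
    - intro n. apply D; auto. lia. }
  assert (N : forall N e, 0 < e -> exists p, forall b, shrink (S p) b -> near N e b y).
  { intros N e He. destruct (Sm e He) as [n0 Hn]. exists (max n0 N). intros b Hb k Hk.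
    eapply Rle_lt_trans. apply (L (max n0 N)); auto. lia. apply Hn. lia. }
  assert (Ky : K y).
  { apply K_closed. intros M e He. destruct (N M e He) as [p Hp]. exists (a p). split.
    apply (shrink_mono O (S p)); auto. lia. apply Hp. apply Ha. }
  destruct (V_cover y Ky) as [i Hi]. destruct (V_open i y Hi) as (M & e & He & HV).
  destruct (N M e He) as [p Hp]. apply (proj1 (proj2 (shrink_spec p HK))). exists (i :: nil).
  intros x Hx. exists i. split. now left. apply HV. now apply Hp.
Qed.
End Cover.

Lemma closed_bounded_compact K : seq_closed K ->
  (forall i, exists B, forall a, K a -> Rabs (a i) <= B) -> Defs.compact prod_open K.
Proof.
  intros HC HB I V HV Hx. apply NNPP. now apply (not_bad I V K).
Qed.

(** * Max-plus convex sets as pairs of a point and a set in the cube *)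

Lemma exp_lip s t : s <= 0 -> t <= 0 -> Rabs (exp s - exp t) <= Rabs (s - t).
Proof.
  assert (E : forall a b, a <= b -> b <= 0 -> exp b - exp a <= b - a).
  { intros a b Hab Hb. replace a with (b + (a - b)) at 1 by ring. rewrite exp_plus.
    pose proof (exp_ineq1_le (a - b)). pose proof (exp_pos b). pose proof (exp_pos (a - b)).
    assert (exp b <= 1). { rewrite <- exp_0. destruct Hb as [Hb| ->]; [left; now apply exp_increasing | lra]. }
    nra. }
  assert (M : forall a b, a <= b -> exp a <= exp b).
  { intros a b [H| ->]; [left; now apply exp_increasing | lra]. }
  intros Hs Ht. destruct (Rle_lt_dec s t) as [L|L].
  - specialize (E s t L Ht). specialize (M s t L). rewrite Rabs_left1, (Rabs_left1 (s - t)) by lra. lra.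
  - specialize (E t s ltac:(lra) Hs). specialize (M t s ltac:(lra)).
    rewrite Rabs_right, (Rabs_right (s - t)) by lra. lra.
Qed.

Lemma ln_lip d u v : 0 < d -> d <= u -> d <= v -> Rabs (ln u - ln v) <= Rabs (u - v) / d.
Proof.
  intro Hd.
  assert (E : forall a b, d <= a -> a <= b -> ln a <= ln b <= ln a + (b - a) / d).
  { intros a b Ha Hab. split.
    - destruct Hab as [Hab| ->]; [left; apply ln_increasing; lra | lra].
    - replace b with (a * (b / a)) at 1 by (field; lra).
      rewrite ln_mult; [|lra|apply Rdiv_lt_0_compat; lra]. apply Rplus_le_compat_l.
      assert (Q : 0 < b / a) by (apply Rdiv_lt_0_compat; lra).
      pose proof (exp_ineq1_le (ln (b / a))). rewrite exp_ln in H by auto.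
      assert (b / a - 1 <= (b - a) / d); [|lra].
      replace (b / a - 1) with ((b - a) / a) by (field; lra). unfold Rdiv.
      apply Rmult_le_compat_l. lra. apply Rinv_le_contravar; lra. }
  intros Hu Hv. unfold Rdiv in *. destruct (Rle_lt_dec u v) as [L|L].
  - specialize (E u v Hu L). rewrite !Rabs_left1 by lra. lra.
  - specialize (E v u Hv ltac:(lra)). rewrite !Rabs_right by lra. lra.
Qed.

Lemma exp_gap s t d : 0 < d -> d <= Rabs (t - s) ->
  (1 - exp (- d)) * exp s <= Rabs (exp s - exp t).
Proof.
  intros Hd H. pose proof (exp_pos s).
  replace (exp t) with (exp s * exp (t - s)) by (rewrite <- exp_plus; f_equal; ring).
  replace (exp s - exp s * exp (t - s)) with (exp s * (1 - exp (t - s))) by ring.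
  rewrite Rabs_mult, (Rabs_right (exp s)) by lra. rewrite Rmult_comm.
  apply Rmult_le_compat_l. lra.
  pose proof (exp_ineq1_le (- d)). pose proof (exp_ineq1_le (t - s)).
  destruct (Rcase_abs (t - s)) as [L|L].
  - rewrite Rabs_left in H by auto. assert (exp (t - s) <= exp (- d)).
    { destruct (Req_dec (t - s) (- d)) as [->|]. lra. left. apply exp_increasing. lra. }
    pose proof (Rle_abs (1 - exp (t - s))). lra.
  - rewrite Rabs_right in H by auto. pose proof (Rle_abs (- (1 - exp (t - s)))).
    rewrite Rabs_Ropp in H3. lra.
Qed.

Definition lift (x u : Rw) : Rw := fun i => x i + ln (u i).
Definition unlift (x a : Rw) : Rw := fun i => exp (a i - x i).

Lemma lift_unlift x a : lift x (unlift x a) = a.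
Proof. apply functional_extensionality. intro i. unfold lift, unlift. rewrite ln_exp. ring. Qed.

Lemma unlift_lift x u : (forall i, 0 < u i) -> unlift x (lift x u) = u.
Proof.
  intro H. apply functional_extensionality. intro i. unfold lift, unlift.
  replace (x i + ln (u i) - x i) with (ln (u i)) by ring. now apply exp_ln.
Qed.

Lemma lift_ones x : lift x ones = x.
Proof. apply functional_extensionality. intro i. unfold lift, ones. rewrite ln_1. ring. Qed.

(** Otherwise [lift x u] itself is a point outside [X] at capped distance [0], and the margin
    vanishes. *)
Lemma mu_inside X x U u : 0 < mu all_idx X x U -> U u -> (forall i, 0 < u i) -> X (lift x u).
Proof.
  intros H Hu P. apply NNPP. intro Hn. assert (mu all_idx X x U <= 0); [|lra].
  apply infc_le. lra. exists u, (lift x u). repeat split; auto. intros i _.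
  pose proof (unlift_lift x u P) as E. apply (f_equal (fun w => w i)) in E. unfold unlift in E.
  rewrite E, Rminus_diag, Rabs_R0, Rmin_right by lra. pose proof (pow2_pos i). lra.
Qed.

Lemma common_lower (P : nat -> R -> Prop) N :
  (forall i r s, P i r -> s <= r -> P i s) -> (forall i, exists d, 0 < d /\ P i d) ->
  exists d, 0 < d /\ forall i, (i < N)%nat -> P i d.
Proof.
  intros Hm H. induction N as [|N (d & Hd & IH)].
  - exists 1. split. lra. intros; lia.
  - destruct (H N) as (d' & Hd' & K). exists (Rmin d d'). split. now apply Rmin_glb_lt.
    intros i Hi. destruct (Nat.eq_dec i N).
    + subst. apply (Hm _ _ _ K). apply Rmin_r.
    + apply (Hm i d). apply IH. lia. apply Rmin_l.
Qed.

Lemma mu_pos X x U N d : 0 < d -> (forall i, exists e, 0 < e /\ forall u, U u -> e <= u i) ->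
  (forall u z, U u -> near N d z (lift x u) -> X z) -> 0 < mu all_idx X x U.
Proof.
  intros Hd HU H.
  destruct (common_lower (fun i r => forall u, U u -> r <= u i) N) as (e & He & HE); auto.
  { intros i r s Hr Hs u Hu. specialize (Hr u Hu). lra. }
  pose proof (exp_pos (- d)). assert (Q : exp (- d) < 1).
  { rewrite <- exp_0. apply exp_increasing. lra. }
  (* By [exp_gap], a displacement of at least [d] in the logarithm changes a value that is at least
     [e] by [(1 - exp (- d)) * e] or more; dividing by [2 ^ N] accounts for the coordinate
     weights. *)
  set (c := Rmin 1 ((1 - exp (- d)) * e)).
  assert (Hc : 0 < c) by (apply Rmin_glb_lt; nra).
  assert (Hc1 : c <= 1) by apply Rmin_l.
  pose proof (pow2_pos N) as P. pose proof (pow2_ge1 N) as P1.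
  assert (Hcp : 0 < c / 2 ^ N) by now apply Rdiv_lt_0_compat.
  apply Rlt_le_trans with (c / 2 ^ N); auto. apply Rnot_lt_le. intro L.
  destruct (infc_ex _ _ L) as (r & Hr & u & z & Hu & Hz & K).
  { apply div_le_iff; lra. }
  apply Hz. apply (H u z Hu). intros k Hk. apply Rnot_le_lt. intro B.
  specialize (K k Logic.I).
  assert (Hek : e <= u k) by now apply HE.
  pose proof (exp_gap (ln (u k)) (z k - x k) d Hd) as G. rewrite exp_ln in G by lra.
  unfold lift in B. replace (z k - x k - ln (u k)) with (z k - (x k + ln (u k))) in G by ring.
  specialize (G B).
  assert ((1 - exp (- d)) * e <= (1 - exp (- d)) * u k) by (apply Rmult_le_compat_l; lra).
  assert (c <= Rmin 1 (Rabs (u k - exp (z k - x k)))).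
  { apply Rmin_glb; auto. pose proof (Rmin_r 1 ((1 - exp (- d)) * e)). fold c in H2. lra. }
  assert (2 ^ k <= 2 ^ N) by (apply Rle_pow; [lra | lia]).
  destruct Hr as [Hr0 Hr]. apply (Rmult_lt_compat_r (2 ^ N)) in Hr; auto.
  replace (c / 2 ^ N * 2 ^ N) with c in Hr by (field; lra).
  assert (2 ^ k * r <= 2 ^ N * r) by (apply Rmult_le_compat_r; auto). lra.
Qed.

Lemma heq_points X : prod_open X ->
  heq (S := Rws) (S' := pairS) X (inside X (fun U => U = one_set)).
Proof.
  intro HX. exists (fun x => (x, one_set)), fst. split; [|split; [|split]].
  - intros x Hx. split; auto. split; cbn; auto. destruct (HX x Hx) as (N & d & Hd & K).
    apply (mu_pos X x one_set N d Hd).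
    + intro i. exists 1. split. lra. intros u ->. unfold ones. lra.
    + intros u z -> Hz. rewrite lift_ones in Hz. now apply K.
  - intros [x U] [E H]; cbn in *. subst U. split; auto. rewrite <- (lift_ones x).
    apply (mu_inside X x one_set); auto. reflexivity. intro. unfold ones. lra.
  - intros u x _ _ L. split. exact L. cbn. rewrite hd_refl. apply cv_const.
  - intros u x _ _ [L _]. exact L.
Qed.

Definition close (N : nat) (e : R) (A B : Rw -> Prop) : Prop :=
  (forall a, A a -> exists b, B b /\ near N e a b) /\
  (forall b, B b -> exists a, A a /\ near N e b a).

(** Hausdorff convergence for the product uniformity; on compact sets it is linked to the Vietoris
    topology by [vietoris_eventually] and [vietoris_close]. *)
Definition hypS : space := Space (Rw -> Prop) (fun A B =>
  forall N e, 0 < e -> exists J, forall j, (J <= j)%nat -> close N e (A j) B).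

Definition lift_set (x : Rw) (U : Rw -> Prop) : Rw -> Prop :=
  fun a => exists u, U u /\ a = lift x u.
Definition unlift_set (x : Rw) (A : Rw -> Prop) : Rw -> Prop :=
  fun u => exists a, A a /\ u = unlift x a.
Definition top (A : Rw -> Prop) : Rw := epsilon (inhabits ones) (greatest A).

Lemma greatest_unique A x y : greatest A x -> greatest A y -> x = y.
Proof.
  intros [H K] [H' K']. apply functional_extensionality. intro i.
  apply Rle_antisym; auto.
Qed.

Lemma top_greatest X A : mpcc X A -> greatest A (top A).
Proof.
  intros (H1 & H2 & H3 & _). apply (epsilon_spec (inhabits ones) (greatest A)).
  now apply compact_greatest.
Qed.

Lemma boundedF_pos U u : boundedF U -> U u -> forall i, 0 < u i.
Proof. intros [_ H] Hu i. destruct (H i) as (d & Hd & L). specialize (L u Hu). lra. Qed.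

Lemma ln_le0 t : 0 < t <= 1 -> ln t <= 0.
Proof.
  intros [H [L| ->]]. rewrite <- ln_1. left. now apply ln_increasing. rewrite ln_1. lra.
Qed.

Lemma lift_greatest x U : boundedF U -> greatest (lift_set x U) x.
Proof.
  intro HU. split.
  - exists ones. split. apply (F_one U), HU. now rewrite lift_ones.
  - intros a (u & Hu & ->) i. unfold lift.
    pose proof (boundedF_pos U u HU Hu i). pose proof (F_cube U (proj1 HU) u Hu i).
    pose proof (ln_le0 (u i)). lra.
Qed.

Lemma exp_le1 t : t <= 0 -> exp t <= 1.
Proof.
  intros [H| ->]. rewrite <- exp_0. left. now apply exp_increasing. rewrite exp_0. lra.
Qed.

Lemma unlift_cube A x a : greatest A x -> A a -> cube (unlift x a).
Proof.
  intros [_ H] Ha i. unfold unlift. split. left. apply exp_pos. apply exp_le1.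
  specialize (H a Ha i). lra.
Qed.

Lemma rle_cube N u v e : 0 < e -> 1 <= 2 ^ N * e -> cube u -> cube v ->
  (forall i, (i < N)%nat -> Rabs (u i - v i) <= e) -> rle u v e.
Proof.
  intros He HN Hu Hv H i. pose proof (pow2_ge1 i). destruct (Nat.lt_ge_cases i N).
  - specialize (H i H1). nra.
  - assert (2 ^ N <= 2 ^ i) by (apply Rle_pow; [lra | auto]).
    specialize (Hu i). specialize (Hv i). apply Rabs_le. nra.
Qed.

Lemma level e : 0 < e -> exists N, 1 <= 2 ^ N * e.
Proof.
  intro He. destruct (pow2_unbounded (/ e)) as [N HN]. exists N.
  apply (Rmult_lt_compat_r e) in HN; auto. rewrite Rinv_l in HN; lra.
Qed.

(** A limit [y] still lies below [x], so [unlift x y] is in the cube, and [exp] is 1-Lipschitz on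
    nonpositive numbers. *)
Lemma lift_closed x U : boundedF U -> seq_closed (lift_set x U).
Proof.
  intros HU y Hy. exists (unlift x y). split; [|now rewrite lift_unlift].
  destruct (lift_greatest x U HU) as [_ G].
  assert (Hx : forall i, y i <= x i).
  { intro i. apply le_epsilon. intros e He. destruct (Hy (S i) e He) as (a & Ha & Hn).
    specialize (G a Ha i). specialize (Hn i ltac:(lia)). apply Rabs_def2 in Hn. lra. }
  apply (F_closed U (proj1 HU)). intros e He.
  destruct (level e He) as [N HN]. destruct (Hy N e He) as (a & (u & Hu & ->) & Hn).
  exists u. split; auto. apply (rle_cube N); auto.
  - apply (F_cube U); auto. apply HU.
  - intro i. unfold unlift. split. left. apply exp_pos. apply exp_le1. specialize (Hx i). lra.
  - intros i Hi. specialize (Hn i Hi). unfold lift in Hn. unfold unlift.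
    pose proof (boundedF_pos U u HU Hu i) as P. rewrite <- (exp_ln (u i)) by auto.
    pose proof (F_cube U (proj1 HU) u Hu i) as C. specialize (Hx i).
    eapply Rle_trans. apply exp_lip. apply ln_le0; lra. lra.
    replace (ln (u i) - (y i - x i)) with (x i + ln (u i) - y i) by ring. lra.
Qed.

Lemma lift_mpcc X x U : inside X boundedF (x, U) -> mpcc X (lift_set x U).
Proof.
  intros [HU Hm]; cbn in *. pose proof (lift_greatest x U HU) as [G1 G2].
  split; [now exists x|split; [|split]].
  - apply closed_bounded_compact. now apply lift_closed.
    intro i. destruct (proj2 HU i) as (d & Hd & L). exists (Rabs (x i) + Rabs (ln d)).
    intros a Ha. pose proof (G2 a Ha i). destruct Ha as (u & Hu & ->). specialize (L u Hu).
    unfold lift in *. assert (ln d <= ln (u i)).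
    { destruct L as [L| ->]; [left; now apply ln_increasing | lra]. }
    pose proof (Rle_abs (x i)). pose proof (Rle_abs (- x i)). rewrite Rabs_Ropp in H2.
    pose proof (Rle_abs (- ln d)). rewrite Rabs_Ropp in H3. pose proof (Rabs_pos (ln d)).
    apply Rabs_le. lra.
  - assert (C : forall u v t, U u -> U v -> t <= 0 ->
      lift_set x U (fun i => Rmax (lift x u i) (t + lift x v i))).
    { intros u v t Hu Hv Ht. exists (fun i => Rmax (u i) (exp t * v i)). split.
      - apply (F_conv U (proj1 HU)); auto. split. left. apply exp_pos. now apply exp_le1.
      - apply functional_extensionality. intro i. unfold lift.
        pose proof (boundedF_pos U u HU Hu i) as Pu. pose proof (boundedF_pos U v HU Hv i) as Pv.
        pose proof (exp_pos t) as Pt.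
        assert (E : ln (exp t * v i) = t + ln (v i)) by (rewrite ln_mult, ln_exp; auto).
        assert (Pw : 0 < exp t * v i) by now apply Rmult_lt_0_compat.
        unfold Rmax at 2. destruct (Rle_dec (u i) (exp t * v i)) as [L|L].
        + rewrite E, Rmax_right. ring. assert (ln (u i) <= t + ln (v i)); [|lra]. rewrite <- E.
          destruct L as [L| ->]; [left; now apply ln_increasing | lra].
        + rewrite Rmax_left. reflexivity. assert (t + ln (v i) <= ln (u i)); [|lra]. rewrite <- E.
          left. apply ln_increasing; lra. }
    intros a b s t (u & Hu & ->) (v & Hv & ->) H. unfold mp_comb.
    (* Whichever of [s], [t] equals [0] marks the unscaled vector; the other is nonpositive, as [C]
       requires. *)
    unfold Rmax in H. destruct (Rle_dec s t) as [L|L]; subst.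
    + assert (E : (fun n => Rmax (s + lift x u n) (0 + lift x v n)) =
        (fun n => Rmax (lift x v n) (s + lift x u n))).
      { apply functional_extensionality. intro n. now rewrite Rmax_comm, Rplus_0_l. }
      rewrite E. now apply C.
    + assert (E : (fun n => Rmax (0 + lift x u n) (t + lift x v n)) =
        (fun n => Rmax (lift x u n) (t + lift x v n))).
      { apply functional_extensionality. intro n. now rewrite Rplus_0_l. }
      rewrite E. apply C; auto; lra.
  - intros a (u & Hu & ->). apply (mu_inside X x U); auto. now apply boundedF_pos with U.
Qed.

Lemma unlift_inside X A : prod_open X -> mpcc X A ->
  inside X boundedF (top A, unlift_set (top A) A).
Proof.
  intros HX HA. pose proof (top_greatest X A HA) as G. set (x := top A) in *.
  destruct HA as (H1 & H2 & H3 & H4). destruct G as [G1 G2].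
  assert (B : forall i, exists e, 0 < e /\ forall u, unlift_set x A u -> e <= u i).
  { intro i. destruct (compact_below A i H2) as [b Hb]. exists (exp (b - x i)).
    split. apply exp_pos. intros u (a & Ha & ->). unfold unlift. specialize (Hb a Ha).
    destruct (Req_dec b (a i)) as [->|]. lra. left. apply exp_increasing. lra. }
  split; cbn.
  - split; auto. split.
    + intros u (a & Ha & ->). now apply (unlift_cube A).
    + exists x. split; auto. apply functional_extensionality. intro i. unfold ones, unlift.
      now rewrite Rminus_diag, exp_0.
    + intros u v t (a & Ha & ->) (b & Hb & ->) Ht.
      (* A zero factor corresponds to the coefficient minus infinity, where the combination is just
         the first vector. *)
      destruct (Req_dec t 0) as [->|Hn].
      { exists a. split; auto. apply functional_extensionality. intro i. unfold unlift.
        rewrite Rmult_0_l. apply Rmax_left. left. apply exp_pos. }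
      exists (mp_comb 0 (ln t) a b). split.
      { apply H3; auto. apply Rmax_left. apply ln_le0. lra. }
      apply functional_extensionality. intro i. unfold unlift, mp_comb.
      rewrite <- (exp_ln t) at 1 by lra. rewrite <- exp_plus, Rplus_0_l.
      unfold Rmax at 2. destruct (Rle_dec (a i) (ln t + b i)) as [L|L].
      * rewrite Rmax_right. f_equal. ring.
        destruct (Req_dec (a i) (ln t + b i)) as [E|E].
        right. f_equal. lra. left. apply exp_increasing. lra.
      * rewrite Rmax_left. reflexivity. left. apply exp_increasing. lra.
    + intros y Hy.
      assert (P : forall i, exists d, 0 < d /\ d <= y i /\ forall a, A a -> d <= unlift x a i).
      { intro i. destruct (B i) as (d & Hd & L). exists d. repeat split; auto.
        - apply le_epsilon. intros e He. pose proof (pow2_pos i).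
          destruct (Hy (e / 2 ^ i)) as (u & Hu & K). now apply Rdiv_lt_0_compat.
          specialize (K i). replace (2 ^ i * (e / 2 ^ i)) with e in K by (field; lra).
          specialize (L u Hu). apply Rabs_le_iff in K. lra.
        - intros a Ha. apply L. now exists a. }
      exists (lift x y). split.
      2: { symmetry. apply unlift_lift. intro i. destruct (P i) as (d & Hd & L & _). lra. }
      apply (compact_closed A H2). intros N e He.
      destruct (common_lower (fun i d => d <= y i /\ forall a, A a -> d <= unlift x a i) N)
        as (d & Hd & K); auto.
      { intros i r s [K1 K2] Hs. split. lra. intros a Ha. specialize (K2 a Ha). lra. }
      pose proof (pow2_pos N) as PN.
      (* Above [d] the logarithm has Lipschitz constant [/ d], and the weights of the first [N]
         coordinates are at most [2 ^ N]. *)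
      destruct (Hy (e * d / 2 / 2 ^ N)) as (u & (a & Ha & ->) & R).
      { repeat (apply Rdiv_lt_0_compat; [|lra]). nra. }
      exists a. split; auto. intros i Hi. destruct (K i Hi) as [K1 K2]. specialize (K2 a Ha).
      pose proof (ln_lip d _ _ Hd K2 K1) as L. specialize (R i).
      replace (ln (unlift x a i)) with (a i - x i) in L by (unfold unlift; now rewrite ln_exp).
      unfold lift. replace (a i - (x i + ln (y i))) with (a i - x i - ln (y i)) by ring.
      eapply Rle_lt_trans. exact L. apply div_lt_iff; auto. eapply Rle_lt_trans. exact R.
      assert (2 ^ i <= 2 ^ N) by (apply Rle_pow; [lra | lia]).
      assert (0 < e * d) by now apply Rmult_lt_0_compat.
      assert (0 < e * d / 2 / 2 ^ N) by (repeat (apply Rdiv_lt_0_compat; [|lra]); auto).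
      apply Rle_lt_trans with (2 ^ N * (e * d / 2 / 2 ^ N)). now apply Rmult_le_compat_r; [left|].
      replace (2 ^ N * (e * d / 2 / 2 ^ N)) with (e * d / 2) by (field; lra). lra.
  - destruct (compact_margin A X H2 HX H4) as (N & d & Hd & K).
    apply (mu_pos X x _ N d Hd B). intros u z (a & Ha & ->) Hz. rewrite lift_unlift in Hz.
    now apply (K a).
Qed.

Lemma lift_set_cv (u : nat -> pairS) p : (forall j, boundedF (snd (u j))) -> boundedF (snd p) ->
  lim pairS u p -> lim hypS (fun j => lift_set (fst (u j)) (snd (u j))) (lift_set (fst p) (snd p)).
Proof.
  intros Hu Hp [L1 L2] N e He.
  destruct (common_lower (fun i r => forall w, snd p w -> r <= w i) N) as (d & Hd & K).
  { intros i r s Hr Hs w Hw. specialize (Hr w Hw). lra. } { apply Hp. }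
  pose proof (pow2_pos N) as PN. pose proof (pow2_ge1 N) as PN1.
  (* The bound [d / 2] keeps perturbed values above [d / 2], where [ln] has Lipschitz constant
     [2 / d]; the second bound then limits the change of [ln] to [e / 2]. The outer [1] serves
     [hd_dle]. *)
  set (h := Rmin 1 (Rmin (d / 2) (e / 2 * (d / 2)) / 2 ^ N)).
  assert (M0 : 0 < Rmin (d / 2) (e / 2 * (d / 2))) by (apply Rmin_glb_lt; nra).
  assert (Hh : 0 < h) by (apply Rmin_glb_lt; [lra | now apply Rdiv_lt_0_compat]).
  destruct (proj1 (cv0_iff _ (fun j => hd_ge0 _ _)) L2 h Hh) as [J2 H2].
  destruct (cv_near_all _ _ L1 N (e / 2) ltac:(lra)) as [J1 H1].
  exists (max J1 J2). intros j Hj. specialize (H1 j ltac:(lia)). specialize (H2 j ltac:(lia)).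
  apply hd_dle in H2; [|apply Rmin_l].
  assert (C : forall w v, snd p v -> rle w v h -> near N e (lift (fst (u j)) w) (lift (fst p) v)).
  { intros w v Hv R i Hi. specialize (R i). specialize (K i Hi v Hv). specialize (H1 i Hi).
    assert (2 ^ i <= 2 ^ N) by (apply Rle_pow; [lra | lia]).
    assert (Rabs (w i - v i) <= Rmin (d / 2) (e / 2 * (d / 2))).
    { eapply Rle_trans. exact R. pose proof (Rmin_r 1 (Rmin (d / 2) (e / 2 * (d / 2)) / 2 ^ N)).
      fold h in H0. apply Rle_trans with (2 ^ N * h). apply Rmult_le_compat_r; lra.
      apply (Rmult_le_compat_l (2 ^ N)) in H0; [|lra].
      replace (2 ^ N * (Rmin (d / 2) (e / 2 * (d / 2)) / 2 ^ N)) with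
        (Rmin (d / 2) (e / 2 * (d / 2))) in H0 by (field; lra). auto. }
    pose proof (Rmin_l (d / 2) (e / 2 * (d / 2))). pose proof (Rmin_r (d / 2) (e / 2 * (d / 2))).
    assert (Q : Rabs (w i - v i) <= d / 2) by lra. apply Rabs_le_iff in Q.
    pose proof (ln_lip (d / 2) (w i) (v i) ltac:(lra) ltac:(lra) ltac:(lra)) as L.
    assert (L' : Rabs (ln (w i) - ln (v i)) <= e / 2).
    { eapply Rle_trans. exact L. apply div_le_iff; lra. }
    unfold lift. replace (fst (u j) i + ln (w i) - (fst p i + ln (v i))) with
      ((fst (u j) i - fst p i) + (ln (w i) - ln (v i))) by ring.
    assert (H1' : Rabs (fst (u j) i - fst p i) < e / 2) by exact H1.
    pose proof (Rabs_triang (fst (u j) i - fst p i) (ln (w i) - ln (v i))). lra. }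
  split.
  - intros a (w & Hw & ->). destruct (proj1 H2 w Hw) as (v & Hv & R). exists (lift (fst p) v).
    split. now exists v. now apply C.
  - intros a (v & Hv & ->). destruct (proj2 H2 v Hv) as (w & Hw & R). exists (lift (fst (u j)) w).
    split. now exists w. apply near_sym, C; auto. now apply rle_sym.
Qed.

(** The top of each set is near an element of the other set, and that element lies below the other
    top; this gives both inequalities. *)
Lemma top_cv (A : nat -> Rw -> Prop) B :
  (forall j, greatest (A j) (top (A j))) -> greatest B (top B) ->
  lim hypS A B -> forall i, Un_cv (fun j => top (A j) i) (top B i).
Proof.
  intros HA [HB1 HB2] L i e He. destruct (L (S i) e He) as [J HJ]. exists J. intros j Hj.
  destruct (HJ j Hj) as [C1 C2]. destruct (HA j) as [G1 G2].
  destruct (C1 _ G1) as (b & Hb & N1). destruct (C2 _ HB1) as (a & Ha & N2).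
  specialize (N1 i ltac:(lia)). specialize (N2 i ltac:(lia)). specialize (HB2 b Hb i).
  specialize (G2 a Ha i). apply Rabs_def2 in N1, N2. unfold Rdist. apply Rabs_def1; lra.
Qed.

Lemma unlift_set_cv (A : nat -> Rw -> Prop) B :
  (forall j, greatest (A j) (top (A j))) -> greatest B (top B) ->
  lim hypS A B -> Un_cv (fun j => hd (unlift_set (top (A j)) (A j)) (unlift_set (top B) B)) 0.
Proof.
  intros HA HB L. apply cv0_iff. intro; apply hd_ge0. intros e He.
  destruct (level (e / 2) ltac:(lra)) as [N HN].
  destruct (L N (e / 4) ltac:(lra)) as [J1 H1].
  destruct (cv_near_all _ _ (top_cv A B HA HB L) N (e / 4) ltac:(lra)) as [J2 H2].
  exists (max J1 J2). intros j Hj. specialize (H1 j ltac:(lia)). specialize (H2 j ltac:(lia)).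
  apply Rle_lt_trans with (e / 2); [|lra]. apply hd_le. lra.
  assert (C : forall a b, A j a -> B b -> near N (e / 4) a b ->
    rle (unlift (top (A j)) a) (unlift (top B) b) (e / 2)).
  { intros a b Ha Hb Hn. apply (rle_cube N); auto. lra. now apply (unlift_cube (A j)).
    now apply (unlift_cube B). intros i Hi. specialize (Hn i Hi). specialize (H2 i Hi).
    pose proof (proj2 (HA j) a Ha i). pose proof (proj2 HB b Hb i). unfold unlift.
    eapply Rle_trans. apply exp_lip; lra. apply Rabs_def2 in Hn, H2. apply Rabs_le. lra. }
  destruct H1 as [C1 C2]. split.
  - intros u (a & Ha & ->). destruct (C1 a Ha) as (b & Hb & Hn). exists (unlift (top B) b).
    split. now exists b. now apply C.
  - intros u (b & Hb & ->). destruct (C2 b Hb) as (a & Ha & Hn). exists (unlift (top (A j)) a).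
    split. now exists a. apply rle_sym, C; auto. now apply near_sym.
Qed.

Theorem heq_mpcc X : prod_open X -> heq (S := pairS) (S' := hypS) (inside X boundedF) (mpcc X).
Proof.
  intro HX. exists (fun p => lift_set (fst p) (snd p)), (fun A => (top A, unlift_set (top A) A)).
  split; [|split; [|split]].
  - intros [x U] H; cbn [fst snd]. pose proof (lift_mpcc X x U H) as K. split; auto.
    assert (E : top (lift_set x U) = x).
    { apply (greatest_unique (lift_set x U)). now apply (top_greatest X). apply lift_greatest, H. }
    rewrite E. f_equal. apply pred_ext. intro u. destruct H as [HU _]; cbn in HU. split.
    + intros (a & (w & Hw & ->) & ->). rewrite unlift_lift; auto. now apply boundedF_pos with U.
    + intro Hu. exists (lift x u). split. now exists u.
      rewrite unlift_lift; auto. now apply boundedF_pos with U.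
  - intros A HA. split. now apply unlift_inside. cbn. apply pred_ext. intro a. split.
    + intros (u & (b & Hb & ->) & ->). now rewrite lift_unlift.
    + intro Ha. exists (unlift (top A) a). split. now exists a. now rewrite lift_unlift.
  - intros u p Hu Hp L. apply lift_set_cv; auto. intro j; apply Hu. apply Hp.
  - intros A B HA HB L. assert (GA : forall j, greatest (A j) (top (A j))).
    { intro j. now apply (top_greatest X). }
    assert (GB : greatest B (top B)) by now apply (top_greatest X).
    split. intro i. now apply (top_cv A B GA GB). now apply unlift_set_cv.
Qed.

(** * The Vietoris topology and convergence of compact sets *)

(** Compactness of [B] turns an upper condition into a uniform margin around [B]; a lower condition
    only needs a neighbourhood of one point. *)
Lemma vietoris_eventually A B W : Defs.compact prod_open B -> lim hypS A B ->
  vietoris_open W -> W B -> exists J, forall j, (J <= j)%nat -> W (A j).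
Proof.
  intros HB L HW HWB. destruct (HW B HWB) as (l & Hl & HlB & Q).
  assert (E : exists J, forall j, (J <= j)%nat -> forall S, In S l -> S (A j)).
  { clear Q. induction l as [|S l IH].
    - exists O. intros j _ S [].
    - destruct IH as [J1 H1]; try (intros; try apply Hl; try apply HlB; now right).
      assert (K : exists J, forall j, (J <= j)%nat -> S (A j)).
      { pose proof (HlB S (or_introl eq_refl)) as SB.
        destruct (Hl S (or_introl eq_refl)) as (U & HU & [HS|HS]); apply HS in SB.
        - destruct (compact_margin B U HB HU SB) as (N & d & Hd & K).
          destruct (L N d Hd) as [J HJ]. exists J. intros j Hj. apply HS. intros a Ha.
          destruct (proj1 (HJ j Hj) a Ha) as (b & Hb & Hn). now apply (K b).
        - destruct SB as (b & Hb & Ub). destruct (HU b Ub) as (N & d & Hd & K).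
          destruct (L N d Hd) as [J HJ]. exists J. intros j Hj. apply HS.
          destruct (proj2 (HJ j Hj) b Hb) as (a & Ha & Hn). exists a. split; auto.
          apply K. now apply near_sym. }
      destruct K as [J2 H2]. exists (max J1 J2). intros j Hj S' [<-|HS'].
      apply H2; lia. apply H1; auto; lia. }
  destruct E as [J HJ]. exists J. intros j Hj. apply Q. now apply HJ.
Qed.

Lemma near_open N e a : prod_open (fun y => near N e y a).
Proof.
  intros y Hy. revert Hy. induction N; intro Hy.
  - exists O, 1. split. lra. intros z _ k Hk. lia.
  - destruct IHN as (M & d & Hd & K). { intros k Hk. apply Hy. lia. }
    pose proof (Hy N ltac:(lia)) as HN. set (r := e - Rabs (y N - a N)).
    exists (max M (S N)), (Rmin d r). split. apply Rmin_glb_lt; unfold r; lra.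
    intros z Hz k Hk. destruct (Nat.eq_dec k N) as [->|].
    + specialize (Hz N ltac:(lia)). pose proof (Rmin_r d r). unfold r in *.
      pose proof (Rabs_triang (z N - y N) (y N - a N)).
      replace (z N - y N + (y N - a N)) with (z N - a N) in H0 by ring. lra.
    + apply K; [|lia]. intros m Hm. specialize (Hz m ltac:(lia)). pose proof (Rmin_l d r). lra.
Qed.

Lemma union_open (I : Type) (V : I -> Rw -> Prop) : (forall i, prod_open (V i)) ->
  prod_open (fun y => exists i, V i y).
Proof.
  intros H y [i Hi]. destruct (H i y Hi) as (N & e & He & K). exists N, e. split; auto.
  intros z Hz. exists i. now apply K.
Qed.

(** One upper set built around all of [A] controls the elements of [B]; lower sets at a finite
    [e / 2]-net of [A] keep every point of [A] near [B]. *)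
Lemma vietoris_close A N e : Defs.compact prod_open A -> 0 < e ->
  exists l, (forall S, In S l -> vietoris_subbasic S) /\ (forall S, In S l -> S A) /\
    forall B, (forall S, In S l -> S B) -> close N e B A.
Proof.
  intros HA He. set (I := {a : Rw | A a}).
  destruct (HA I (fun i y => near N (e / 2) y (proj1_sig i))) as [l Hl].
  { intro i. apply near_open. }
  { intros x Hx. exists (exist _ x Hx). apply near_refl. lra. }
  exists (upper_set (fun y => exists i : I, near N e y (proj1_sig i)) ::
    map (fun i : I => lower_set (fun y => near N (e / 2) y (proj1_sig i))) l).
  split; [|split].
  - intros S [<-|HS].
    + eexists. split. 2: { left. reflexivity. } apply union_open. intro; apply near_open.
    + apply in_map_iff in HS as (i & <- & _). eexists. split. 2: { right. reflexivity. }
      apply near_open.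
  - intros S [<-|HS].
    + intros a Ha. exists (exist _ a Ha). now apply near_refl.
    + apply in_map_iff in HS as ([a Ha] & <- & _). exists a. split; auto. apply near_refl. lra.
  - intros B HB. split.
    + intros b Hb. destruct (HB _ (or_introl eq_refl) b Hb) as [[a Ha] Hn]. now exists a.
    + intros a Ha. destruct (Hl a Ha) as (i & Hi & Hn).
      destruct (HB (lower_set (fun y => near N (e / 2) y (proj1_sig i)))) as (b & Hb & Hn').
      { right. apply in_map_iff. now exists i. }
      exists b. split; auto. replace e with (e / 2 + e / 2) by field.
      apply (near_tri _ _ _ _ (proj1_sig i)); auto. now apply near_sym.
Qed.

Lemma inv_level N e : 0 < e -> exists J, forall j, (J <= j)%nat -> (N <= j)%nat /\ / (INR j + 1) <= e.
Proof.
  intro He. destruct (INR_unbounded (/ e)) as [n Hn]. exists (max N n). intros j Hj. split. lia.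
  assert (INR n <= INR j) by (apply le_INR; lia). rewrite <- (Rinv_inv e).
  apply Rinv_le_contravar. now apply Rinv_0_lt_compat. lra.
Qed.

Lemma proj1_sig_inj (T : Type) (P : T -> Prop) (x y : {t | P t}) :
  proj1_sig x = proj1_sig y -> x = y.
Proof.
  destruct x as [x Hx], y as [y Hy]; cbn. intros <-. f_equal. apply proof_irrelevance.
Qed.

(* Both topologies are first countable, so sequential continuity is enough. *)
Lemma heq_homeomorphic X : prod_open X -> heq (S := Rws) (S' := hypS) X (mpcc X) ->
  homeomorphic (subspace_top prod_open X) (subspace_top vietoris_open (mpcc X)).
Proof.
  intros HX (f & g & Hf & Hg & Cf & Cg).
  assert (Inv : forall j, 0 < / (INR j + 1)).
  { intro j. apply Rinv_0_lt_compat. pose proof (pos_INR j). lra. }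
  exists (fun x => exist _ (f (proj1_sig x)) (proj1 (Hf _ (proj2_sig x)))),
    (fun A => exist _ (g (proj1_sig A)) (proj1 (Hg _ (proj2_sig A)))).
  split; [|split; [|split]].
  - intros [x Hx]. apply proj1_sig_inj. cbn. now apply Hf.
  - intros [A HA]. apply proj1_sig_inj. cbn. now apply Hg.
  (* Openness of [X] keeps all nearby points in the domain of [f], so this set is open in the whole
     space. *)
  - intros V (W & HW & HV). exists (fun x => X x /\ W (f x)). split.
    + intros x [Hx Wx]. apply NNPP. intro Q. destruct (HX x Hx) as (N & e & He & HN).
      assert (P : forall j, exists y, near j (/ (INR j + 1)) y x /\ X y /\ ~ W (f y)).
      { intro j. apply NNPP. intro P. apply Q. exists (max j N), (Rmin (/ (INR j + 1)) e).
        split. now apply Rmin_glb_lt. intros y Hy.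
        assert (Xy : X y). { apply HN. apply (near_mono _ (max j N) _ (Rmin (/ (INR j + 1)) e)); auto.
          lia. apply Rmin_r. }
        split; auto. apply NNPP. intro Wy. apply P. exists y. repeat split; auto.
        apply (near_mono _ (max j N) _ (Rmin (/ (INR j + 1)) e)); auto. lia. apply Rmin_l. }
      destruct (choice _ P) as [y Hy].
      assert (L : lim Rws y x).
      { intros i d Hd. destruct (inv_level (S i) d Hd) as [J HJ]. exists J. intros j Hj.
        destruct (HJ j Hj) as [H1 H2]. destruct (Hy j) as [Hn _].
        apply (near_mono (S i) j d _ _ _ H1 H2 Hn). lia. }
      destruct (vietoris_eventually (fun j => f (y j)) (f x) W) as [J HJ]; auto.
      { apply (Hf x Hx). } { apply Cf; auto. intro j. apply Hy. }
      destruct (Hy J) as (_ & _ & HW'). apply HW', HJ. lia.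
    + intros [x Hx]. rewrite HV. cbn. tauto.
  - intros V (W & HW & HV).
    (* [g] is controlled only on [mpcc X], so the open set is the union of all basic neighbourhoods
       whose members in [mpcc X] are sent into [W]. *)
    exists (fun B => exists l, (forall S, In S l -> vietoris_subbasic S) /\ (forall S, In S l -> S B) /\
      forall B', mpcc X B' -> (forall S, In S l -> S B') -> W (g B')).
    split.
    + intros B (l & H1 & H2 & H3). exists l. repeat split; auto. intros B' HB'. exists l. auto.
    + intros [A HA]. rewrite HV. cbn. split; [|now intros (l & _ & H2 & H3); apply H3].
      intro WA. apply NNPP. intro Q.
      assert (P : forall j, exists B, close j (/ (INR j + 1)) B A /\ mpcc X B /\ ~ W (g B)).
      { intro j. apply NNPP. intro P. apply Q.
        destruct (vietoris_close A j (/ (INR j + 1))) as (l & H1 & H2 & H3); auto. apply HA.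
        exists l. repeat split; auto. intros B HB HS. apply NNPP. intro WB. apply P.
        exists B. split; [now apply H3 | split; auto]. }
      destruct (choice _ P) as [B HB].
      assert (L : lim hypS B A).
      { intros N d Hd. destruct (inv_level N d Hd) as [J HJ]. exists J. intros j Hj.
        destruct (HJ j Hj) as [H1 H2]. destruct (HB j) as [[C1 C2] _]. split.
        - intros a Ha. destruct (C1 a Ha) as (b & Hb & Hn). exists b. split; auto.
          now apply (near_mono N j d (/ (INR j + 1))).
        - intros b Hb. destruct (C2 b Hb) as (a & Ha & Hn). exists a. split; auto.
          now apply (near_mono N j d (/ (INR j + 1))). }
      assert (Lg : lim Rws (fun j => g (B j)) (g A)).
      { apply Cg; auto. intro j. apply HB. }
      destruct (HW (g A) WA) as (N & e & He & K).
      destruct (cv_near_all _ _ Lg N e He) as [J HJ].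
      destruct (HB J) as (_ & _ & HW'). apply HW', K. apply HJ. lia.
Qed.

Theorem theorem4p3 (X : Rw -> Prop) :
  prod_open X -> (exists x, X x) ->
  homeomorphic (subspace_top prod_open X) (subspace_top vietoris_open (mpcc X)).
Proof.
  intros HX _. apply heq_homeomorphic; auto.
  eapply heq_trans. now apply heq_points. eapply heq_trans. apply heq_sym, heq_collapse.
  now apply heq_mpcc.
Qed.
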